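(* Let $p$ be a prime. For any prime number $u\ne p$, there exist natural numbers $m$ and $m'$ (possibly $0$) such that, in $\mathbf{On}_p$, $\alpha_u=[\chi_{f(u)}+m]=\chi_{f(u)}+m'$.
   Context: Conventions. $p$ is a fixed prime. An expression in square brackets $[\cdots]$ is evaluated with ordinary ordinal arithmetic; unbracketed operations on ordinals are those of $\mathbf{On}_p$. An ordinal $\alpha$ is also identified with the set of all smaller ordinals, so $\beta\in\alpha$ means $\beta<\alpha$; an ordinal is called a field if this set is a field under the operations of $\mathbf{On}_p$. In bracketed sums such as $[\sum\phi^\delta\alpha_\delta]$, the terms are taken in decreasing order of exponent $\delta$. Definition of $\mathbf{On}_p$. $\mathbf{On}_p$ is the Class of all ordinals with addition and multiplication defined along an increasing chain of ordinals $\phi_\Delta$ ($\Delta$ an ordinal), each a field of characteristic $p$ whose operations extend those of the earlier ones: $\phi_0=p$ with arithmetic modulo $p$; for $\Delta$ a limit, $\phi_\Delta=\sup_{\Delta'<\Delta}\phi_{\Delta'}$; for $\Delta$ a successor, write $\phi=\phi_{[\Delta-1]}$, $\widetilde\phi=\phi_\Delta$, and: (i) If $\phi$ is not algebraically closed, let $n$ be the smallest positive integer such that some polynomial of degree $n$ in $\phi[x]$ has no root in $\phi$, and let $h(x)\in\phi[x]$ (of degree $<n$) be the lexicographically earliest polynomial such that $g(x)=x^n-h(x)$ has no root in $\phi$ (comparing coefficients, as ordinals, from the highest power of $x$ down). Then $\widetilde\phi=[\phi^n]$, and the operations on $\widetilde\phi$ are transported from $\phi[x]/\langle g(x)\rangle$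 through the bijection $\theta\left(\left[\sum_{i=0}^{n-1}\phi^i\alpha_i\right]\right)=\sum_{i=0}^{n-1}x^i\alpha_i+\langle g(x)\rangle$ ($\alpha_i\in\phi$). (ii) If $\phi$ is algebraically closed, then $\widetilde\phi=[\phi^\phi]$, and the operations are transported from the rational function field $\phi(x)$ through the bijection $\theta\left(\left[\sum_i\phi^{\omega+\omega\alpha_i+n_i}\beta_i+\sum_j\phi^{m_j}\delta_j\right]\right)=\sum_i\frac{\beta_i}{(x-\alpha_i)^{n_i+1}}+\sum_j x^{m_j}\delta_j$ (finite sums, $\alpha_i,\beta_i,\delta_j\in\phi$, $n_i,m_j\in\omega$; partial fractions). The ordinal $[\omega^{\omega^\omega}]$ is the smallest ordinal that is an algebraically closed field in $\mathbf{On}_p$; each of its elements is algebraic over the field $p=\{0,\dots,p-1\}$. For $\alpha\in[\omega^{\omega^\omega}]$, $d(\alpha)$ is the degree of the minimal polynomial of $\alpha$ over the field $p$. For a prime $u$, let $k$ be the number of primes less than $u$; the field $\chi_u$ is $[p^{\omega^k}]$. For every positive integer $h$, $\chi_h$ denotes the smallest ordinal $\alpha\in[\omega^{\omega^\omega}]$ such that $h$ divides $d(\alpha)$ (so $\chi_1=0$; this agrees with the previous definition when $h=u$ is prime). For a prime $u\ne p$, $\alpha_u$ is the smallest ordinal in the field $\chi_u$ having no $u$th root in $\chi_u$; $\zeta_u$ is a primitive $u$th root of unity in $[\omega^{\omega^\omega}]$, and $f(u)=d(\zeta_u)$. *)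

(* Defs.v *)
From HB Require Import structures.
From mathcomp Require Import all_boot all_order all_algebra.
From mathcomp Require Import generic_quotient qpoly fraction.
From mathcomp Require Import boolp classical_sets.

Set Implicit Arguments.
Unset Strict Implicit.
Unset Printing Implicit Defensive.

Import Order.TTheory GRing.Theory.
Local Open Scope quotient_scope.
Local Open Scope order_scope.

(** [onode A f] stands for the least ordinal above all the [f i]; the type of
    ordinals is the quotient of these trees by mutual comparison. The index
    types [A] live in a universe below that of [Ord], so that the "sets" of
    ordinals are the families indexed by such types; [ord_bounded] below states
    that every such family is bounded. *)

Inductive otree : Type := onode (A : Type) of A -> otree.

Fixpoint tle (s t : otree) : Prop :=
  match s, t with
  | onode A f, onode B g => forall i : A, exists j : B, tle (f i) (g j)
  end.

Lemma tle_refl s : tle s s.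
Proof. by elim: s => A f IH /= i; exists i. Qed.

Lemma tle_trans s t u : tle s t -> tle t u -> tle s u.
Proof.
elim: s t u => A f IH [B g] [C h] /= st tu i.
have [j fg] := st i; have [k gh] := tu j; exists k; exact: IH fg gh.
Qed.

Definition tlt (s t : otree) : Prop :=
  match t with onode B g => exists j : B, tle s (g j) end.

Lemma tle_or_tlt s t : tle s t \/ tlt t s.
Proof.
elim: s t => A f IH [B g] /=.
have [H|/existsNP[i Hi]] := pselect (forall i, exists j, tle (f i) (g j)).
  by left.
right; exists i; case Efi: (f i) => [C h] j.
have [fg|] := IH i (g j); first by case: Hi; exists j.
by rewrite Efi.
Qed.

Lemma tlt_tle s t : tlt s t -> tle s t.
Proof.
elim: s t => A f IH [B g] /= [j st] i.
exists j; apply: IH; case: (g j) st => C h /= st; exact: st.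
Qed.

Lemma tlt_irr t : ~ tlt t t.
Proof.
elim: t => A f IH /= [i H]; apply: (IH i).
by case: {-1}(f i) (erefl (f i)) H => B g E /(_ i); rewrite E.
Qed.

HB.instance Definition _ := gen_eqMixin otree.
HB.instance Definition _ := gen_choiceMixin otree.

Definition teqv (s t : otree) : bool := `[< tle s t /\ tle t s >].

Lemma teqv_refl : reflexive teqv.
Proof. by move=> s; apply/asboolP; split; exact: tle_refl. Qed.

Lemma teqv_sym : symmetric teqv.
Proof. by move=> s t; apply/asboolP/asboolP => -[? ?]. Qed.

Lemma teqv_trans : transitive teqv.
Proof.
move=> t s u /asboolP[st ts] /asboolP[tu ut].
by apply/asboolP; split; [exact: tle_trans tu | exact: tle_trans ts].
Qed.

Canonical teqv_equiv := EquivRel teqv teqv_refl teqv_sym teqv_trans.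

Definition Ord : Type := {eq_quot teqv}.
HB.instance Definition _ := Choice.on Ord.
HB.instance Definition _ := EqQuotient.on Ord.

Definition ole (a b : Ord) : bool := `[< tle (repr a) (repr b) >].

Lemma ole_refl : reflexive ole.
Proof. by move=> a; apply/asboolP; exact: tle_refl. Qed.

Lemma ole_anti : antisymmetric ole.
Proof.
move=> a b /andP[/asboolP ab /asboolP ba].
rewrite -[a]reprK -[b]reprK; apply/eqquotP; exact/asboolP.
Qed.

Lemma ole_trans : transitive ole.
Proof.
move=> b a c /asboolP ab /asboolP bc; apply/asboolP; exact: tle_trans ab bc.
Qed.

Lemma ole_total : total ole.
Proof.
move=> a b; have [ab|/tlt_tle ba] := tle_or_tlt (repr a) (repr b).
  by apply/orP; left; apply/asboolP.
by apply/orP; right; apply/asboolP.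
Qed.

Fact ord_display : Order.disp_t. Proof. exact: (Order.Disp tt tt). Qed.

HB.instance Definition _ :=
  Order.Le_isPOrder.Build ord_display Ord ole_refl ole_anti ole_trans.
HB.instance Definition _ :=
  Order.POrder_isTotal.Build ord_display Ord ole_total.

Lemma leOrdE (a b : Ord) : (a <= b) = ole a b. Proof. by []. Qed.

Lemma tle_pi t : tle (repr (\pi_Ord t)) t /\ tle t (repr (\pi_Ord t)).
Proof.
have : \pi_Ord (repr (\pi_Ord t)) = \pi_Ord t by rewrite reprK.
by move/eqquotP/asboolP.
Qed.

Lemma ltOrd_wf : well_founded (fun a b : Ord => a < b).
Proof.
suff H t (a : Ord) : tle (repr a) t -> Acc (fun a b : Ord => a < b) a.
  by move=> a; apply: (H (repr a)); exact: tle_refl.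
elim: t a => A f IH a le_at; constructor=> b.
rewrite ltNge leOrdE => /asboolP nab.
have [//|] := tle_or_tlt (repr a) (repr b).
case: (repr a) le_at => C h /= hf [k bh].
have [i hi] := hf k; exact: (IH i b (tle_trans bh hi)).
Qed.

Lemma ord_bounded (A : Type) (f : A -> Ord) : exists b, forall i, f i < b.
Proof.
exists (\pi_Ord (onode (fun i => repr (f i)))) => i.
rewrite ltNge leOrdE; apply/asboolP => H.
have {H} := tle_trans (proj2 (tle_pi _)) H.
case E : (repr (f i)) => [B g] /= /(_ i); rewrite E => H.
exact: (@tlt_irr (onode g)).
Qed.

Definition ozero : Ord := \pi_Ord (onode (fun i : Empty_set => match i with end)).

(** The least element of a class of ordinals ([0] for the empty class). *)
Definition oleast (P : set Ord) : Ord :=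
  xget ozero [set a | P a /\ forall b, P b -> a <= b].

Lemma oleastP (P : set Ord) :
  (exists a, P a) -> P (oleast P) /\ forall b, P b -> oleast P <= b.
Proof.
case=> a Pa; apply: (@xgetPex _ ozero [set a | P a /\ forall b, P b -> a <= b]).
elim: (ltOrd_wf a) Pa => {}a _ IH Pa.
have [[b [ltba Pb]]|no] := pselect (exists b, b < a /\ P b).
  exact: IH ltba Pb.
exists a; split=> // b Pb; rewrite leNgt; apply/negP => ltba.
by apply: no; exists b.
Qed.

(** Transfinite recursion: [G] is given the values at the smaller ordinals
    (extended by [dflt] elsewhere) and the ordinal itself. *)
Definition orec (T : Type) (dflt : T) (G : (Ord -> T) -> Ord -> T) : Ord -> T :=
  Fix ltOrd_wf (fun _ => T) (fun a rec =>
    G (fun b => if pselect (b < a) is left h then rec b h else dflt) a).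

Lemma orecE (T : Type) (dflt : T) (G : (Ord -> T) -> Ord -> T) (a : Ord) :
  orec dflt G a = G (fun b => if b < a then orec dflt G b else dflt) a.
Proof.
rewrite {1}/orec Fix_eq => [|x f g fg]; last first.
  by congr (G _ x); apply/funext => b; case: pselect.
congr (G _ a); apply/funext => b.
by case: pselect => [h|/negP/negbTE ->//]; rewrite h.
Qed.

(** [osucc], [osup], [oadd], [omul], [opow] and [obracket] are ordinary ordinal
    arithmetic, i.e. the operations in square brackets; [On_add] and [On_mul]
    below are the unbracketed ones. *)

Definition osucc (a : Ord) : Ord := oleast [set b | a < b].

Definition osup (P : set Ord) : Ord := oleast [set b | forall a, P a -> a <= b].

Definition oadd (a : Ord) : Ord -> Ord :=
  orec ozero (fun add b =>
    oleast [set c | a <= c /\ forall b', b' < b -> add b' < c]).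

Definition omul (a : Ord) : Ord -> Ord :=
  orec ozero (fun mul b =>
    oleast [set c | forall b', b' < b -> oadd (mul b') a <= c]).

Definition onat (n : nat) : Ord := iter n osucc ozero.

(** The usual power for a positive base. *)
Definition opow (a : Ord) : Ord -> Ord :=
  orec ozero (fun pow b =>
    oleast [set c | onat 1 <= c /\ forall b', b' < b -> omul (pow b') a <= c]).

Definition omega : Ord := osup (range onat).

(** [obracket phi [:: (d1, a1); (d2, a2); ...]] is the bracketed sum
    [phi^d1 a1 + phi^d2 a2 + ...], with the terms added from left to right. *)
Definition obracket (phi : Ord) (s : seq (Ord * Ord)) : Ord :=
  foldr (fun t acc => oadd (omul (opow phi t.1) t.2) acc) ozero s.

(** A stage carries the ordinal [phi_Delta] with its two operations; the values
    of the operations outside [phi_Delta] are irrelevant. *)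
Record stage := Stage {
  bound : Ord;
  sadd : Ord -> Ord -> Ord;
  smul : Ord -> Ord -> Ord
}.

HB.instance Definition _ := gen_eqMixin stage.
HB.instance Definition _ := gen_choiceMixin stage.

(** The set of ordinals below [bound S], with the operations of [S], is a field:
    it is isomorphic to [F] through [e]. *)
Definition stage_field (F : fieldType) (e : F -> Ord) (S : stage) : Prop :=
  [/\ injective e,
      forall a, a < bound S <-> exists x, e x = a,
      forall x y, e (x + y)%R = sadd S (e x) (e y)
    & forall x y, e (x * y)%R = smul S (e x) (e y)].

(** The operations of [S] are those of the ring [R], where [code a x] means that
    the ordinal [a] corresponds to [x] in [R]. *)
Definition transported (R : pzRingType) (code : Ord -> R -> Prop) (S : stage) :
    Prop :=
  forall a b x y, code a x -> code b y ->
    code (sadd S a b) (x + y)%R /\ code (smul S a b) (x * y)%R.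

Definition rootless (F : fieldType) (q : {poly F}) : Prop :=
  forall x, ~~ root q x.

Definition first_degree (F : fieldType) (n : nat) : Prop :=
  let bad m := (0 < m)%N /\ exists q : {poly F}, size q = m.+1 /\ rootless q in
  bad n /\ forall m, bad m -> (n <= m)%N.

Definition lex_lt (F : fieldType) (e : F -> Ord) (h h' : {poly F}) : Prop :=
  exists i : nat, e (h`_i)%R < e (h'`_i)%R /\
    forall j : nat, (i < j)%N -> (h`_j = h'`_j)%R.

Definition first_poly (F : fieldType) (e : F -> Ord) (n : nat) (h : {poly F}) :
    Prop :=
  let bad (k : {poly F}) := (size k <= n)%N /\ rootless ('X^n - k)%R in
  bad h /\ forall k, bad k -> k <> h -> lex_lt e h k.

(** [{poly %/ g}] is [F[x]/<g>], each class being represented by its polynomial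
    of degree less than [n]. *)
Definition alg_code (F : fieldType) (e : F -> Ord) (phi : Ord) (n : nat)
    (g : {poly F}) (a : Ord) (x : {poly %/ g}) : Prop :=
  a = obracket phi
        [seq (onat i, e ((x : {poly F})`_i)%R) | i <- rev (iota 0 n)].

(** A triple [(alpha, n, beta)] stands for [beta / (x - alpha)^(n+1)], a pair
    [(m, delta)] for [x^m delta]. *)
Definition fraction_value (F : fieldType) (s : seq (F * nat * F))
    (t : seq (nat * F)) : {fraction {poly F}} :=
  ((\sum_(u <- s) (let: (alpha, n, beta) := u in
      tofrac beta%:P / tofrac ('X - alpha%:P) ^+ n.+1))
   + \sum_(u <- t) (let: (m, delta) := u in tofrac ('X^m * delta%:P)))%R.

Definition fraction_terms (F : fieldType) (e : F -> Ord)
    (s : seq (F * nat * F)) (t : seq (nat * F)) : seq (Ord * Ord) :=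
  [seq (let: (alpha, n, beta) := u in
        (oadd (oadd omega (omul omega (e alpha))) (onat n), e beta)) | u <- s]
  ++ [seq (let: (m, delta) := u in (onat m, e delta)) | u <- t].

Definition trans_code (F : fieldType) (e : F -> Ord) (phi : Ord) (a : Ord)
    (r : {fraction {poly F}}) : Prop :=
  exists s t,
    [/\ sorted (fun d d' : Ord => d' < d)
          [seq term.1 | term <- fraction_terms e s t],
        a = obracket phi (fraction_terms e s t)
      & r = fraction_value s t].

Definition next_stage (S S' : stage) : Prop :=
  exists (F : fieldType) (e : F -> Ord), stage_field e S /\
    (~ GRing.closed_field_axiom F /\
       (exists n h, [/\ first_degree F n, first_poly e n h,
          bound S' = opow (bound S) (onat n)
        & transported (@alg_code F e (bound S) n ('X^n - h)%R) S'])
     \/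
     GRing.closed_field_axiom F /\
       bound S' = opow (bound S) (bound S) /\
       transported (@trans_code F e (bound S)) S').

(** The union of the stages [f D], [D] in [I]: two ordinals are combined in the
    first of these stages that contains them both. *)
Definition union_op (op : stage -> Ord -> Ord -> Ord) (f : Ord -> stage)
    (I : set Ord) (a b : Ord) : Ord :=
  op (f (oleast [set D | [/\ I D, a < bound (f D) & b < bound (f D)]])) a b.

Definition nat_of_Ord (a : Ord) : nat := xget 0%N [set n | onat n = a].

Definition stage0 (p : nat) : stage :=
  Stage (onat p)
    (fun a b => onat ((nat_of_Ord a + nat_of_Ord b) %% p)%N)
    (fun a b => onat ((nat_of_Ord a * nat_of_Ord b) %% p)%N).

(** At a successor, [next_stage] determines the bound and, below that bound, the
    operations. *)
Definition On_stage (p : nat) : Ord -> stage :=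
  orec (stage0 p) (fun prev D =>
    if D == ozero then stage0 p
    else if pselect (exists D', D = osucc D') then
      let S := prev (oleast [set D' | D = osucc D']) in
      xget S [set S' | next_stage S S']
    else
      Stage (osup [set bound (prev D') | D' in [set D' | D' < D]])
        (union_op sadd prev [set D' | D' < D])
        (union_op smul prev [set D' | D' < D])).

Definition On_add (p : nat) : Ord -> Ord -> Ord :=
  union_op sadd (On_stage p) setT.

Definition On_mul (p : nat) : Ord -> Ord -> Ord :=
  union_op smul (On_stage p) setT.

Definition On_exp (p : nat) (a : Ord) (n : nat) : Ord :=
  iter n (On_mul p a) (onat 1).

Definition omega_omega_omega : Ord := opow omega (opow omega omega).

Definition On_eval (p : nat) (q : {poly 'F_p}) (a : Ord) : Ord :=
  foldr (fun (c : 'F_p) acc => On_add p (On_mul p acc a) (onat c)) ozero q.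

Definition is_minpoly (p : nat) (a : Ord) (q : {poly 'F_p}) : Prop :=
  [/\ q \is monic, On_eval q a = ozero
    & forall r : {poly 'F_p},
        r \is monic -> On_eval r a = ozero -> (size q <= size r)%N].

Definition deg (p : nat) (a : Ord) : nat :=
  (size (xget 0%R [set q | @is_minpoly p a q])).-1.

Definition chi (p h : nat) : Ord :=
  oleast [set a | a < omega_omega_omega /\ (h %| deg p a)%N].

(** The field chi_u for a prime [u]; it agrees with [chi p u]. *)
Definition chi_field (p u : nat) : Ord :=
  opow (onat p) (opow omega (onat (count prime (iota 0 u)))).

Definition alpha (p u : nat) : Ord :=
  oleast [set a | a < chi_field p u /\
    ~ exists b, b < chi_field p u /\ On_exp p b u = a].

(** A primitive [u]th root of unity; its degree, [zeta_deg], does not depend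
    on the choice. *)
Definition zeta (p u : nat) : Ord :=
  xget ozero [set z | [/\ z < omega_omega_omega, On_exp p z u = onat 1
    & forall k, (0 < k < u)%N -> On_exp p z k <> onat 1]].

Definition zeta_deg (p u : nat) : nat := deg p (zeta p u).

(* Main.v *)
Require Import Defs.
From HB Require Import structures.
From mathcomp Require Import all_boot all_order all_algebra.
From mathcomp Require Import qpoly generic_quotient.
From mathcomp Require Import separable closed_field algC cyclotomic cyclic.
From mathcomp Require Import boolp classical_sets ring.

(** The stages below [omega^(omega^omega)] are the subfields of an algebraic
    closure [C] of ['F_p] obtained by adjoining, prime after prime, all elements of
    degree a power of that prime; so [chi_u] is the field of elements whose degree
    over ['F_p] has only prime factors less than [u]. By Kummer theory an element
    [x] of [chi_u] has a [u]-th root there iff it has one in [F_p(x)], which is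
    automatic when [F_p(x)] does not contain [zeta_u]. Hence [f(u)] divides
    [d(alpha_u)], and [alpha_u >= chi_(f(u))].

    Addition of finite ordinals permutes each block
    [{omega g + n | n < omega}], and the finite ordinals form the union of the
    fields with [p^(2^j)] elements. It remains to find a finite [m] such that
    [chi_(f(u)) + m] is not a [u]-th power. This is clear if [f(u)] is a power of 2.
    Otherwise [x = chi_(f(u))] has degree [n > 1], [n] odd, over some field [E] with
    [p^(2^a)] elements. If all [x + m] were [u]-th powers, a multiplicative
    character of order [u] of [E(x)] would be 1 on all linear polynomials over all
    the fields with [p^(2^j)] elements. Its [L]-function is a polynomial with
    reciprocal roots [q z_i], and the power sums [s_k = sum z_i^k] satisfy
    [|s_k| <= 1] and [s_(2^j) = -1]. Averaging [|s_k|^2] shows that all [z_i] lie in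
    the unit disk and at most one of them, [z], on the unit circle; then
    [z^(2^j)] tends to [-1], which is absurd as [z^(2^(j+1))] is its square. *)

Set Implicit Arguments.
Unset Strict Implicit.
Unset Printing Implicit Defensive.

Import Order.TTheory GRing.Theory.
Local Open Scope quotient_scope.
Local Open Scope order_scope.

(** * Ordinal arithmetic *)

(** Blocks serve twice. Since [alpha_u] lies between [chi_(f(u))] and any non-power above it in the
    same block, it belongs to that block, which gives the ordinary sum; and a block is one coset of
    the field of finite ordinals, which gives the sum in [On_p]. The prime 2 is special as the first
    degree at which the tower extends: the stages p, p^2, p^4, ... have supremum omega. The
    polynomial h chosen at a stage never has to be known: finite fields have one extension of each
    degree, so every rootless X^u - h leads to the same subfield of [C]. What is not canonical is
    the identification of ordinals with elements of [C]; it is built by successive extensions, each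
    agreeing with its predecessor. In the L-function argument the roots are scaled by q, not by its
    square root: |s_k| <= 1 only says that a sum of q^k numbers in the unit disk has modulus at most
    q^k. The value at k = 2^j comes from the oddness of n, by which the product of the conjugates is
    a norm from the extension of E(x) of degree 2^j, where the hypothesis on u-th powers applies. *)

Lemma ozero_le (a : Ord) : ozero <= a.
Proof.
rewrite leOrdE; apply/asboolP; apply: tle_trans (proj1 (tle_pi _)) _.
by case: (repr a) => A f [].
Qed.

Lemma le_ozero (a : Ord) : (a <= ozero) = (a == ozero).
Proof. by rewrite eq_le ozero_le andbT. Qed.

Lemma lt0_neq (a : Ord) : (ozero < a) = (a != ozero).
Proof. by rewrite lt_def ozero_le andbT. Qed.

Fixpoint subtree (t : otree) : Type :=
  match t with onode A f => option {i : A & subtree (f i)} end.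

Fixpoint subtree_val (t : otree) : subtree t -> otree :=
  match t return subtree t -> otree with
  | onode A f => fun n => if n is Some (existT i m) then subtree_val m else onode f
  end.

(** An initial segment of [Ord] is the image of a type in the universe of the
    index types of [otree], so that [ord_bounded] applies to it. *)
Lemma ltOrd_subtree (t : otree) (b : Ord) :
  b <= \pi_Ord t -> exists n : subtree t, b = \pi_Ord (subtree_val n).
Proof.
elim: t b => A f IH b; rewrite le_eqVlt => /orP[/eqP ->|]; first by exists None.
rewrite ltNge leOrdE => /asboolP H.
have [//|] := tle_or_tlt (repr (\pi_Ord (onode f))) (repr b).
move=> bf; have {bf} : tlt (repr b) (onode f).
  have [+ _] := tle_pi (onode f); move: bf.
  case: (repr (\pi_Ord (onode f))) => [B g] [j bj] /= /(_ j)[i gi].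
  by exists i; exact: tle_trans gi.
case=> i bi; have [|n ->] := IH i b; last by exists (Some (existT _ i n)).
rewrite leOrdE; apply/asboolP; apply: tle_trans bi (proj2 (tle_pi _)).
Qed.

(** Replacement for initial segments. It makes the classes whose [oleast] defines [oadd], [omul] and
    [opow] inhabited, so that the default value never intervenes. *)
Lemma segment_bounded (F : Ord -> Ord) (b : Ord) :
  exists c, forall b', b' < b -> F b' < c.
Proof.
have [c cP] := ord_bounded (fun n : subtree (repr b) => F (\pi_Ord (subtree_val n))).
exists c => b' /ltW; rewrite -{1}[b]reprK => /ltOrd_subtree[n ->]; exact: cP.
Qed.

Lemma oleast_in (P : set Ord) : (exists a, P a) -> P (oleast P).
Proof. by move=> /oleastP[]. Qed.

Lemma oleast_le (P : set Ord) a : P a -> oleast P <= a.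
Proof. by move=> Pa; apply: (proj2 (oleastP _)) => //; exists a. Qed.

Lemma ord_ind (P : Ord -> Prop) :
  (forall a, (forall b, b < a -> P b) -> P a) -> forall a, P a.
Proof. by move=> H a; elim: (ltOrd_wf a) => {}a _ IH; exact: H. Qed.

Lemma le_from_lt (a b : Ord) : (forall c, c < a -> c < b) -> a <= b.
Proof. by move=> H; rewrite leNgt; apply/negP => /H; rewrite ltxx. Qed.

Lemma ord_gt (a : Ord) : exists b, a < b.
Proof. by have [b /(_ tt)] := ord_bounded (fun _ : unit => a); exists b. Qed.

Lemma ltS (a : Ord) : a < osucc a.
Proof. exact: (@oleast_in [set b | a < b]) (ord_gt a). Qed.

Lemma leS (a b : Ord) : (osucc a <= b) = (a < b).
Proof.
apply/idP/idP; first exact/lt_le_trans/ltS.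
by move=> ab; exact: (@oleast_le [set b | a < b]).
Qed.

Lemma ltSle (a b : Ord) : (a < osucc b) = (a <= b).
Proof. by rewrite ltNge leS -leNgt. Qed.

Lemma osuccS (a b : Ord) : (osucc a < osucc b) = (a < b).
Proof. by rewrite ltSle leS. Qed.

Lemma osucc_inj : injective osucc.
Proof.
move=> a b E; apply/eqP; rewrite eq_le -!ltSle E ltS /=.
by rewrite -[osucc b]E ltS.
Qed.

Lemma osucc_neq0 (a : Ord) : osucc a != ozero.
Proof. by rewrite -lt0_neq (le_lt_trans (ozero_le a)) ?ltS. Qed.

Lemma lt_osup (A : Type) (f : A -> Ord) a :
  a < osup (range f) <-> exists i, a < f i.
Proof.
have [c cP] := ord_bounded f.
have ub : exists b, forall a0, range f a0 -> a0 <= b.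
  by exists c => _ [i _ <-]; exact/ltW/cP.
split=> [|[i ai]]; last first.
  apply: lt_le_trans ai _.
  by apply: (@oleast_in [set b | forall a, range f a -> a <= b] ub); exists i.
move=> H; apply: contrapT => /forallNP no; move: H; apply/negP; rewrite -leNgt.
apply: (@oleast_le [set b | forall a, range f a -> a <= b]) => _ [i _ <-].
by rewrite leNgt; apply/negP/no.
Qed.

Lemma onat_mono m n : (onat m < onat n) = (m < n)%N.
Proof.
have H k l : (k < l)%N -> onat k < onat l.
  elim: l => // l IH; rewrite ltnS leq_eqVlt => /orP[/eqP ->|/IH kl] /=.
    exact: ltS.
  exact: lt_trans kl (ltS _).
apply/idP/idP => [|/H//]; case: (ltngtP m n) => //; last by move=> ->; rewrite ltxx.
by move/H/ltW; rewrite leNgt => /negbTE ->.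
Qed.

Lemma onat_le m n : (onat m <= onat n) = (m <= n)%N.
Proof. by rewrite leNgt onat_mono -leqNgt. Qed.

Lemma onat_inj : injective onat.
Proof. by move=> m n E; apply/eqP; rewrite eqn_leq -!onat_le E lexx. Qed.

Lemma nat_of_OrdK n : nat_of_Ord (onat n) = n.
Proof.
by apply: onat_inj; apply: (@xgetPex _ 0%N [set m | onat m = onat n]); exists n.
Qed.

Lemma lt_omega a : a < omega <-> exists n, a = onat n.
Proof.
split=> [/lt_osup[n]|[n ->]]; last first.
  by apply/lt_osup; exists n.+1; rewrite onat_mono.
elim: n => [|n IH] /=; first by rewrite ltNge ozero_le.
by rewrite ltSle le_eqVlt => /orP[/eqP ->|/IH //]; exists n.
Qed.

Lemma lt_onat a n : a < onat n -> exists2 m, (m < n)%N & a = onat m.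
Proof.
move=> an; have /lt_omega[m am] : a < omega.
  by apply: lt_trans an _; apply/lt_omega; exists n.
by exists m => //; rewrite -onat_mono -am.
Qed.

Lemma oaddP (a b : Ord) :
  [/\ a <= oadd a b, forall b', b' < b -> oadd a b' < oadd a b &
     forall c, a <= c -> (forall b', b' < b -> oadd a b' < c) -> oadd a b <= c].
Proof.
have E : oadd a b = oleast [set c | a <= c /\ forall b', b' < b -> oadd a b' < c].
  rewrite /oadd orecE; congr oleast; apply/seteqP; split=> c /= [ac H]; split=> //.
    by move=> b' lb; have := H b' lb; rewrite lb.
  by move=> b' lb; rewrite lb; exact: H.
have : exists c, a <= c /\ forall b', b' < b -> oadd a b' < c.
  have [c cP] := segment_bounded (oadd a) b.
  have [ac|ca] := leP a c; first by exists c.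
  by exists a; split=> // b' /cP /lt_trans; apply.
rewrite E => ex; have [[ac H] min] := oleastP ex; split=> // c ac' Hc; exact: min.
Qed.

Lemma le_oaddr a b : a <= oadd a b. Proof. by have [] := oaddP a b. Qed.

Lemma oadd_mono a b c : (oadd a b < oadd a c) = (b < c).
Proof.
have H x y : x < y -> oadd a x < oadd a y by have [_ + _] := oaddP a y; apply.
apply/idP/idP => [|/H//]; rewrite ltNge [b < c]ltNge; apply: contraNN.
by rewrite le_eqVlt => /orP[/eqP ->|/H/ltW].
Qed.

Lemma oadd_le a b c : (oadd a b <= oadd a c) = (b <= c).
Proof. by rewrite leNgt oadd_mono -leNgt. Qed.

Lemma oadd_inj a : injective (oadd a).
Proof. by move=> b c E; apply/eqP; rewrite eq_le -(oadd_le a b) -(oadd_le a c) E lexx. Qed.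

Lemma oadd_lub a b c : a <= c -> (forall b', b' < b -> oadd a b' < c) -> oadd a b <= c.
Proof. by have [_ _] := oaddP a b; apply. Qed.

Lemma oaddx0 a : oadd a ozero = a.
Proof.
apply/eqP; rewrite eq_le le_oaddr andbT; apply: oadd_lub => // b'.
by rewrite ltNge ozero_le.
Qed.

Lemma le_oaddl a b : b <= oadd a b.
Proof.
elim/ord_ind: b => b IH; apply: le_from_lt => c cb.
by apply: le_lt_trans (IH c cb) _; rewrite oadd_mono.
Qed.

Lemma oadd_sub a c : a <= c -> exists b, c = oadd a b.
Proof.
move=> ac; set P : set Ord := [set b | c <= oadd a b]%classic.
have ex : exists b, P b by exists c; exact: le_oaddl.
have [H min] := oleastP ex; exists (oleast P); apply/eqP; rewrite eq_le H /=.
apply: oadd_lub => // b' lb; rewrite ltNge; apply/negP => /min.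
by rewrite leNgt lb.
Qed.

Lemma lt_oadd c a b : c < oadd a b -> c < a \/ exists2 b', b' < b & c = oadd a b'.
Proof.
have [ac|] := leP a c; last by left.
have [b' ->] := oadd_sub ac; rewrite oadd_mono => lb; right; by exists b'.
Qed.

Lemma oaddA a b c : oadd a (oadd b c) = oadd (oadd a b) c.
Proof.
elim/ord_ind: c => c IH; apply/eqP; rewrite eq_le; apply/andP; split.
  apply: oadd_lub => [|x /lt_oadd[xb|[c' cc ->]]].
  - exact: le_trans (le_oaddr a b) (le_oaddr _ _).
  - by apply: lt_le_trans (le_oaddr _ _); rewrite oadd_mono.
  - by rewrite IH // oadd_mono.
apply: oadd_lub => [|c' cc]; first by rewrite oadd_le le_oaddr.
by rewrite -IH // !oadd_mono.
Qed.

Lemma oadd0x a : oadd ozero a = a.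
Proof.
apply/eqP; rewrite eq_le le_oaddl andbT; elim/ord_ind: a => a IH.
apply: oadd_lub => [|b ba]; first exact: ozero_le.
exact: le_lt_trans (IH b ba) ba.
Qed.

Lemma oaddS a b : oadd a (osucc b) = osucc (oadd a b).
Proof.
apply/eqP; rewrite eq_le leS oadd_mono ltS andbT; apply: oadd_lub.
  by apply: ltW; rewrite ltSle le_oaddr.
by move=> b'; rewrite !ltSle oadd_le.
Qed.

Lemma oadd_nat m n : oadd (onat m) (onat n) = onat (m + n).
Proof. by elim: n => [|n IH]; rewrite ?oaddx0 ?addn0 //= oaddS IH addnS. Qed.

Lemma oadd_monol a b c : a <= b -> oadd a c <= oadd b c.
Proof.
move=> ab; elim/ord_ind: c => c IH; apply: oadd_lub => [|c' cc].
  exact: le_trans ab (le_oaddr _ _).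
by apply: le_lt_trans (IH c' cc) _; rewrite oadd_mono.
Qed.

Lemma omulP (a b : Ord) :
  (forall b', b' < b -> oadd (omul a b') a <= omul a b) /\
  (forall c, (forall b', b' < b -> oadd (omul a b') a <= c) -> omul a b <= c).
Proof.
have E : omul a b = oleast [set c | forall b', b' < b -> oadd (omul a b') a <= c].
  rewrite /omul orecE; congr oleast; apply/seteqP; split=> c /= H.
    by move=> b' lb; have := H b' lb; rewrite lb.
  by move=> b' lb; rewrite lb; exact: H.
have ex : exists c, forall b', b' < b -> oadd (omul a b') a <= c.
  have [c cP] := segment_bounded (fun b' => oadd (omul a b') a) b.
  by exists c => b' /cP /ltW.
by rewrite E; have [H min] := oleastP ex; split=> // c Hc; exact: min.
Qed.

Lemma omul_step a b' b : b' < b -> oadd (omul a b') a <= omul a b.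
Proof. by have [+ _] := omulP a b; apply. Qed.

Lemma omul_lub a b c : (forall b', b' < b -> oadd (omul a b') a <= c) -> omul a b <= c.
Proof. by have [_] := omulP a b; apply. Qed.

Lemma omulx0 a : omul a ozero = ozero.
Proof.
by apply/eqP; rewrite -le_ozero; apply: omul_lub => b'; rewrite ltNge ozero_le.
Qed.

Lemma omul_le a b c : b <= c -> omul a b <= omul a c.
Proof.
rewrite le_eqVlt => /orP[/eqP -> //|bc]; apply: le_trans (omul_step a bc).
exact: le_oaddr.
Qed.

Lemma omul_lt a b c : ozero < a -> b < c -> omul a b < omul a c.
Proof.
move=> a0 bc; apply: lt_le_trans (omul_step a bc).
by rewrite -{1}[omul a b]oaddx0 oadd_mono.
Qed.

Lemma omulS a b : omul a (osucc b) = oadd (omul a b) a.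
Proof.
apply/eqP; rewrite eq_le omul_step ?ltS // andbT; apply: omul_lub => b'.
rewrite ltSle => bb; exact/oadd_monol/omul_le.
Qed.

Lemma omulx1 a : omul a (onat 1) = a.
Proof. by rewrite /= omulS omulx0 oadd0x. Qed.

Lemma omul1x a : omul (onat 1) a = a.
Proof.
elim/ord_ind: a => a IH; apply/eqP; rewrite eq_le; apply/andP; split.
  by apply: omul_lub => b ba; rewrite IH // /= oaddS oaddx0 leS.
apply: le_from_lt => b ba; rewrite -leS; apply: le_trans (omul_step _ ba).
by rewrite IH // /= oaddS oaddx0.
Qed.

Lemma omul_divl a b c : c < omul a b ->
  exists q r, [/\ q < b, r < a & c = oadd (omul a q) r].
Proof.
move=> cab; set P : set Ord := [set q | c < omul a (osucc q)]%classic.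
have [q0 q0b cq0] : exists2 q, q < b & c < omul a (osucc q).
  apply: contrapT => no; move: cab; apply/negP; rewrite -leNgt.
  apply: omul_lub => b' bb; rewrite -omulS leNgt; apply/negP => H; apply: no.
  by exists b'.
have ex : exists q, P q by exists q0.
have [cq min] := oleastP ex; set q := oleast P in cq min.
have qc : omul a q <= c.
  apply: omul_lub => q' qq; rewrite -omulS leNgt; apply/negP => /min.
  by rewrite leNgt qq.
have [r E] := oadd_sub qc; exists q, r; split=> //.
  exact: le_lt_trans (min _ cq0) q0b.
by move: cq; rewrite /P /= E omulS oadd_mono.
Qed.

Lemma omul_div_uniq a q r q' r' : r < a -> r' < a ->
  oadd (omul a q) r = oadd (omul a q') r' -> q = q' /\ r = r'.
Proof.
move=> ra ra' E.
have H x y s t : s < a -> t < a -> x < y -> oadd (omul a x) s < oadd (omul a y) t.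
  move=> sa ta xy; apply: lt_le_trans (le_oaddr _ _).
  by apply: lt_le_trans (omul_step a xy); rewrite oadd_mono.
have qq : q = q'.
  case: (ltgtP q q') => // [/(H _ _ _ _ ra ra')|/(H _ _ _ _ ra' ra)].
    by rewrite E ltxx.
  by rewrite E ltxx.
by split=> //; move: E; rewrite qq => /oadd_inj.
Qed.

Lemma omul_lt_code a b q r : q < b -> r < a -> oadd (omul a q) r < omul a b.
Proof.
by move=> qb ra; apply: lt_le_trans (omul_step a qb); rewrite oadd_mono.
Qed.

Lemma omulDr a b c : omul a (oadd b c) = oadd (omul a b) (omul a c).
Proof.
elim/ord_ind: c => c IH; apply/eqP; rewrite eq_le; apply/andP; split.
  apply: omul_lub => y /lt_oadd[yb|[c' cc ->]].
    exact: le_trans (omul_step a yb) (le_oaddr _ _).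
  by rewrite IH // -oaddA oadd_le omul_step.
apply: oadd_lub => [|z /omul_divl[q [r [qc ra ->]]]].
  exact/omul_le/le_oaddr.
rewrite oaddA -IH //; apply: omul_lt_code => //; by rewrite oadd_mono.
Qed.

Lemma omulA a b c : omul a (omul b c) = omul (omul a b) c.
Proof.
elim/ord_ind: c => c IH; apply/eqP; rewrite eq_le; apply/andP; split.
  apply: omul_lub => y /omul_divl[q [r [qc rb ->]]].
  rewrite omulDr IH // -oaddA; apply: le_trans (omul_step _ qc).
  by rewrite oadd_le omul_step.
apply: omul_lub => c' cc; rewrite -IH // -omulDr; apply: omul_le.
exact: omul_step.
Qed.

Lemma omul_nat m n : omul (onat m) (onat n) = onat (m * n).
Proof.
elim: n => [|n IH]; first by rewrite muln0 omulx0.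
by rewrite [onat n.+1]/= omulS IH oadd_nat mulnS addnC.
Qed.

Lemma omul_gt0 a b : ozero < a -> ozero < b -> ozero < omul a b.
Proof. by move=> a0 b0; rewrite -(omulx0 a) omul_lt. Qed.

Lemma omul_monol (a b c : Ord) : a <= b -> omul a c <= omul b c.
Proof.
move=> ab; elim/ord_ind: c => c IH; apply: omul_lub => c' cc.
apply: le_trans (omul_step b cc); apply: le_trans (oadd_monol _ (IH _ cc)) _.
by rewrite oadd_le.
Qed.

Lemma opowP (a b : Ord) :
  [/\ onat 1 <= opow a b, (forall b', b' < b -> omul (opow a b') a <= opow a b) &
   forall c, onat 1 <= c ->
     (forall b', b' < b -> omul (opow a b') a <= c) -> opow a b <= c].
Proof.
have E : opow a b = oleast [set c | onat 1 <= c /\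
     forall b', b' < b -> omul (opow a b') a <= c].
  rewrite /opow orecE; congr oleast; apply/seteqP; split=> c /= [c1 H]; split=> //.
    by move=> b' lb; have := H b' lb; rewrite lb.
  by move=> b' lb; rewrite lb; exact: H.
have ex : exists c, onat 1 <= c /\ forall b', b' < b -> omul (opow a b') a <= c.
  have [c cP] := segment_bounded (fun b' => omul (opow a b') a) b.
  have [c1|] := leP (onat 1) c; first by exists c; split=> // b' /cP /ltW.
  by move=> lc; exists (onat 1); split=> // b' /cP /lt_trans/(_ lc)/ltW.
by rewrite E; have [[c1 H] min] := oleastP ex; split=> // c Hc Hc'; exact: min.
Qed.

Opaque oadd omul opow osucc osup.

Lemma opow_ge1 a b : onat 1 <= opow a b. Proof. by have [] := opowP a b. Qed.

Lemma opow_gt0 a b : ozero < opow a b.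
Proof. by rewrite -leS; exact: opow_ge1. Qed.

Lemma opow_step a b' b : b' < b -> omul (opow a b') a <= opow a b.
Proof. by have [_ + _] := opowP a b; apply. Qed.

Lemma opow_lub a b c : onat 1 <= c ->
  (forall b', b' < b -> omul (opow a b') a <= c) -> opow a b <= c.
Proof. by have [_ _] := opowP a b; apply. Qed.

Lemma opowx0 a : opow a ozero = onat 1.
Proof.
apply/eqP; rewrite eq_le opow_ge1 andbT; apply: opow_lub => // b'.
by rewrite ltNge ozero_le.
Qed.

Lemma opow_le a b c : ozero < a -> b <= c -> opow a b <= opow a c.
Proof.
move=> a0; rewrite le_eqVlt => /orP[/eqP -> //|bc].
apply: le_trans (opow_step a bc); rewrite -{1}[opow a b]omulx1.
by apply: omul_le; rewrite leS.
Qed.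

Lemma opow_lt a b c : onat 1 < a -> b < c -> opow a b < opow a c.
Proof.
move=> a1 bc; apply: lt_le_trans (opow_step a bc).
by rewrite -{1}[opow a b]omulx1 omul_lt ?opow_gt0.
Qed.

Lemma opowS a b : ozero < a -> opow a (osucc b) = omul (opow a b) a.
Proof.
move=> a0; apply/eqP; rewrite eq_le opow_step ?ltS // andbT; apply: opow_lub.
  by rewrite /= leS omul_gt0 ?opow_gt0.
by move=> b'; rewrite ltSle => bb; exact/omul_monol/opow_le.
Qed.

Lemma opowx1 a : ozero < a -> opow a (onat 1) = a.
Proof. by move=> a0; rewrite /= opowS // opowx0 omul1x. Qed.

Lemma lt_opow a b y : y < opow a b ->
  y = ozero \/ exists2 b', b' < b & y < omul (opow a b') a.
Proof.
move=> H; have [|y0] := eqVneq y ozero; first by left.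
right; apply: contrapT => no; move: H; apply/negP; rewrite -leNgt.
apply: opow_lub; first by rewrite leS lt0_neq.
move=> b' bb; rewrite leNgt; apply/negP => H; apply: no; by exists b'.
Qed.

Lemma opowD a b c : ozero < a -> opow a (oadd b c) = omul (opow a b) (opow a c).
Proof.
move=> a0; elim/ord_ind: c => c IH; apply/eqP; rewrite eq_le; apply/andP; split.
  apply: opow_lub => [|y /lt_oadd[yb|[c' cc ->]]].
  - by rewrite leS omul_gt0 ?opow_gt0.
  - apply: le_trans (opow_step a yb) _.
    by rewrite -{1}[opow a b]omulx1; apply: omul_le; exact: opow_ge1.
  - by rewrite IH // -omulA; apply: omul_le; exact: opow_step.
apply: omul_lub => y /lt_opow[->|[c' cc yc]].
  by rewrite omulx0 oadd0x opow_le ?le_oaddr.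
rewrite -omulS; apply: (@le_trans _ _ (omul (opow a b) (omul (opow a c') a))).
  by apply: omul_le; rewrite leS.
by rewrite omulA -IH // opow_step // oadd_mono.
Qed.

Lemma opow_mul a b c : ozero < a -> opow a (omul b c) = opow (opow a b) c.
Proof.
move=> a0; elim/ord_ind: c => c IH; apply/eqP; rewrite eq_le; apply/andP; split.
  apply: opow_lub => [|x /omul_divl[q [r [qc rb ->]]]]; first exact: opow_ge1.
  rewrite opowD // IH // -omulA; apply: le_trans (opow_step _ qc).
  exact/omul_le/opow_step.
apply: opow_lub => [|c' cc]; first exact: opow_ge1.
by rewrite -IH // -opowD // opow_le // omul_step.
Qed.

Lemma lt_omul_sup a : ozero < a -> forall y, y < omul a omega <->
  exists n, y < omul a (onat n).
Proof.
move=> a0 y; split=> [/omul_divl[q [r [/lt_omega[n ->] ra ->]]]|[n H]].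
  by exists n.+1; rewrite [onat n.+1]/= omulS oadd_mono.
by apply: lt_trans H _; apply: omul_lt => //; apply/lt_omega; exists n.
Qed.

Lemma opow_nat p n : (0 < p)%N -> opow (onat p) (onat n) = onat (p ^ n).
Proof.
move=> p0; have p0' : ozero < onat p by rewrite -[ozero]/(onat 0) onat_mono.
elim: n => [|n IH]; first by rewrite opowx0.
by rewrite [onat n.+1]/= opowS // IH omul_nat expnS mulnC.
Qed.

Lemma lt_opow_sup a b : onat 1 < a -> ozero < b -> forall y,
  y < opow a (omul b omega) <-> exists n, y < opow a (omul b (onat n)).
Proof.
move=> a1 b0 y; have a0 : ozero < a by apply: lt_trans a1; exact: ltS.
split=> [/lt_opow[->|[b' /(lt_omul_sup b0)[n b'n] H]]|[n H]].
- by exists 0%N; exact: opow_gt0.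
- exists n; apply: lt_le_trans H _; rewrite -opowS //.
  by apply: opow_le; rewrite ?leS.
- apply: lt_trans H _; apply: opow_lt => //; apply: omul_lt => //.
  by apply/lt_omega; exists n.
Qed.

Lemma omega_gt1 : onat 1 < omega. Proof. by apply/lt_omega; exists 1%N. Qed.

Lemma omega_gt0 : ozero < omega. Proof. by apply/lt_omega; exists 0%N. Qed.

Lemma ord_ext (a b : Ord) : (forall y, y < a <-> y < b) -> a = b.
Proof.
by move=> H; apply/eqP; rewrite eq_le; apply/andP; split; apply: le_from_lt => c /H.
Qed.

Lemma oadd1omega : oadd (onat 1) omega = omega.
Proof.
apply: ord_ext => y; split=> [/lt_oadd[y1|[y' /lt_omega[n ->] ->]]|].
- exact: lt_trans y1 omega_gt1.
- by apply/lt_omega; exists (1 + n)%N; rewrite oadd_nat.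
- by move=> yw; apply: lt_le_trans (le_oaddl _ _).
Qed.

(** * Bounds of the algebraic stages *)

Section StageBounds.
Variable p : nat.
Hypothesis p2 : (1 < p)%N.

Let P1 : onat 1 < onat p. Proof. by rewrite onat_mono. Qed.
Let P0 : ozero < onat p. Proof. by apply: lt_trans P1; exact: ltS. Qed.

Lemma opow_omega : opow (onat p) omega = omega.
Proof.
rewrite -[omega in LHS]omul1x.
apply: ord_ext => y; split=> [/(lt_opow_sup P1 (ltS _))[n]|/lt_omega[n ->]].
  rewrite omul1x opow_nat 1?ltnW // => yn; apply: lt_trans yn _.
  by apply/lt_omega; exists (p ^ n)%N.
apply/(lt_opow_sup P1 (ltS _)); exists n.
by rewrite omul1x opow_nat 1?ltnW // onat_mono ltn_expl.
Qed.

(** The bound of the stage reached from [p^(omega^k)] after [i] extensions of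
    degree [q]. *)
Definition sbound (q : nat -> nat) (k i : nat) : Ord :=
  opow (onat p) (omul (opow omega (onat k)) (onat (q k ^ i))).

Lemma sbound0 q k : sbound q k 0 = opow (onat p) (opow omega (onat k)).
Proof. by rewrite /sbound expn0 omulx1. Qed.

Lemma sbound00 q : sbound q 0 0 = onat p.
Proof. by rewrite sbound0 opowx0 opowx1. Qed.

Lemma sboundS q k i : sbound q k i.+1 = opow (sbound q k i) (onat (q k)).
Proof. by rewrite /sbound -opow_mul // -omulA omul_nat expnSr. Qed.

Lemma sbound_lim q k : (1 < q k)%N ->
  forall y, y < sbound q k.+1 0 <-> exists i, y < sbound q k i.
Proof.
move=> q1 y; rewrite sbound0 [onat k.+1]/= opowS ?omega_gt0 //.
split=> [/(lt_opow_sup P1 (opow_gt0 _ _))[n yn]|[i yi]]; last first.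
  by apply/(lt_opow_sup P1 (opow_gt0 _ _)); exists (q k ^ i)%N.
(* The exponents [q k ^ i] are cofinal in the naturals, as n < (q k)^n. *)
exists n; apply: lt_le_trans yn _; apply: opow_le => //; apply: omul_le.
by rewrite onat_le ltnW // ltn_expl.
Qed.

Lemma sbound_gt0 q k i : ozero < sbound q k i.
Proof. exact: opow_gt0. Qed.

Lemma sbound_leS q k i : (0 < q k)%N -> sbound q k i <= sbound q k i.+1.
Proof.
move=> q0; apply: opow_le => //; apply: omul_le.
by rewrite onat_le expnS leq_pmull.
Qed.

(** Since p^omega = omega, the bound is omega^c with c = [omega^k q^i] >= 1. Thus base-[sbound]
    digits respect the blocks of length omega, as [ext_val_block] requires. *)
Lemma sbound_omega q k i : (0 < q k.+1)%N ->
  exists x, sbound q k.+1 i = omul omega x.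
Proof.
move=> q0; rewrite /sbound.
have -> : opow omega (onat k.+1) = omul omega (opow omega (onat k)).
  rewrite -{2}[omega]opowx1 ?omega_gt0 // -opowD ?omega_gt0 //.
  by rewrite oadd_nat.
rewrite -omulA opow_mul // opow_omega.
have [x ->] : exists x, omul (opow omega (onat k)) (onat (q k.+1 ^ i)) = oadd (onat 1) x.
  apply: oadd_sub; rewrite leS; apply: omul_gt0; first exact: opow_gt0.
  by rewrite -[ozero]/(onat 0) onat_mono expn_gt0 q0.
by exists (opow omega x); rewrite opowD ?omega_gt0 // opowx1 ?omega_gt0.
Qed.

Lemma sbound10 q : sbound q 1 0 = omega.
Proof. by rewrite sbound0 opowx1 ?omega_gt0 // opow_omega. Qed.

(** From omega = p^omega and 1 + omega = omega, the ordinal omega^(omega^omega) equals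
    p^(omega^omega). *)
Lemma sbound_sup q y :
  y < omega_omega_omega <-> exists k, y < sbound q k 0.
Proof.
have -> : omega_omega_omega = opow (onat p) (opow omega omega).
  rewrite /omega_omega_omega -{1}opow_omega -opow_mul //.
  rewrite -{1}[omega]opowx1 ?omega_gt0 // -opowD ?omega_gt0 //.
  by rewrite oadd1omega.
split=> [/lt_opow[->|[b' H yb]]|[k yk]].
- by exists 0%N; exact: sbound_gt0.
- have [k b'k] : exists k, b' < opow omega (onat k).
    case: (lt_opow H) => [->|[c /lt_omega[k ->] bc]].
      by exists 0%N; exact: opow_gt0.
    by exists k.+1; rewrite /= opowS ?omega_gt0.
  exists k; rewrite sbound0; apply: lt_le_trans yb _; exact: opow_step.
- apply: lt_trans yk _; rewrite sbound0; apply: opow_lt => //.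
  by apply: opow_lt; [exact: omega_gt1 | apply/lt_omega; exists k].
Qed.

End StageBounds.

(** * Expansions in base [phi] *)

Definition digits (phi : Ord) (f : nat -> Ord) (n : nat) : Ord :=
  obracket phi [seq (onat i, f i) | i <- rev (iota 0 n)].

Lemma digitsS phi f n :
  digits phi f n.+1 = oadd (omul (opow phi (onat n)) (f n)) (digits phi f n).
Proof. by rewrite /digits -[n.+1]addn1 iotaD rev_cat. Qed.

Lemma digits0 phi f : digits phi f 0 = ozero. Proof. by []. Qed.

Lemma digits_lt phi f n : ozero < phi -> (forall i, (i < n)%N -> f i < phi) ->
  digits phi f n < opow phi (onat n).
Proof.
move=> phi0; elim: n => [|n IH] H; first by rewrite digits0 opow_gt0.
rewrite digitsS [onat n.+1]/= opowS //; apply: omul_lt_code; first exact: H.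
by apply: IH => i /ltnW; exact: H.
Qed.

Lemma eq_digits phi f g n : (forall i, (i < n)%N -> f i = g i) ->
  digits phi f n = digits phi g n.
Proof.
elim: n => [|n IH] H; first by [].
by rewrite !digitsS H // IH // => i /ltnW; exact: H.
Qed.

Lemma digits_surj phi n x : ozero < phi -> x < opow phi (onat n) ->
  exists2 f, (forall i, f i < phi) & x = digits phi f n.
Proof.
move=> phi0; elim: n x => [|n IH] x.
  by rewrite opowx0 ltSle le_ozero => /eqP ->; exists (fun=> ozero).
rewrite [onat n.+1]/= opowS // => /omul_divl[q [r [qp /IH[f fp ->] ->]]].
exists (fun i => if i == n then q else f i) => [i|]; first by case: eqP.
rewrite digitsS eqxx; congr (oadd _ _); apply: eq_digits => i.
by rewrite ltn_neqAle => /andP[/negbTE ->].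
Qed.

Lemma digits_inj phi f g n : ozero < phi ->
  (forall i, (i < n)%N -> f i < phi) -> (forall i, (i < n)%N -> g i < phi) ->
  digits phi f n = digits phi g n -> forall i, (i < n)%N -> f i = g i.
Proof.
move=> phi0; elim: n => [|n IH] Hf Hg //.
rewrite !digitsS => /omul_div_uniq[||E1 E2 i].
- by apply: digits_lt => // i /ltnW; exact: Hf.
- by apply: digits_lt => // i /ltnW; exact: Hg.
- rewrite ltnS leq_eqVlt => /orP[/eqP -> //|]; apply: IH => // j /ltnW; by [exact: Hf|exact: Hg].
Qed.

(** The lowest digit is the remainder of division by [phi]; the quotient [c] depends on the other
    digits only. *)
Lemma digits_low phi f n : ozero < phi ->
  exists c, forall a, digits phi (fun i => if i is 0 then a else f i) n.+1 =
     oadd (omul phi c) a.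
Proof.
move=> phi0; elim: n => [|n [c H]].
  by exists ozero => a; rewrite digitsS digits0 opowx0 omul1x oaddx0 omulx0 oadd0x.
exists (oadd (omul (opow phi (onat n)) (f n.+1)) c) => a.
have E : opow phi (onat n.+1) = omul phi (opow phi (onat n)).
  by rewrite -{2}[phi]opowx1 // -opowD // oadd_nat.
by rewrite digitsS H oaddA omulDr omulA -E.
Qed.

Lemma digits_const phi f n : ozero < phi -> (forall i, f i.+1 = ozero) ->
  digits phi f n.+1 = f 0%N.
Proof.
move=> phi0 H; elim: n => [|n IH].
  by rewrite digitsS digits0 opowx0 omul1x oaddx0.
by rewrite digitsS H omulx0 IH oadd0x.
Qed.

(** * Finite subfields *)

Section FiniteSubfields.
Local Open Scope ring_scope.
Variables (C : closedFieldType) (p : nat).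
Hypothesis charC : p \in [pchar C].

Let p_gt0 : (0 < p)%N.
Proof. exact/prime_gt0/(pcharf_prime charC). Qed.

Let p_gt1 : (1 < p)%N.
Proof. exact/prime_gt1/(pcharf_prime charC). Qed.

(** The subfield with [p ^ d] elements of [C], for [d > 0]. The proof argument
    lets the closure and morphism instances below be inferred. *)
Definition fixF of p \in [pchar C] := fun (d : nat) => (fun x : C => x ^+ (p ^ d) == x) : {pred C}.

Lemma fixFP d x : reflect (x ^+ (p ^ d) = x) (x \in fixF charC d).
Proof. exact: eqP. Qed.

Lemma exprD_frob d (x y : C) : (x + y) ^+ (p ^ d) = x ^+ (p ^ d) + y ^+ (p ^ d).
Proof.
apply: exprDn_pchar; apply/pnatP; first by rewrite expn_gt0 p_gt0.
move=> r r_pr; rewrite Euclid_dvdX // => /andP[].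
by rewrite dvdn_prime2 ?(pcharf_prime charC) // => /eqP ->.
Qed.

Definition frob of p \in [pchar C] := fun (d : nat) (x : C) => x ^+ (p ^ d).

Lemma frob_is_additive d : zmod_morphism (frob charC d).
Proof.
move=> x y; rewrite /frob exprD_frob; congr (_ + _); apply/eqP.
by rewrite -subr_eq0 opprK -exprD_frob addNr expr0n expn_eq0 -leqn0 leqNgt p_gt0.
Qed.

Lemma frob_is_multiplicative d : monoid_morphism (frob charC d).
Proof. by split=> [|x y]; rewrite /frob ?expr1n ?exprMn. Qed.

HB.instance Definition _ d :=
  GRing.isZmodMorphism.Build C C (frob charC d) (frob_is_additive d).
HB.instance Definition _ d :=
  GRing.isMonoidMorphism.Build C C (frob charC d) (frob_is_multiplicative d).

Lemma frobE d x : frob charC d x = x ^+ (p ^ d). Proof. by []. Qed.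

Lemma frob_comp d e x : frob charC d (frob charC e x) = frob charC (d + e) x.
Proof. by rewrite !frobE -exprM -expnD addnC. Qed.

Lemma frob_inj d : injective (frob charC d).
Proof. exact: fmorph_inj. Qed.

Lemma frob0 x : frob charC 0 x = x. Proof. by rewrite frobE expr1. Qed.

Lemma fixF_divring d : divring_closed (fixF charC d).
Proof.
split=> [|x y /fixFP Hx /fixFP Hy|x y /fixFP Hx /fixFP Hy]; apply/fixFP.
- exact: expr1n.
- by rewrite [LHS](frob_is_additive d) /frob Hx Hy.
- by rewrite exprMn exprVn Hx Hy.
Qed.

HB.instance Definition _ d := GRing.isDivringClosed.Build C (fixF charC d) (fixF_divring d).

Lemma fixF_mul d e x : x \in fixF charC d -> x \in fixF charC (d * e).
Proof.
move=> /fixFP H; apply/fixFP; elim: e => [|e IH]; first by rewrite muln0 expr1.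
by rewrite mulnS expnD exprM H.
Qed.

Lemma fixF_dvd d e x : (d %| e)%N -> x \in fixF charC d -> x \in fixF charC e.
Proof. by move=> /dvdnP[k ->] H; rewrite mulnC fixF_mul. Qed.

(** By Bezout k d = l e + gcd(d, e), and the Frobenius powers of exponents k d and l e both fix
    [x]. *)
Lemma fixF_gcd d e x : (0 < d)%N -> x \in fixF charC d -> x \in fixF charC e ->
  x \in fixF charC (gcdn d e).
Proof.
move=> d0 Hd He; have [k l E _] := egcdnP e d0.
have /fixFP H1 : x \in fixF charC (k * d) by rewrite mulnC fixF_mul.
have /fixFP H2 : x \in fixF charC (l * e) by rewrite mulnC fixF_mul.
by apply/fixFP; rewrite -[in LHS]H2 -exprM -expnD addnC addnC -E H1.
Qed.

Lemma fixF_frob d e x : (frob charC e x \in fixF charC d) = (x \in fixF charC d).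
Proof.
apply/fixFP/fixFP => [|H]; rewrite -!frobE; last first.
  by rewrite frob_comp addnC -frob_comp [frob charC d x]H.
by rewrite frob_comp addnC -frob_comp => /frob_inj.
Qed.

Let q_gt1 d : (0 < d)%N -> (1 < p ^ d)%N.
Proof. by case: d => // d _; apply: leq_trans p_gt1 (leq_pexp2l p_gt0 (ltn0Sn d)). Qed.

(** The finite subfields of the infinite field [C] are handled as duplicate-free lists, so that sums
    over them can be reindexed by [perm_big] and [uniq_perm]. *)
Definition elemF (d : nat) : seq C :=
  sval (closed_field_poly_normal ('X^(p ^ d) - 'X : {poly C})).

Lemma elemF_spec d : (0 < d)%N -> 'X^(p ^ d) - 'X = \prod_(z <- elemF d) ('X - z%:P) :> {poly C}.
Proof.
move=> d0; rewrite /elemF; case: closed_field_poly_normal => r /= {1}->.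
rewrite lead_coefDl ?lead_coefXn ?scale1r //.
by rewrite size_polyN size_polyX size_polyXn ltnS q_gt1.
Qed.

Lemma size_elemF d : (0 < d)%N -> size (elemF d) = (p ^ d)%N.
Proof.
move=> d0; apply: succn_inj; rewrite -(size_prod_XsubC (elemF d) id) -elemF_spec //.
by rewrite size_polyDl ?size_polyXn // size_polyN size_polyX ltnS q_gt1.
Qed.

Lemma mem_elemF d x : (0 < d)%N -> (x \in elemF d) = (x \in fixF charC d).
Proof.
move=> d0; rewrite -root_prod_XsubC -elemF_spec // rootE !hornerE.
by rewrite subr_eq0.
Qed.

Lemma uniq_elemF d : (0 < d)%N -> uniq (elemF d).
Proof.
move=> d0; rewrite -separable_prod_XsubC -elemF_spec // unlock derivB derivX derivXn.
have -> : (p ^ d)%N = (p * p ^ d.-1)%N by rewrite -expnS prednK.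
have p0 : p%:R = 0 :> {poly C} by rewrite -polyC_natr (pcharf0 charC).
rewrite -mulr_natr natrM p0 mul0r mulr0 sub0r.
by rewrite -[- 1]scaleN1r coprimepZr ?oppr_eq0 ?oner_eq0 ?coprimep1.
Qed.

Lemma root_frob d (q : {poly C}) x : q \is a polyOver (fixF charC d) ->
  root q x -> root q (frob charC d x).
Proof.
move=> /polyOverP Hq /rootP qx; apply/rootP.
have -> : q = map_poly (frob charC d) q.
  by apply/polyP => i; rewrite coef_map [RHS](fixFP _ _ (Hq i)).
by rewrite horner_map qx rmorph0.
Qed.

(** The orbit of [x] under the [p ^ d]-Frobenius consists of roots of [q]. *)
Lemma root_degree d (q : {poly C}) x : q \is a polyOver (fixF charC d) -> q != 0 ->
  root q x -> exists2 r, (0 < r < size q)%N & x \in fixF charC (d * r).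
Proof.
move=> Hq q0 qx; have qn : (0 < size q)%N by rewrite size_poly_gt0.
pose s := [seq frob charC (d * i) x | i <- iota 0 (size q)].
have sroot : all (root q) s.
  apply/allP => _ /mapP[i _ ->]; elim: i => [|i IH]; first by rewrite muln0 frob0.
  by rewrite mulnS -frob_comp; exact: root_frob.
have : ~~ uniq s.
  apply/negP => us; have := max_poly_roots q0 sroot us.
  by rewrite size_map size_iota ltnn.
move=> /(uniqPn 0)[i [j [ij]]]; rewrite size_map size_iota => jq.
rewrite !(nth_map 0%N) ?size_iota ?(ltn_trans ij) // !nth_iota ?(ltn_trans ij) //.
rewrite !add0n -[in RHS](subnKC (ltnW ij)) mulnDr -frob_comp => /frob_inj H.
exists (j - i)%N; first by rewrite subn_gt0 ij (leq_ltn_trans (leq_subr _ _)).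
by apply/fixFP; rewrite -frobE -H.
Qed.

Hypothesis algebraicC : forall x : C, exists2 d, (0 < d)%N & x \in fixF charC d.

Let exists_fixF x : exists d, (0 < d)%N && (x \in fixF charC d).
Proof. by have [d d0 H] := algebraicC x; exists d; rewrite d0. Qed.

(** The degree of [x] over the prime field, read off from the smallest finite field containing [x];
    [deg_val] matches it with the degree of a minimal polynomial. *)
Definition dgr (x : C) : nat := ex_minn (exists_fixF x).

Lemma dgr_gt0 x : (0 < dgr x)%N.
Proof. by rewrite /dgr; case: ex_minnP => d /andP[]. Qed.

Lemma fixF_dgr x : x \in fixF charC (dgr x).
Proof. by rewrite /dgr; case: ex_minnP => d /andP[]. Qed.

Lemma dgr_le x d : (0 < d)%N -> x \in fixF charC d -> (dgr x <= d)%N.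
Proof. by move=> d0 H; rewrite /dgr; case: ex_minnP => e _; apply; rewrite d0. Qed.

Lemma fixFE d x : (x \in fixF charC d) = (dgr x %| d)%N.
Proof.
apply/idP/idP => [H|/fixF_dvd]; last by apply; exact: fixF_dgr.
have G := fixF_gcd (dgr_gt0 x) (fixF_dgr x) H.
rewrite -[dgr x](_ : gcdn (dgr x) d = _) ?dvdn_gcdr //.
apply/eqP; rewrite eqn_leq dgr_le ?gcdn_gt0 ?dgr_gt0 // andbT.
by rewrite dvdn_leq ?dgr_gt0 ?dvdn_gcdl.
Qed.

End FiniteSubfields.

(** * Power sums on the unit circle *)

Section PowerSums.
Local Open Scope ring_scope.
Import Num.Theory.

(** The sum 1 + x + ... + x^(k-1) has k terms, each at least x^k, so k (1 - x) x^k <= 1 - x^k <= 1,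
    and the Archimedean property concludes. *)
Lemma expr_small (x e : algC) : 0 <= x -> x < 1 -> 0 < e ->
  exists K, forall k, (K <= k)%N -> x ^+ k < e.
Proof.
move=> x0 x1 e0; have d0 : 0 < 1 - x by rewrite subr_gt0.
exists (Num.bound ((1 - x) * e)^-1) => k Kk.
have H : k%:R * ((1 - x) * x ^+ k) <= 1.
  apply: (@le_trans _ _ (1 - x ^+ k)); last by rewrite gerBl exprn_ge0.
  rewrite -[leRHS]opprB subrX1 -mulNr opprB mulrCA ler_pM2l //.
  rewrite mulr_natl -[X in _ *+ X]card_ord -sumr_const; apply: ler_sum => i _.
  by apply: ler_wiXn2l => //; [exact: ltW | exact: ltnW].
have k0 : 0 < k%:R :> algC.
  apply: lt_le_trans (_ : (Num.bound ((1 - x) * e)^-1)%:R <= _); last by rewrite ler_nat.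
  by apply: le_lt_trans (archi_boundP _); rewrite invr_ge0 ltW ?mulr_gt0.
rewrite real_ltNge; [|by rewrite ger0_real ?exprn_ge0|by rewrite gtr0_real].
apply/negP => ek.
have : k%:R * ((1 - x) * e) <= 1.
  by apply: le_trans H; rewrite ler_pM2l // ler_pM2l.
rewrite -ler_pdivlMr ?mulr_gt0 // mul1r => H2.
have : ((1 - x) * e)^-1 < k%:R.
  apply: lt_le_trans (archi_boundP _) _; last by rewrite ler_nat.
  by rewrite invr_ge0 ltW ?mulr_gt0.
by move=> /(le_lt_trans H2); rewrite ltxx.
Qed.

Lemma natmul_bounded (x B : algC) : 0 <= B -> 0 < x ->
  (forall N : nat, N%:R * x <= B) -> False.
Proof.
move=> B0 x0 /(_ (Num.bound (B / x))); rewrite -ler_pdivlMr // => H.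
have /archi_boundP/(le_lt_trans H) : 0 <= B / x by rewrite divr_ge0 // ltW.
by rewrite ltxx.
Qed.

(** A geometric sum of ratio [w != 1] stays bounded, so the mean of the powers of [w] tends to the
    indicator of [w = 1]. For [w = 1] the right side is 2 / 0 = 0, and the left side vanishes
    too. *)
Lemma geom_bounded (w : algC) N : `|w| <= 1 ->
  `|N%:R * (w == 1)%:R - \sum_(k < N) w ^+ k.+1| <= 2 / `|w - 1|.
Proof.
move=> w1; have [->|wn] := eqVneq w 1.
  rewrite subrr normr0 invr0 mulr0 mulr1.
  rewrite (eq_bigr (fun=> 1)) => [|i _]; last by rewrite expr1n.
  by rewrite sumr_const card_ord subrr normr0.
rewrite mulr0 sub0r normrN ler_pdivlMr ?normr_gt0 ?subr_eq0 // -normrM mulrC.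
rewrite (eq_bigr (fun k : 'I_N => w * w ^+ k)) => [|i _]; last by rewrite exprS.
rewrite -mulr_sumr mulrCA -subrX1 normrM mulrC.
apply: (@le_trans _ _ (`|w ^+ N - 1| * 1)); first by rewrite ler_wpM2l.
rewrite mulr1; apply: le_trans (ler_normB _ _) _.
by rewrite normr1 normrX lerD ?exprn_ile1.
Qed.

Definition psum (z : seq algC) (k : nat) : algC := \sum_(x <- z) x ^+ k.

Lemma psum_norm z k :
  `|psum z k| ^+ 2 = \sum_(x <- z) \sum_(y <- z) (x * y^*) ^+ k.
Proof.
rewrite normCK /psum rmorph_sum mulr_suml; apply: eq_bigr => x _.
by rewrite mulr_sumr; apply: eq_bigr => y _; rewrite rmorphXn exprMn.
Qed.

(** In the closed unit disk [x * y^* = 1] forces |x| = |y| = 1 and x = y, so there this is the sum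
    of the squared multiplicities of the elements of [z] on the unit circle. *)
Definition unit_pairs (z : seq algC) : algC :=
  \sum_(x <- z) \sum_(y <- z) (x * y^* == 1)%:R.

Lemma unit_pairs_real z : unit_pairs z \is Num.real.
Proof. by apply: rpred_sum => x _; apply: rpred_sum => y _; exact: realn. Qed.

(** Averaging [|psum z k|^2] over [k] isolates the pairs of equal elements on
    the unit circle. *)
Lemma unit_pairs_bound z : (forall x, x \in z -> `|x| <= 1) ->
  exists2 B : algC, 0 <= B &
    forall N, N%:R * unit_pairs z <= \sum_(k < N) `|psum z k.+1| ^+ 2 + B.
Proof.
move=> z1; pose B : algC := \sum_(x <- z) \sum_(y <- z) 2 / `|x * y^* - 1|.
exists B => [|N].
  by apply: sumr_ge0 => x _; apply: sumr_ge0 => y _; rewrite divr_ge0.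
have real1 : \sum_(k < N) `|psum z k.+1| ^+ 2 \is Num.real.
  by apply: rpred_sum => k _; rewrite ger0_real ?exprn_ge0.
rewrite -lerBlDl; apply: le_trans (real_ler_norm _) _.
  by rewrite rpredB // rpredM ?realn ?unit_pairs_real.
have -> : N%:R * unit_pairs z - \sum_(k < N) `|psum z k.+1| ^+ 2 =
    \sum_(x <- z) \sum_(y <- z) (N%:R * (x * y^* == 1)%:R - \sum_(k < N) (x * y^*) ^+ k.+1).
  rewrite (eq_bigr _ (fun (k : 'I_N) _ => psum_norm z k.+1)) exchange_big /=.
  rewrite /unit_pairs mulr_sumr -sumrB; apply: eq_bigr => x _.
  by rewrite mulr_sumr exchange_big -sumrB.
apply: le_trans (ler_norm_sum _ _ _) _; rewrite /B !big_seq.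
apply: ler_sum => x xz; apply: le_trans (ler_norm_sum _ _ _) _; rewrite !big_seq.
apply: ler_sum => y yz; apply: geom_bounded.
by rewrite normrM norm_conjC mulr_ile1 ?z1.
Qed.

Lemma max_norm (z : seq algC) : z != [::] ->
  exists2 x, x \in z & forall y, y \in z -> `|y| <= `|x|.
Proof.
elim: z => // a z IH _; have [->|/IH[x xz xm]] := eqVneq z [::].
  by exists a => [|y]; rewrite inE // => /eqP ->.
have [ax|xa] := real_leP (normr_real a) (normr_real x).
  exists x => [|y]; rewrite inE ?xz ?orbT // => /predU1P[->//|]; exact: xm.
exists a => [|y]; rewrite inE ?eqxx // => /predU1P[->//|/xm yx].
exact: le_trans yx (ltW xa).
Qed.

Lemma unit_row_ge1 (z : seq algC) x : x \in z -> `|x| = 1 ->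
  1 <= \sum_(y <- z) (x * y^* == 1)%:R :> algC.
Proof.
move=> xz x1; rewrite (big_rem x) //=.
have -> : x * x^* = 1 by rewrite -normCK x1 expr1n.
by rewrite eqxx lerDl; apply: sumr_ge0.
Qed.

Lemma unit_pairs_ge1 z x : x \in z -> `|x| = 1 -> 1 <= unit_pairs z.
Proof.
move=> xz x1; rewrite /unit_pairs (big_rem x) //=.
apply: le_trans (unit_row_ge1 xz x1) _; rewrite lerDl.
by apply: sumr_ge0 => y _; apply: sumr_ge0.
Qed.

Lemma unit_pairs_ge2 z x y : x \in z -> y \in rem x z -> `|x| = 1 -> `|y| = 1 ->
  2 <= unit_pairs z.
Proof.
move=> xz yz x1 y1; rewrite /unit_pairs (big_rem x xz) /= (big_rem y yz) /=.
rewrite -[2]/(1 + 1); apply: lerD; first exact: unit_row_ge1.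
apply: le_trans (unit_row_ge1 (mem_rem yz) y1) _; rewrite lerDl.
by apply: sumr_ge0 => t _; apply: sumr_ge0.
Qed.

(** Suppose the largest modulus [r] exceeds 1 and divide [z] by [r]. The result lies in the disk and
    meets the circle, so its squared power sums have sum at least N - B over k <= N; but they are at
    most r^(-k), whose sum is bounded. *)
Lemma psum_disk z : (forall k, `|psum z k.+1| <= 1) -> forall x, x \in z -> `|x| <= 1.
Proof.
move=> p1 x xz; have [x0 x0z xm] : exists2 x, x \in z & forall y, y \in z -> `|y| <= `|x|.
  by apply: max_norm; case: (z) xz.
apply: le_trans (xm x xz) _; rewrite real_leNgt ?normr_real ?real1 //.
apply/negP => r1; set r : algC := `|x0| in xm r1 *.
have r0 : 0 < r by apply: lt_trans r1.
have rr : r^-1 < 1 by rewrite invf_lt1.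
pose z' := [seq x / r | x <- z].
have psz k : psum z' k = psum z k / r ^+ k.
  rewrite /psum big_map mulr_suml; apply: eq_bigr => y _.
  by rewrite exprMn exprVn.
have [|B B0 HB] := @unit_pairs_bound z'.
  move=> _ /mapP[y yz ->]; rewrite normrM normfV (gtr0_norm r0).
  by rewrite ler_pdivrMr // mul1r xm.
have u1 : 1 <= unit_pairs z'.
  apply: (@unit_pairs_ge1 _ (x0 / r)); first exact: map_f.
  by rewrite normrM normfV (gtr0_norm r0) divff ?gt_eqF.
apply: (@natmul_bounded 1 (2 / `|r^-1 - 1| + B)) => // [|N].
  by rewrite addr_ge0 // divr_ge0.
apply: le_trans (_ : N%:R * unit_pairs z' <= _); first by rewrite ler_wpM2l.
apply: le_trans (HB N) _; rewrite lerD2r.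
have rn : `|r^-1| <= 1 by rewrite gtr0_norm ?invr_gt0 // ltW.
have := geom_bounded N rn; rewrite (lt_eqF rr) mulr0 sub0r normrN.
apply: le_trans; apply: le_trans (real_ler_norm _); last first.
  by apply: rpred_sum => k _; rewrite rpredX // ger0_real ?invr_ge0 ?ltW.
apply: ler_sum => k _; rewrite psz normrM normfV normrX (gtr0_norm r0).
rewrite exprMn -exprVn; set t := r^-1 ^+ k.+1.
have t0 : 0 <= t by rewrite exprn_ge0 // invr_ge0 ltW.
have t1 : t <= 1 by apply: exprn_ile1; [rewrite invr_ge0 ltW | exact: ltW].
rewrite [t ^+ 2]expr2 mulrA; apply: ler_piMl => //.
have p2 : `|psum z k.+1| ^+ 2 <= 1 by apply: exprn_ile1.
by apply: mulr_ile1 => //; apply: exprn_ge0.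
Qed.

(** The mean of |psum z k|^2 is at most 1 and tends to [unit_pairs z]. Hence at most one element of
    [z] is on the circle, with multiplicity 1. *)
Lemma psum_unit_pairs z : (forall k, `|psum z k.+1| <= 1) -> unit_pairs z <= 1.
Proof.
move=> p1; have [B B0 HB] := unit_pairs_bound (psum_disk p1).
rewrite real_leNgt ?unit_pairs_real ?real1 //; apply/negP => u1.
apply: (@natmul_bounded (unit_pairs z - 1) B) => // [|N]; first by rewrite subr_gt0.
rewrite mulrBr lerBlDl mulr1; apply: le_trans (HB N) _; rewrite lerD2r.
rewrite -[N in leRHS]card_ord -sumr_const; apply: ler_sum => k _.
by rewrite exprn_ile1.
Qed.

Lemma psum_pow2 z : (forall k, `|psum z k.+1| <= 1) ->
  (forall i, psum z (2 ^ i) = -1) -> False.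
Proof.
move=> p1 p2; have zd := psum_disk p1.
(* The value [x = 0] stands for the case with no element on the circle; the restriction to k > 0 is
   there because 0^0 = 1. *)
have [x [z' [zE x1 z'1]]] : exists x z',
    [/\ forall k, (0 < k)%N -> psum z k = x ^+ k + psum z' k, (x == 0) || (`|x| == 1) &
      forall y, y \in z' -> `|y| < 1].
  have [/hasP[x xz /eqP x1]|/hasPn no] := boolP (has (fun x => `|x| == 1) z); last first.
    exists 0, z; split=> [k k0||y yz]; rewrite ?eqxx //.
      by rewrite expr0n -[k == 0]negbK -lt0n k0 add0r.
    by rewrite lt_neqAle no ?zd.
  exists x, (rem x z); split=> [k _||y yz]; first by rewrite /psum (big_rem x).
    by rewrite x1 eqxx orbT.
  rewrite lt_neqAle zd ?(mem_rem yz) // andbT; apply/eqP => y1.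
  have := le_trans (unit_pairs_ge2 xz yz x1 y1) (psum_unit_pairs p1).
  by rewrite lern1.
have [K HK] : exists K, forall k, (K <= k)%N -> `|psum z' k| < 2^-1.
  have [z0|zn] := eqVneq z' [::].
    by exists 0%N => k _; rewrite z0 /psum big_nil normr0 invr_gt0 ltr0n.
  have [m mz mm] := max_norm zn.
  have s0 : 0 < (size z')%:R :> algC by rewrite ltr0n lt0n size_eq0.
  have [|K HK] := @expr_small `|m| (2^-1 / (size z')%:R) (normr_ge0 _) (z'1 _ mz).
    by rewrite divr_gt0 // invr_gt0 ltr0n.
  exists K => k /HK; rewrite ltr_pdivlMr // mulrC mulr_natl; apply: le_lt_trans.
  apply: le_trans (ler_norm_sum _ _ _) _.
  have -> : `|m| ^+ k *+ size z' = \sum_(y <- z') `|m| ^+ k.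
    by rewrite big_const_seq count_predT iter_addr_0.
  rewrite !big_seq; apply: ler_sum => y yz; rewrite normrX.
  by apply: lerXn2r; rewrite ?nnegrE ?mm.
have n2 : 2^-1 < 1 :> algC by rewrite invf_lt1 ?ltr1n ?ltr0n.
pose k := (2 ^ K)%N; have Kk : (K <= k)%N by rewrite ltnW // ltn_expl.
have k0 : (0 < k)%N by rewrite expn_gt0.
have e1 := zE k k0; rewrite p2 in e1.
have e2 := zE (k * 2)%N; rewrite /k -expnSr p2 expnSr -/k exprM muln_gt0 k0 in e2.
have x1' : `|x| = 1.
  have [x0|//] := orP x1; last by move/eqP.
  have := HK k Kk; move: e1; rewrite (eqP x0) expr0n -[k == 0]negbK -lt0n k0 add0r => <-.
  by rewrite normrN normr1 => /lt_trans/(_ n2); rewrite ltxx.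
have h1 : `|x ^+ k + 1| < 2^-1.
  have -> : x ^+ k + 1 = - psum z' k by rewrite -[1]opprK e1; ring.
  by rewrite normrN HK.
have h2 : `|(x ^+ k) ^+ 2 + 1| < 2^-1.
  have -> : (x ^+ k) ^+ 2 + 1 = - psum z' (k * 2)%N by rewrite -[1]opprK e2 //; ring.
  by rewrite normrN HK // (leq_trans Kk) // leq_pmulr.
have h3 : `|x ^+ k - 1| <= 2.
  by apply: le_trans (ler_normB _ _) _; rewrite normrX x1' expr1n normr1.
(* With t = x^k, both t + 1 and t^2 + 1 have modulus below 1/2, while |t - 1| <= 2; this identity
   then bounds 2 by 1/2 + 2 * 1/2. *)
have h4 : 2 = ((x ^+ k) ^+ 2 + 1) - (x ^+ k - 1) * (x ^+ k + 1) by ring.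
have : `|2 : algC| < 2.
  rewrite [X in `|X|]h4; apply: le_lt_trans (ler_normB _ _) _.
  rewrite normrM; apply: lt_le_trans (_ : 2^-1 + 2 * 2^-1 <= _).
    by apply: ltr_leD => //; apply: ler_pM => //; exact: ltW.
  by rewrite divff ?pnatr_eq0 // -[leRHS]/(1 + 1) lerD2r ltW.
by rewrite normr_nat ltxx.
Qed.

(** The polynomial of constant term 1 with reciprocal roots [z], the shape in which an L-function
    factors. *)
Definition char_prod (z : seq algC) : {poly algC} := \prod_(x <- z) (1 - x *: 'X).

Lemma geom_poly (x : algC) N :
  (\poly_(k < N) x ^+ k.+1) * (1 - x *: 'X) = x%:P - (x ^+ N.+1 *: 'X^N).
Proof.
have -> : \poly_(k < N) x ^+ k.+1 = x *: \sum_(k < N) (x *: 'X) ^+ k.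
  rewrite poly_def scaler_sumr; apply: eq_bigr => k _.
  by rewrite exprZn scalerA -exprS.
rewrite -scalerAl mulrC -[1 - _]opprB mulNr -subrX1 opprB scalerBr exprZn scalerA.
by rewrite -exprS -mul_polyC mulr1.
Qed.

(** Newton's identities: [G' = - (sum_k p_(k+1) X^k) G], truncated at [X^N]. *)
Lemma newton_poly z N : exists r,
  (char_prod z)^`() = - (\poly_(k < N) psum z k.+1) * char_prod z + 'X^N * r.
Proof.
elim: z => [|x z [r IH]].
  exists 0; rewrite /char_prod big_nil derivC mulr0 addr0 mulr1.
  by apply/polyP => i; rewrite coefN coef_poly coef0 /psum big_nil if_same oppr0.
(* The new error term is the tail x^(N+1) X^N of the truncated geometric series of [x]. *)
exists ((1 - x *: 'X) * r - x ^+ N.+1 *: char_prod z).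
have -> : char_prod (x :: z) = (1 - x *: 'X) * char_prod z by rewrite /char_prod big_cons.
have -> : \poly_(k < N) psum (x :: z) k.+1 =
    \poly_(k < N) x ^+ k.+1 + \poly_(k < N) psum z k.+1.
  apply/polyP => i; rewrite coefD !coef_poly /psum big_cons.
  by case: ifP; rewrite ?addr0.
rewrite derivM IH derivB derivZ derivX derivC sub0r.
have E := geom_poly x N; set T := \poly_(k < N) x ^+ k.+1 in E *.
set S := \poly_(k < N) _.
have -> : - (T + S) * ((1 - x *: 'X) * char_prod z) =
  - (T * (1 - x *: 'X)) * char_prod z - S * (1 - x *: 'X) * char_prod z by ring.
rewrite E -!mul_polyC; ring.
Qed.

Lemma newton_identity z d : (0 < d)%N ->
  d%:R * (char_prod z)`_d = - \sum_(k < d) psum z k.+1 * (char_prod z)`_(d - k.+1).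
Proof.
case: d => // d _; have [r E] := newton_poly z d.+1.
have := congr1 (fun q : {poly algC} => q`_d) E.
rewrite coef_deriv mulr_natl => ->.
rewrite coefD coefXnM ltnSn addr0 mulNr coefN coefM; congr (- _).
by apply: eq_bigr => k _; rewrite coef_poly ltn_ord subSS.
Qed.

Lemma char_prod0 z : (char_prod z)`_0 = 1.
Proof.
rewrite -horner_coef0 /char_prod horner_prod big1 // => x _.
by rewrite !hornerE ?mulr0 ?oppr0 ?addr0 ?subr0.
Qed.

Lemma char_prod_factor (A : {poly algC}) : A`_0 = 1 -> exists z, A = char_prod z.
Proof.
move=> A0; have [w E] := closed_field_poly_normal A.
have lA : lead_coef A != 0.
  rewrite lead_coef_eq0; apply/eqP => Az; move: A0; rewrite Az coef0 => /eqP.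
  by rewrite eq_sym oner_eq0.
have w0 : forall x, x \in w -> x != 0.
  move=> x xw; apply/eqP => x0; have : root A 0.
    by rewrite E rootZ // root_prod_XsubC -x0.
  by rewrite rootE horner_coef0 A0 oner_eq0.
exists [seq x^-1 | x <- w].
have E2 : \prod_(x <- w) ('X - x%:P) = (\prod_(x <- w) - x) *: char_prod [seq x^-1 | x <- w].
  rewrite /char_prod big_map; elim: w w0 {E} => [|x w IH] w0; first by rewrite !big_nil scale1r.
  rewrite !big_cons IH => [|y yw]; last by apply: w0; rewrite inE yw orbT.
  rewrite -scalerAr [- x * _]mulrC -scalerA; congr (_ *: _).
  rewrite scalerAl; congr (_ * _).
  rewrite scalerBr scalerA mulNr divff ?w0 ?mem_head // scaleN1r opprK addrC.
  by rewrite -mul_polyC mulr1 polyCN.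
move: E; rewrite E2 scalerA => E; rewrite E.
have := congr1 (fun q : {poly algC} => q`_0) E; rewrite A0 coefZ char_prod0 mulr1 => <-.
by rewrite scale1r.
Qed.

(** The recurrence is Newton's identity up to sign: if [z] are the reciprocal roots of the
    polynomial with coefficients [a], then [psum z k = - s k]. This is why the values 1 of [s]
    become the -1 of [psum_pow2]. *)
Lemma newton_pow2 n (a s : nat -> algC) : a 0%N = 1 ->
  (forall d, (n <= d)%N -> a d = 0) ->
  (forall d, (0 < d)%N -> d%:R * a d = \sum_(k < d) s k.+1 * a (d - k.+1)%N) ->
  (forall k, `|s k.+1| <= 1) -> (forall i, s (2 ^ i)%N = 1) -> False.
Proof.
move=> a0 an Ha s1 s2.
have aE d : (\poly_(i < n) a i)`_d = a d.
  by rewrite coef_poly; case: ltnP => // /an.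
have [|z Az] := @char_prod_factor (\poly_(i < n) a i); first by rewrite aE.
have psE k : psum z k.+1 = - s k.+1.
  elim/ltn_ind: k => k IH; have := newton_identity z (ltn0Sn k).
  rewrite -Az aE Ha // !big_ord_recr /= subnn aE a0 !mulr1 opprD.
  have -> : \sum_(i < k) psum z i.+1 * (\poly_(i0 < n) a i0)`_(k.+1 - i.+1) =
     - \sum_(i < k) s i.+1 * a (k.+1 - i.+1)%N.
    by rewrite -sumrN; apply: eq_bigr => i _; rewrite IH // aE mulNr.
  by rewrite opprK => /addrI ->; rewrite opprK.
apply: (@psum_pow2 z) => [k|i]; first by rewrite psE normrN.
by case: (2 ^ i)%N (s2 i) (expn_gt0 2 i) => // k; rewrite psE => ->.
Qed.

End PowerSums.

(** * Character sums over polynomials *)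

Section SmallPolynomials.
Local Open Scope ring_scope.
Variables (C : closedFieldType) (p : nat).
Hypothesis charC : p \in [pchar C].
Local Notation F d := (fixF charC d).
Local Notation elems d := (elemF C p d).

Fixpoint lows (d n : nat) : seq {poly C} :=
  if n is n'.+1 then [seq q * 'X + c%:P | q <- lows d n', c <- elems d] else [:: 0].

Lemma mem_lows d n q : (0 < d)%N ->
  (q \in lows d n) = (size q <= n)%N && (q \is a polyOver (F d)).
Proof.
move=> d0; elim: n q => [|n IH] q /=.
  rewrite inE leqn0 size_poly_eq0; case: eqP => // ->; by rewrite rpred0.
apply/allpairsP/andP => [[[r c] /= [+ cd ->]]|[sq qF]].
  rewrite IH => /andP[sr rF]; rewrite mem_elemF // in cd.
  split; first by rewrite size_MXaddC; case: ifP.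
  by rewrite rpredD ?polyOverC // rpredM // polyOverX.
exists (\poly_(i < n) q`_i.+1, q`_0); split => /=.
- rewrite IH size_poly /=; apply/polyOverP => i; rewrite coef_poly.
  by case: ifP; rewrite ?rpred0 // (polyOverP qF).
- by rewrite mem_elemF // (polyOverP qF).
apply/polyP => -[|i]; rewrite coefD coefMX coefC /= ?add0r // addr0 coef_poly.
by case: ltnP => // ni; rewrite nth_default // (leq_trans sq).
Qed.

Lemma uniq_lows d n : (0 < d)%N -> uniq (lows d n).
Proof.
move=> d0; elim: n => //= n IH; apply: allpairs_uniq => //; first exact: uniq_elemF.
move=> [q c] [r b] _ _ /= E.
have cb : c = b.
  by have := congr1 (fun h : {poly C} => h`_0) E; rewrite !coefD !coefMX !coefC /= !add0r.
congr (_, _) => //; apply/polyP => i.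
by have := congr1 (fun h : {poly C} => h`_i.+1) E; rewrite !coefD !coefMX !coefC /= !addr0.
Qed.

Lemma size_lows d n : (0 < d)%N -> size (lows d n) = (p ^ (d * n))%N.
Proof.
move=> d0; elim: n => [|n IH] /=; first by rewrite muln0.
by rewrite size_allpairs IH size_elemF // mulnS mulnC expnD.
Qed.

Lemma root_small d n x (q : {poly C}) :
  (forall r, (0 < r < n)%N -> x \notin F (d * r)) ->
  q \is a polyOver (F d) -> (size q <= n)%N -> root q x -> q = 0.
Proof.
move=> Hx qF sq qx; apply/eqP; apply: contraT => q0.
have [r /andP[r0 rq] xr] := root_degree qF q0 qx.
by have := Hx r; rewrite r0 (leq_trans rq sq) xr => /(_ isT).
Qed.

(** By counting: [q |-> q.[x]] is injective on polynomials of size at most [n]. *)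
Lemma eval_surj d n x y : (0 < d)%N -> (0 < n)%N ->
  (forall r, (0 < r < n)%N -> x \notin F (d * r)) ->
  x \in F (d * n) -> y \in F (d * n) ->
  exists q, [/\ q \is a polyOver (F d), (size q <= n)%N & q.[x] = y].
Proof.
move=> d0 n0 Hx xF yF; have dn0 : (0 < d * n)%N by rewrite muln_gt0 d0.
pose s := [seq q.[x] | q <- lows d n].
have us : uniq s.
  rewrite map_inj_in_uniq ?uniq_lows // => q r.
  rewrite !mem_lows // => /andP[sq qF] /andP[sr rF] E; apply/eqP; rewrite -subr_eq0.
  apply/eqP/(root_small Hx); first by rewrite rpredB.
    by rewrite (leq_trans (size_polyD _ _)) // geq_max sq size_polyN.
  by rewrite rootE hornerD hornerN E subrr.
have sF : {subset s <= elems (d * n)}.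
  move=> _ /mapP[q + ->]; rewrite mem_lows // mem_elemF // => /andP[_ qF].
  apply: rpred_horner => //; apply: polyOverS qF => z; exact: fixF_mul.
have [|_ H] := uniq_min_size us sF; first by rewrite size_map size_lows ?size_elemF.
have : y \in s by rewrite H mem_elemF.
by move=> /mapP[q + ->]; rewrite mem_lows // => /andP[sq qF]; exists q.
Qed.

End SmallPolynomials.

Section Characters.
Local Open Scope ring_scope.
Import Num.Theory.
Variables (C : closedFieldType) (p : nat).
Hypothesis charC : p \in [pchar C].
Local Notation F d := (fixF charC d).
Local Notation elems d := (elemF C p d).

Lemma sum_translate (s : seq C) (f : C -> algC) a : uniq s ->
  (forall x, (x + a \in s) = (x \in s)) ->
  \sum_(x <- s) f (x + a) = \sum_(x <- s) f x.
Proof.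
move=> us H; rewrite -(big_map (fun x => x + a) xpredT f); apply: perm_big.
apply: uniq_perm => //; first by rewrite map_inj_uniq //; exact: addIr.
by move=> x; rewrite -{1}[x](subrK a) (mem_map (addIr a)) -H subrK.
Qed.

Lemma fixF_expr_pred d x : x \in F d -> x != 0 -> x ^+ (p ^ d).-1 = 1.
Proof.
move=> /fixFP H x0; apply: (mulIf x0); rewrite mul1r -exprSr prednK //.
by rewrite expn_gt0 prime_gt0 // (pcharf_prime charC).
Qed.

(** Otherwise X^(e+1) - X would vanish at all p^d elements of [F d], more than its degree. *)
Lemma exists_nonpower d e : (0 < d)%N -> (0 < e)%N -> (e < (p ^ d).-1)%N ->
  exists x, [/\ x \in F d, x != 0 & x ^+ e != 1].
Proof.
move=> d0 e0 eq; apply: contrapT => no.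
have H : all (root ('X^(e.+1) - 'X : {poly C})) (elems d).
  apply/allP => x; rewrite (mem_elemF charC) // => xd; rewrite rootE !hornerE exprSr.
  have [->|x0] := eqVneq x 0; first by rewrite mulr0 subrr.
  have [->|xe] := eqVneq (x ^+ e) 1; first by rewrite mul1r subrr.
  by exfalso; apply: no; exists x.
have sz : size ('X^(e.+1) - 'X : {poly C}) = e.+2.
  by rewrite size_polyDl ?size_polyXn // size_polyN size_polyX.
have := max_poly_roots _ H (uniq_elemF charC d0).
rewrite -size_poly_gt0 sz size_elemF // => /(_ isT).
rewrite leqNgt ltnS -(@prednK (p ^ d)) ?ltnS ?(leq_trans _ eq) //.
by rewrite expn_gt0 prime_gt0 // (pcharf_prime charC).
Qed.

(** With e = (p^d - 1) / u, the map x |-> x^e sends the nonzero elements of [F d] to u-th roots of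
    unity in [C]; matching a primitive one [z] with a primitive one [w] in [algC] gives a character.
    Multiplying by an [x0] with [chi x0 != 1] permutes [F d], so the sum of the character is 0. *)
Lemma character_exists d u : (0 < d)%N -> prime u -> (u %| (p ^ d).-1)%N ->
  (0 < (p ^ d).-1)%N ->
  exists chi : C -> algC,
  [/\ chi 0 = 0, {in F d &, {morph chi : x y / x * y}}, forall x, `|chi x| <= 1,
      forall x, x != 0 -> x ^+ ((p ^ d).-1 %/ u) = 1 -> chi x = 1 &
      \sum_(x <- elems d) chi x = 0].
Proof.
move=> d0 pu ud q0; set e := ((p ^ d).-1 %/ u)%N.
have eu : (e * u = (p ^ d).-1)%N by rewrite divnK.
have e0 : (0 < e)%N by rewrite divn_gt0 ?prime_gt0 // dvdn_leq.
have [|x0 [x0F x0n x0e]] := exists_nonpower d0 e0.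
  by rewrite -eu -{1}[e]muln1 ltn_pmul2l // prime_gt1.
pose z := x0 ^+ e.
have zu : z ^+ u = 1 by rewrite -exprM eu fixF_expr_pred.
have zprim : u.-primitive_root z.
  have [m mz /(primeP pu).2] := prim_order_exists (prime_gt0 pu) zu.
  case/orP=> /eqP mE; rewrite mE in mz => //.
  by move: x0e; rewrite -/z -(prim_expr_order mz) expr1 eqxx.
have [w wprim] := C_prim_root_exists (prime_gt0 pu).
(* [pick] can fail only outside [F d], and then the value 0 keeps the bound by 1 valid on all of
   [C]. *)
pose chi x : algC := if x == 0 then 0 else
  if [pick i : 'I_u | x ^+ e == z ^+ i] is Some i then w ^+ i else 0.
have chiE x : x \in F d -> x != 0 -> exists2 i, x ^+ e = z ^+ i & chi x = w ^+ i.
  move=> xF xn; rewrite /chi (negbTE xn); case: pickP => [i /eqP xi|no].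
    by exists i.
  have xeu : (x ^+ e) ^+ u = 1 by rewrite -exprM eu fixF_expr_pred.
  by have [i xi] := prim_rootP zprim xeu; have := no i; rewrite xi eqxx.
have chi_mul x y : x \in F d -> y \in F d -> chi (x * y) = chi x * chi y.
  move=> xF yF; have [->|xn] := eqVneq x 0; first by rewrite mul0r /chi eqxx mul0r.
  have [->|yn] := eqVneq y 0; first by rewrite mulr0 /chi eqxx mulr0.
  have [i xi ->] := chiE x xF xn; have [j yj ->] := chiE y yF yn.
  have [||k xyk ->] := chiE (x * y); rewrite ?rpredM ?mulf_neq0 //.
  move: xyk; rewrite exprMn xi yj -!exprD => /eqP; rewrite (eq_prim_root_expr zprim) => H.
  by apply/eqP; rewrite (eq_prim_root_expr wprim) eq_sym.
have w1 : `|w| = 1.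
  apply/eqP; rewrite -(@pexpr_eq1 _ _ u) ?prime_gt0 //.
  by rewrite -normrX (prim_expr_order wprim) normr1.
have chi1 x : x != 0 -> x ^+ e = 1 -> chi x = 1.
  move=> xn xe; rewrite /chi (negbTE xn) xe; case: pickP => [i|/(_ (Ordinal (prime_gt0 pu)))].
    by rewrite eq_sym -(prim_order_dvd zprim) (prim_order_dvd wprim) => /eqP.
  by rewrite expr0 eqxx.
exists chi; split=> //.
- by rewrite /chi eqxx.
- move=> x; rewrite /chi; case: eqP => _; first by rewrite normr0.
  case: pickP => [i _|_]; first by rewrite normrX w1 expr1n.
  by rewrite normr0.
have c1 : chi x0 != 1.
  have [i xi ->] := chiE x0 x0F x0n; rewrite -(prim_order_dvd wprim).
  by rewrite (prim_order_dvd zprim) -xi.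
have E : \sum_(x <- elems d) chi x = chi x0 * \sum_(x <- elems d) chi x.
  rewrite mulr_sumr [RHS]big_seq [RHS](eq_bigr (fun x => chi (x0 * x))); last first.
    by move=> x; rewrite (mem_elemF charC) // => xd; rewrite chi_mul.
  rewrite -big_seq -(big_map (fun x => x0 * x) xpredT chi); apply: perm_big.
  apply: uniq_perm; rewrite ?uniq_elemF // ?map_inj_uniq ?uniq_elemF //; try exact: mulfI.
  move=> x; rewrite -{2}[x](mulVKf x0n) (mem_map (mulfI x0n)) !(mem_elemF charC) //.
  apply/idP/idP => H; first by rewrite rpredM // rpredV.
  by rewrite -[x](mulVKf x0n) rpredM.
apply/eqP; have := subrr (\sum_(x <- elems d) chi x).
rewrite {1}E -{2}[\sum_(x <- _) _]mul1r -mulrBl => /eqP.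
by rewrite mulf_eq0 subr_eq0 (negbTE c1).
Qed.
End Characters.

(** * Products over Frobenius conjugates *)

Section ConjugateProducts.
Local Open Scope ring_scope.
Variables (C : closedFieldType) (p : nat).
Hypothesis charC : p \in [pchar C].
Local Notation F d := (fixF charC d).
Local Notation elems d := (elemF C p d).
Local Notation frob := (frob charC).
Variable s : nat.
Hypothesis s0 : (0 < s)%N.

Definition monics (d : nat) : seq {poly C} := [seq 'X^d + r | r <- lows C p s d].

Lemma mem_monics d h :
  (h \in monics d) = [&& h \is monic, size h == d.+1 & h \is a polyOver (F s)].
Proof.
apply/mapP/and3P => [[r + ->]|[hm /eqP hs hF]].
  rewrite mem_lows // => /andP[sr rF]; split.
  - by rewrite monicE lead_coefDl ?lead_coefXn // size_polyXn ltnS.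
  - by rewrite size_polyDl ?size_polyXn // ltnS.
  - by rewrite rpredD ?polyOverXn.
exists (h - 'X^d); last by rewrite addrC subrK.
rewrite mem_lows // rpredB ?polyOverXn // andbT.
apply/leq_sizeP => j dj; rewrite coefB coefXn.
case: (ltngtP d j) dj => // [dj _|<- _].
  by rewrite nth_default ?hs // subr0.
by have := hm; rewrite monicE lead_coefE hs => /eqP ->; rewrite subrr.
Qed.

Lemma uniq_monics d : uniq (monics d).
Proof. by rewrite map_inj_uniq ?uniq_lows //; exact: addrI. Qed.

Lemma monics0 : monics 0 = [:: 1].
Proof. by rewrite /monics /= expr0 addr0. Qed.

(** A power of the minimal polynomial of [y] over [F s] when [y \in F (s * k)]. *)
Definition conjp (k : nat) (y : C) : {poly C} :=
  \prod_(l < k) ('X - (frob (s * l) y)%:P).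

Lemma size_conjp k y : size (conjp k y) = k.+1.
Proof. by rewrite /conjp size_prod_XsubC /index_enum -enumT size_enum_ord. Qed.

Lemma monic_conjp k y : conjp k y \is monic.
Proof. exact: monic_prod_XsubC. Qed.

(** The Frobenius of exponent [s] permutes the factors cyclically, because its k-th iterate fixes
    [y]. *)
Lemma conjp_over k y : y \in F (s * k) -> conjp k y \is a polyOver (F s).
Proof.
move=> yk; have H : map_poly (frob s) (conjp k y) = conjp k y.
  rewrite /conjp map_prod_XsubC; case: k yk => [|k] yk; first by rewrite !big_ord0.
  rewrite big_ord_recr big_ord_recl mulrC muln0 frob0 /=; congr (_ * _).
    by apply: eq_bigr => l _; rewrite frob_comp -mulnS.
  by rewrite frob_comp -mulnS [frob _ _](fixFP _ _ _ yk).
by apply/polyOverP => i; apply/fixFP; rewrite -(frobE charC) -{2}H coef_map.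
Qed.

Lemma conjp_in_monics k y : y \in F (s * k) -> conjp k y \in monics k.
Proof. by move=> yk; rewrite mem_monics monic_conjp size_conjp eqxx conjp_over. Qed.

Lemma frob_mod k l y : y \in F (s * k) -> frob (s * l) y = frob (s * (l %% k)) y.
Proof.
move=> yk; rewrite {1}(divn_eq l k) addnC mulnDr -frob_comp; congr (frob _ _).
by rewrite mulnC -mulnA mulnC [(k * s)%N]mulnC; apply/fixFP/fixF_mul.
Qed.

(** Multiplication by [conjp k y] is a bijection from the monic polynomials of degree d - k onto its
    monic multiples of degree d; the quotient has coefficients in [F s] because Frobenius fixes
    it. *)
Lemma prod_monics k d y (f : {poly C} -> algC) : y \in F (s * k) -> (k <= d)%N ->
  \sum_(h <- monics d | conjp k y %| h) f h = \sum_(h <- monics (d - k)) f (conjp k y * h).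
Proof.
move=> yk kd; rewrite -(big_map (fun h => conjp k y * h) xpredT f) -[LHS]big_filter.
have c0 : conjp k y != 0 by apply: monic_neq0; exact: monic_conjp.
apply: perm_big; apply: uniq_perm.
- exact/filter_uniq/uniq_monics.
- by rewrite map_inj_uniq ?uniq_monics //; exact: mulfI.
have szM h : h != 0 -> size (conjp k y * h) = (k + size h)%N.
  by move=> h0; rewrite size_mul // size_conjp.
move=> h; rewrite mem_filter; apply/andP/mapP => [[dv]|[g + ->]]; last first.
  rewrite !mem_monics dvdp_mulr // => /and3P[gm /eqP sg gF]; split=> //.
  rewrite monicMl ?monic_conjp // gm szM ?monic_neq0 // sg addnS subnKC // eqxx.
  by rewrite rpredM ?conjp_over.
rewrite mem_monics => /and3P[hm /eqP sh hF].
have E : h = conjp k y * (h %/ conjp k y) by rewrite mulrC divpK.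
have q0 : h %/ conjp k y != 0 by apply/eqP => q0; move: (monic_neq0 hm); rewrite E q0 mulr0 eqxx.
exists (h %/ conjp k y) => //; rewrite mem_monics; apply/and3P; split.
- by rewrite -(monicMr _ (monic_conjp k y)) mulrC -E.
- by move: sh; rewrite {1}E szM // => /eqP; rewrite -{1}(subnKC kd) -addnS eqn_add2l.
apply/polyOverP => i; apply/fixFP; rewrite -(frobE charC).
have mapE (g : {poly C}) : g \is a polyOver (F s) -> map_poly (frob s) g = g.
  by move=> gF; apply/polyP => j; rewrite coef_map [LHS](fixFP _ _ _ (polyOverP gF j)).
suff {2}-> : h %/ conjp k y = map_poly (frob s) (h %/ conjp k y) by rewrite coef_map.
by rewrite map_divp !mapE ?conjp_over.
Qed.

Lemma fixF_order y k0 : (0 < k0)%N -> y \in F (s * k0) ->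
  exists o, [/\ (0 < o)%N, y \in F (s * o) &
    forall k, (0 < k)%N -> (y \in F (s * k)) = (o %| k)%N].
Proof.
move=> k0_gt0 yk0.
have ex : exists k, (0 < k)%N && (y \in F (s * k)) by exists k0; rewrite k0_gt0.
case: (ex_minnP ex) => o /andP[o0 yo] min; exists o; split=> // k k1.
apply/idP/idP => [yk|ok]; last by apply: fixF_dvd yo; rewrite dvdn_mul.
have so0 : (0 < s * o)%N by rewrite muln_gt0 s0.
have := fixF_gcd so0 yo yk; rewrite -muln_gcdr => yg.
have og : (o <= gcdn o k)%N by apply: min; rewrite yg gcdn_gt0 o0.
suff -> : o = gcdn o k by exact: dvdn_gcdr.
by apply/eqP; rewrite eqn_leq og dvdn_leq // dvdn_gcdl.
Qed.

Lemma conjp_add o m y : y \in F (s * o) -> conjp (o + m) y = conjp o y * conjp m y.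
Proof.
move=> yo; rewrite /conjp big_split_ord /=; congr (_ * _); apply: eq_bigr => l _.
by rewrite mulnDr addnC -frob_comp [frob (s * o) y](fixFP _ _ _ yo).
Qed.

Lemma conjp_mul o a y : y \in F (s * o) -> conjp (o * a) y = conjp o y ^+ a.
Proof.
move=> yo; elim: a => [|a IH]; first by rewrite muln0 expr0 /conjp big_ord0.
by rewrite mulnS conjp_add // IH exprS.
Qed.

Section ConjugateMultiplicity.
Variables (y : C) (o : nat).
Hypotheses (o0 : (0 < o)%N) (yo : y \in F (s * o)).
Hypothesis ord_y : forall k, (0 < k)%N -> (y \in F (s * k)) = (o %| k)%N.

Lemma uniq_conj : uniq [seq frob (s * l) y | l <- iota 0 o].
Proof.
rewrite map_inj_in_uniq ?iota_uniq // => i j; rewrite !mem_iota !add0n /=.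
wlog ij : i j / (i < j)%N => [H io jo E|io jo].
  by case: (ltngtP i j) => // ij; [|symmetry]; apply: H.
rewrite -(subnKC (ltnW ij)) mulnDr -frob_comp => /frob_inj E.
have ji : (0 < j - i)%N by rewrite subn_gt0.
have : y \in F (s * (j - i)) by apply/fixFP; rewrite -(frobE charC) -E.
rewrite ord_y // => /(dvdn_leq ji); rewrite leqNgt; case/negP.
by rewrite ltn_subLR ?(leq_trans jo) ?leq_addl // ltnW.
Qed.

Lemma conjpE : conjp o y = \prod_(z <- [seq frob (s * l) y | l <- iota 0 o]) ('X - z%:P).
Proof.
rewrite big_map /conjp -(big_mkord xpredT (fun l => 'X - (frob (s * l) y)%:P)).
by rewrite /index_iota subn0.
Qed.

Lemma conjp_dvd_root h : h \is a polyOver (F s) -> root h y -> conjp o y %| h.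
Proof.
move=> hF hy; rewrite conjpE; apply: uniq_roots_dvdp; last first.
  by rewrite uniq_rootsE uniq_conj.
apply/allP => _ /mapP[l _ ->]; elim: l => [|l IH]; first by rewrite muln0 frob0.
by rewrite mulnS -frob_comp; exact: root_frob.
Qed.

Lemma conjp_pow_dvd h a : h \is a polyOver (F s) -> h != 0 ->
  (conjp o y ^+ a %| h) = (('X - y%:P) ^+ a %| h).
Proof.
have yP : conjp o y = ('X - y%:P) *
    \prod_(z <- behead [seq frob (s * l) y | l <- iota 0 o]) ('X - z%:P).
  by rewrite conjpE; case: (o) o0 => // o' _; rewrite /= big_cons muln0 frob0.
move=> hF h0; apply/idP/idP; first by apply: dvdp_trans; rewrite yP exprMn dvdp_mulIl.
elim: a h hF h0 => [|a IH] h hF h0 dv; first by rewrite expr0 dvd1p.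
have hy : root h y.
  by rewrite -dvdp_XsubCl; apply: dvdp_trans dv; rewrite exprS dvdp_mulIl.
have Pm : conjp o y \in monics o by exact: conjp_in_monics.
have := conjp_dvd_root hF hy; rewrite dvdp_eq => /eqP E.
set g := h %/ conjp o y in E.
have g0 : g != 0 by apply/eqP => g0; move: h0; rewrite E g0 mul0r eqxx.
have gF : g \is a polyOver (F s).
  apply/polyOverP => i; apply/fixFP; rewrite -(frobE charC).
  have mapE (q : {poly C}) : q \is a polyOver (F s) -> map_poly (frob s) q = q.
    by move=> qF; apply/polyP => j; rewrite coef_map [LHS](fixFP _ _ _ (polyOverP qF j)).
  suff {2}-> : g = map_poly (frob s) g by rewrite coef_map.
  by rewrite map_divp !mapE ?conjp_over.
rewrite E exprSr dvdp_mul2r ?monic_neq0 ?monic_conjp //; apply: IH => //.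
move: dv; rewrite E yP mulrCA exprS dvdp_mul2l ?polyXsubC_eq0 //.
rewrite Gauss_dvdpl // coprimep_expl // coprimep_sym coprimep_XsubC root_prod_XsubC.
by have := uniq_conj; case: (o) o0 => // o' _; rewrite /= muln0 frob0 => /andP[].
Qed.

Lemma sum_dvdn m : (\sum_(k < o * m) (o %| k.+1) = m)%N.
Proof.
elim: m => [|m IH]; first by rewrite muln0 big_ord0.
rewrite mulnSr big_split_ord /= IH -addn1; congr (_ + _)%N.
rewrite -(prednK o0) big_ord_recr /= prednK // big1 => [|k _].
  by rewrite add0n -addnS prednK // dvdn_addr ?dvdn_mulr // dvdnn.
rewrite -addnS dvdn_addr ?dvdn_mulr //; apply/eqP; rewrite eqb0.
by rewrite gtnNdvd //= -[X in (_ < X)%N]prednK // ltnS.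
Qed.

(** Only multiples k = o a count, and [conjp k y = conjp o y ^+ a] divides [h] iff a is at most the
    multiplicity m; so the contributing k are o, 2 o, ..., m o. *)
Lemma count_conj_root h d : h \in monics d ->
  (\sum_(k < d) ((y \in F (s * k.+1)) && (conjp k.+1 y %| h)%R) = mup y h)%N.
Proof.
rewrite mem_monics => /and3P[hm /eqP sh hF]; have h0 := monic_neq0 hm.
set m := mup y h.
(* All m contributing values of k lie in the range of summation. *)
have omd : (o * m <= d)%N.
  have : conjp o y ^+ m %| h by rewrite conjp_pow_dvd // -mup_geq.
  by move=> /(dvdp_leq h0); rewrite -conjp_mul // size_conjp sh.
rewrite -(subnKC omd) big_split_ord /= [X in (_ + X)%N]big1 ?addn0 => [|k _].
  rewrite -[RHS](sum_dvdn m); apply: eq_bigr => k _; rewrite ord_y //; congr nat_of_bool.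
  have [/dvdnP[a E]|//] := boolP (o %| k.+1)%N; rewrite E mulnC conjp_mul //.
  rewrite conjp_pow_dvd // -mup_geq //= -/m -(leq_pmul2l o0) mulnC -E.
  exact: ltn_ord.
rewrite ord_y //; have [/dvdnP[a E]|//] := boolP (o %| (o * m + k).+1)%N.
rewrite E mulnC conjp_mul // conjp_pow_dvd // -mup_geq //= -/m -(leq_pmul2l o0) mulnC -E.
by rewrite -addnS leqNgt -[X in (X < _)%N]addn0 ltn_add2l.
Qed.

End ConjugateMultiplicity.

(** The analogue of [sum_(k | n) Lambda k = log n]: a root [y] of [h] contributes
    its multiplicity, as [conjp k y] is a power of its minimal polynomial. *)
Lemma count_conj h d : h \in monics d ->
  (\sum_(k < d) count (fun y => conjp k.+1 y %| h)%R (elems (s * k.+1)) = d)%N.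
Proof.
move=> hd; move: (hd); rewrite mem_monics => /and3P[hm /eqP sh hF].
have [r E] := closed_field_poly_normal h.
rewrite (eqP hm) scale1r in E.
have sr : size r = d by apply: succn_inj; rewrite -sh E size_prod_XsubC.
have sk0 k : (0 < s * k.+1)%N by rewrite muln_gt0 s0.
(* Only roots of [h] contribute, since ['X - y%:P] divides [conjp k.+1 y]; hence [y] may range over
   the distinct roots. *)
transitivity (\sum_(k < d) \sum_(y <- undup r)
    ((y \in F (s * k.+1)) && (conjp k.+1 y %| h)%R))%N.
  apply: eq_bigr => k _; rewrite -sum1_count -[LHS]big_filter sum1_size.
  rewrite (eq_bigr (fun y => if (y \in F (s * k.+1)) && (conjp k.+1 y %| h)%R then 1 else 0)%N).
    rewrite -big_mkcond -[RHS]big_filter sum1_size; apply: perm_size.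
    apply: uniq_perm; rewrite ?filter_uniq ?undup_uniq ?uniq_elemF // => y.
    rewrite !mem_filter (mem_elemF charC) // mem_undup andbC -andbA; congr (_ && _).
    have [dv|//] := boolP (conjp k.+1 y %| h); symmetry.
    rewrite -root_prod_XsubC -E -dvdp_XsubCl; apply: dvdp_trans dv.
    by rewrite /conjp big_ord_recl muln0 frob0 dvdp_mulIl.
  by move=> y _; case: (_ && _).
rewrite exchange_big /= -[RHS]sr -sum1_size -[RHS]big_undup_iterop_count.
rewrite [LHS]big_seq [RHS]big_seq; apply: eq_bigr => y; rewrite mem_undup => yr.
have hy : root h y by rewrite E root_prod_XsubC.
have [k0 /andP[k00 _] yk] := root_degree hF (monic_neq0 hm) hy.
have [o [o0 yo ord_y]] := fixF_order k00 yk.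
rewrite (count_conj_root o0 yo ord_y hd) E mu_prod_XsubC Monoid.iteropE.
by elim: (count_mem y r) => //= n <-.
Qed.

End ConjugateProducts.

(** * The L-function of a character at [beta] *)

Section LFunction.
Local Open Scope ring_scope.
Import Num.Theory.
Variables (C : closedFieldType) (p : nat).
Hypothesis charC : p \in [pchar C].
Local Notation F d := (fixF charC d).
Local Notation elems d := (elemF C p d).
Local Notation frob := (frob charC).
Variables (s n u : nat) (beta : C).
Hypotheses (s0 : (0 < s)%N) (n1 : (1 < n)%N) (odd_n : odd n).
Hypothesis beta_deg : forall r, (0 < r < n)%N -> beta \notin F (s * r).
Hypothesis betaF : beta \in F (s * n).
Hypotheses (pu : prime u) (ud : (u %| (p ^ (s * n)).-1)%N).
Hypothesis all_powers : forall i m, m \in F (s * 2 ^ i) ->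
  (beta + m) ^+ ((p ^ (s * n * 2 ^ i)).-1 %/ u) = 1.

Let n0 : (0 < n)%N. Proof. exact: ltnW. Qed.
Let sn0 : (0 < s * n)%N. Proof. by rewrite muln_gt0 s0. Qed.
Let p0 : (0 < p)%N. Proof. exact/prime_gt0/(pcharf_prime charC). Qed.
Let p1 : (1 < p)%N. Proof. exact/prime_gt1/(pcharf_prime charC). Qed.
Let q0 k : (0 < p ^ k)%N. Proof. by rewrite expn_gt0 p0. Qed.
Let sk0 k : (0 < s * k.+1)%N. Proof. by rewrite muln_gt0 s0. Qed.

Section WithCharacter.
Variable chi : C -> algC.
Hypotheses (chi0 : chi 0 = 0) (chiM : {in F (s * n) &, {morph chi : x y / x * y}}).
Hypothesis chi_le1 : forall x, `|chi x| <= 1.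
Hypothesis chi1 : forall x : C, x != 0 -> x ^+ ((p ^ (s * n)).-1 %/ u) = 1 -> chi x = 1.
Hypothesis chi_sum : \sum_(x <- elems (s * n)) chi x = 0.

(** The coefficient of T^d in the Dirichlet L-function of h |-> chi(h(beta)), a character modulo the
    minimal polynomial of [beta] over [F s]. *)
Definition Lcoef (d : nat) : algC := \sum_(h <- monics C p s d) chi h.[beta].

(** The coefficient of T^k in T L'(T) / L(T). *)
Definition conj_sum (k : nat) : algC :=
  \sum_(y <- elems (s * k)) chi (conjp charC s k y).[beta].

Lemma eval_beta h : h \is a polyOver (F s) -> h.[beta] \in F (s * n).
Proof.
move=> hF; apply: rpred_horner betaF; apply: polyOverS hF => z; exact: fixF_mul.
Qed.

Lemma monics_over d h : h \in monics C p s d -> h \is a polyOver (F s).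
Proof. by rewrite (mem_monics charC) // => /and3P[]. Qed.

Lemma Lcoef0 : Lcoef 0 = 1.
Proof.
rewrite /Lcoef monics0 big_seq1 hornerE; apply: chi1; first exact: oner_neq0.
by rewrite expr1n.
Qed.

Lemma Lcoef_shift d r : r \is a polyOver (F s) -> (size r <= d)%N ->
  \sum_(h <- monics C p s d) chi (h + r).[beta] = Lcoef d.
Proof.
move=> rF sr; rewrite /Lcoef -(big_map (fun h => h + r) xpredT (fun h => chi h.[beta])).
apply: perm_big; apply: uniq_perm.
- by rewrite map_inj_uniq ?uniq_monics //; exact: addIr.
- exact: uniq_monics.
move=> h; rewrite -{1}[h](subrK r) (mem_map (addIr r)) /monics.
rewrite -[h in RHS](subrK 'X^d) -[h - r](subrK 'X^d) ![_ - _ + 'X^d]addrC.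
rewrite !(mem_map (addrI _)) !(mem_lows charC) //.
have -> : h - r - 'X^d = h - 'X^d - r by rewrite addrAC.
set g := h - 'X^d; apply/andP/andP => -[sg gF]; split.
- by rewrite -[g](subrK r) (leq_trans (size_polyD _ _)) // geq_max sg.
- by rewrite -[g](subrK r) rpredD.
- by rewrite (leq_trans (size_polyD _ _)) // geq_max sg size_polyN.
- by rewrite rpredB.
Qed.

(** For d >= n, adding polynomials of degree below n shifts h(beta) by every element of [F (s * n)]
    while permuting the monic polynomials of degree d. Averaging over these shifts gives full
    character sums, which vanish. *)
Lemma Lcoef_big d : (n <= d)%N -> Lcoef d = 0.
Proof.
move=> nd.
have E : (p ^ (s * n))%:R * Lcoef d = 0.
  transitivity (\sum_(x <- elems (s * n)) Lcoef d).
    by rewrite big_const_seq count_predT iter_addr_0 size_elemF // mulr_natl.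
  transitivity (\sum_(x <- elems (s * n)) \sum_(h <- monics C p s d) chi (x + h.[beta])).
    rewrite big_seq [RHS]big_seq; apply: eq_bigr => x; rewrite (mem_elemF charC) // => xF.
    have [r [rF sr <-]] := eval_surj s0 n0 beta_deg betaF xF.
    rewrite -(Lcoef_shift rF (leq_trans sr nd)); apply: eq_bigr => h _.
    by rewrite hornerD addrC.
  rewrite exchange_big /= big_seq big1 // => h /monics_over/eval_beta hF.
  rewrite (@sum_translate _ _ chi) ?uniq_elemF // => x.
  rewrite !(mem_elemF charC) //; apply/idP/idP => H; last exact: rpredD.
  by rewrite -[x](addrK h.[beta]) rpredB.
move/eqP: E; rewrite mulf_eq0 pnatr_eq0 -leqn0 leqNgt q0 /=.
by move/eqP.
Qed.

(** The weight d of each [h] is replaced by the count of [count_conj]; after exchanging the sums,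
    [h] factors as [conjp k y] times a monic polynomial of degree d - k, and [chi] is
    multiplicative. *)
Lemma Lcoef_newton d :
  d%:R * Lcoef d = \sum_(k < d) conj_sum k.+1 * Lcoef (d - k.+1).
Proof.
transitivity (\sum_(h <- monics C p s d) \sum_(k < d)
    \sum_(y <- elems (s * k.+1) | conjp charC s k.+1 y %| h) chi h.[beta]).
  rewrite /Lcoef mulr_sumr big_seq [RHS]big_seq; apply: eq_bigr => h hd.
  rewrite -{1}(count_conj charC s0 hd) natr_sum mulr_suml; apply: eq_bigr => k _.
  by rewrite big_const_seq iter_addr_0 mulr_natl.
rewrite exchange_big /=; apply: eq_bigr => k _.
rewrite /conj_sum mulr_suml.
transitivity (\sum_(y <- elems (s * k.+1)) \sum_(h <- monics C p s d | conjp charC s k.+1 y %| h)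
    chi h.[beta]).
  rewrite (eq_bigr (fun h => \sum_(y <- elems (s * k.+1))
      if conjp charC s k.+1 y %| h then chi h.[beta] else 0)).
    by rewrite exchange_big /=; apply: eq_bigr => y _; rewrite -big_mkcond.
  by move=> h _; rewrite -big_mkcond.
rewrite big_seq [RHS]big_seq; apply: eq_bigr => y; rewrite (mem_elemF charC) // => yF.
rewrite (prod_monics s0 (fun h => chi h.[beta]) yF (ltn_ord k)) /Lcoef mulr_sumr.
rewrite big_seq [RHS]big_seq; apply: eq_bigr => h /monics_over hF.
by rewrite hornerM chiM // eval_beta ?conjp_over.
Qed.

Lemma conj_sum_le k : `|conj_sum k.+1| <= (p ^ (s * k.+1))%:R.
Proof.
rewrite -(size_elemF charC (sk0 k)) -sum1_size natr_sum.
by apply: le_trans (ler_norm_sum _ _ _) _; apply: ler_sum => y _; exact: chi_le1.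
Qed.

(** As n is odd, l |-> n l permutes the residues modulo 2^i, so the conjugates of [y] may be taken
    under the Frobenius of exponent [s * n], which fixes [beta]. The product is then the norm of
    [beta - y] from [F (s * n * 2 ^ i)] to [F (s * n)]. *)
Lemma conj_eval_pow2 i y : y \in F (s * 2 ^ i) ->
  (conjp charC s (2 ^ i) y).[beta] = (beta - y) ^+ (\sum_(l < 2 ^ i) (p ^ (s * n)) ^ l).
Proof.
move=> yF; set k := (2 ^ i)%N in yF *.
have k0 : (0 < k)%N by rewrite expn_gt0.
have cop : coprime n k by rewrite coprimeXr // coprimen2.
pose sg (l : 'I_k) : 'I_k := Ordinal (ltn_pmod (n * l) k0).
have sgI : injective sg.
  move=> a b /(congr1 val) /= H.
  have {}H : (n * a == n * b %[mod k])%N by apply/eqP.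
  apply: val_inj => /=; wlog ab : a b H / (a <= b)%N => [W|].
    by case: (leqP a b) => [/W->//|/ltnW/W-> //]; rewrite eq_sym.
  move: H; rewrite eq_sym eqn_mod_dvd ?leq_mul2l ?ab ?orbT // -mulnBr.
  rewrite Gauss_dvdr 1?coprime_sym // => dv; apply/eqP; rewrite eqn_leq ab /=.
  rewrite -subn_eq0; apply: contraTT dv => nz.
  by rewrite gtnNdvd ?lt0n // (leq_ltn_trans (leq_subr _ _)).
rewrite /conjp horner_prod expr_sum (reindex_inj sgI) /=; apply: eq_bigr => l _.
rewrite !hornerE -(frob_mod _ yF) mulnA -expnM -(frobE charC) rmorphB /=.
congr (_ - _); rewrite [RHS](fixFP _ _ _ _) //; exact: fixF_mul.
Qed.

(** Every term is 1: with Q = p^(s n), raising the norm to the power (Q - 1) / u raises [beta - y]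
    to the power (Q^(2^i) - 1) / u, which is 1 by [all_powers] at [m = - y]. *)
Lemma conj_sum_pow2 i : conj_sum (2 ^ i) = (p ^ (s * 2 ^ i))%:R.
Proof.
have k0 : (0 < 2 ^ i)%N by rewrite expn_gt0.
have sk : (0 < s * 2 ^ i)%N by rewrite muln_gt0 s0.
rewrite -(size_elemF charC sk) -sum1_size natr_sum /conj_sum.
rewrite big_seq [RHS]big_seq; apply: eq_bigr => y; rewrite (mem_elemF charC) // => yF.
have e0 : (0 < (p ^ (s * n)).-1 %/ u)%N.
  rewrite divn_gt0 ?prime_gt0 // dvdn_leq // -subn1 subn_gt0.
  by rewrite -(exp1n (s * n)) ltn_exp2r.
have H : (conjp charC s (2 ^ i) y).[beta] ^+ ((p ^ (s * n)).-1 %/ u) = 1.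
  rewrite conj_eval_pow2 // -exprM muln_divA // mulnC -predn_exp -expnM.
  by apply: all_powers; rewrite rpredN.
apply: chi1 => //; apply: contra_eq_neq H => ->.
by rewrite expr0n eqn0Ngt e0 /= eq_sym oner_eq0.
Qed.

Lemma Lfunction_contradiction : False.
Proof.
pose q : algC := (p ^ s)%:R.
have qn0 : q != 0 by rewrite pnatr_eq0 -lt0n.
have qX k : q ^+ k = (p ^ (s * k))%:R by rewrite -natrX expnM.
have qX0 k : q ^+ k != 0 by rewrite expf_neq0.
apply: (@newton_pow2 n (fun d => Lcoef d / q ^+ d) (fun k => conj_sum k / q ^+ k)).
- by rewrite Lcoef0 expr0 divr1.
- by move=> d /Lcoef_big ->; rewrite mul0r.
- move=> d _; rewrite mulrA Lcoef_newton mulr_suml; apply: eq_bigr => k _.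
  rewrite mulrACA -invfM -exprD subnKC //.
- move=> k; rewrite normrM normfV qX normr_nat ler_pdivrMr ?ltr0n // mul1r.
  exact: conj_sum_le.
- by move=> i; rewrite conj_sum_pow2 qX divff // -qX.
Qed.

End WithCharacter.

Lemma not_all_powers : False.
Proof.
have [|chi [c0 cM c1 cone csum]] := character_exists charC sn0 pu ud.
  by rewrite -subn1 subn_gt0 -(exp1n (s * n)) ltn_exp2r.
exact: (@Lfunction_contradiction chi).
Qed.

End LFunction.

(** * The tower of subfields *)

Section PrimeEnumeration.
Local Open Scope nat_scope.

Lemma exists_prime_above m : exists q, (m < q) && prime q.
Proof. by have [q mq pq] := prime_above m; exists q; rewrite mq. Qed.

Fixpoint prm (k : nat) : nat :=
  if k is k'.+1 then ex_minn (exists_prime_above (prm k')) else 2.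

Lemma prm_prime k : prime (prm k).
Proof. by case: k => //= k; case: ex_minnP => q /andP[]. Qed.

Lemma prm_gt0 k : 0 < prm k. Proof. exact/prime_gt0/prm_prime. Qed.

Lemma prm_gt1 k : 1 < prm k. Proof. exact/prime_gt1/prm_prime. Qed.

Lemma prm_next k l : prime l -> (l < prm k.+1) = (l <= prm k).
Proof.
move=> pl /=; case: ex_minnP => q /andP[kq pq] min.
by case: (leqP l (prm k)) => [/leq_ltn_trans->//|lk]; apply/negbTE; rewrite -leqNgt min ?lk.
Qed.

Lemma prm0 : prm 0 = 2. Proof. by []. Qed.

#[global] Opaque prm.

Lemma count_primeS n : count prime (iota 0 n.+1) = count prime (iota 0 n) + prime n.
Proof. by rewrite -[n.+1]addn1 iotaD count_cat /= add0n addn0. Qed.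

Lemma count_prm k : count prime (iota 0 (prm k)) = k.
Proof.
elim: k => [|k IH]; first by rewrite prm0.
have H m : prm k < m <= prm k.+1 -> count prime (iota 0 m) = k.+1.
  elim: m => // m IHm /andP[km mk]; rewrite count_primeS.
  move: km; rewrite ltnS leq_eqVlt => /orP[/eqP <-|km].
    by rewrite IH prm_prime addn1.
  rewrite IHm ?km ?(ltnW mk) //; case: (boolP (prime m)) => [pm|_]; last by rewrite addn0.
  by move: mk; rewrite prm_next // leqNgt km.
apply: H; rewrite leqnn andbT ltnNge -prm_next ?prm_prime //.
by rewrite ltnn.
Qed.

Lemma prm_count u : prime u -> prm (count prime (iota 0 u)) = u.
Proof.
move=> pu; set v := prm _; have pv : prime v := prm_prime _.
have : count prime (iota 0 v) = count prime (iota 0 u) by rewrite count_prm.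
have H x y : prime x -> x < y -> count prime (iota 0 x) < count prime (iota 0 y).
  move=> px /subnKC <-; rewrite iotaD count_cat count_primeS px.
  by rewrite -addnA addnC -[X in X < _]add0n ltn_add2r.
case: (ltngtP v u) => // [/(H _ _ pv)|/(H _ _ pu)] + E; by rewrite E ltnn.
Qed.

Definition smooth (u w : nat) : bool := (0 < w) && all (fun l => l < u) (primes w).

Lemma smoothP u w : reflect (0 < w /\ forall l, prime l -> l %| w -> l < u) (smooth u w).
Proof.
apply: (iffP andP) => -[w0 H]; split=> //.
  by move=> l pl lw; apply: (allP H); rewrite mem_primes pl w0.
by apply/allP => l; rewrite mem_primes => /and3P[pl _]; exact: H.
Qed.

Lemma smooth_gt0 u w : smooth u w -> 0 < w. Proof. by case/andP. Qed.

Lemma smoothM u v w : smooth u v -> smooth u w -> smooth u (v * w).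
Proof.
move=> /smoothP[v0 Hv] /smoothP[w0 Hw]; apply/smoothP; split.
  by rewrite muln_gt0 v0.
by move=> l pl; rewrite Euclid_dvdM // => /orP[/(Hv l pl)|/(Hw l pl)].
Qed.

Lemma smooth_small u r : 0 < r < u -> smooth u r.
Proof.
move=> /andP[r0 ru]; apply/smoothP; split=> // l _ /(dvdn_leq r0) lr.
exact: leq_ltn_trans ru.
Qed.

Lemma smooth_coprime u w : prime u -> smooth u w -> coprime u w.
Proof.
move=> pu /smoothP[_ H]; rewrite prime_coprime //; apply/negP => /(H u pu).
by rewrite ltnn.
Qed.

Lemma smooth_next k w : smooth (prm k.+1) w <->
  exists i w', smooth (prm k) w' /\ w = prm k ^ i * w'.
Proof.
split=> [/smoothP[w0 H]|[i [w' [/smoothP[w0 H] ->]]]].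
  have [w' cop E] := pfactor_coprime (prm_prime k) w0.
  exists (logn (prm k) w), w'; split; last by rewrite mulnC.
  apply/smoothP; split; first by move: w0; rewrite E muln_gt0 => /andP[].
  move=> l pl lw; have : l <= prm k by rewrite -prm_next // H // E dvdn_mulr.
  rewrite leq_eqVlt => /orP[/eqP lE|//]; move: cop.
  by rewrite prime_coprime ?prm_prime // -lE lw.
apply/smoothP; split; first by rewrite muln_gt0 expn_gt0 prm_gt0.
move=> l pl; rewrite prm_next // Euclid_dvdM // => /orP[|/(H _ pl)/ltnW //].
by rewrite Euclid_dvdX // dvdn_prime2 ?prm_prime // => /andP[/eqP ->].
Qed.

End PrimeEnumeration.

(** * The fields of the tower inside [C] *)

Section TowerFields.
Local Open Scope ring_scope.
Variables (C : closedFieldType) (p : nat).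
Hypothesis charC : p \in [pchar C].
Local Notation F d := (fixF charC d).
Local Notation elems d := (elemF C p d).
Let p0 : (0 < p)%N. Proof. exact/prime_gt0/(pcharf_prime charC). Qed.
Let p1 : (1 < p)%N. Proof. exact/prime_gt1/(pcharf_prime charC). Qed.

(** The field reached from chi_u after [i] extensions of degree [u], as a directed union of finite
    fields: degrees are u^j times a number whose primes are below [u], with j <= i. *)
Definition towerF (u i : nat) : {pred C} :=
  fun x => `[< exists2 w, smooth u w & x \in F (u ^ i * w) >].
Local Notation K u i := (towerF u i).

Lemma towerFP u i x : reflect (exists2 w, smooth u w & x \in F (u ^ i * w)) (x \in K u i).
Proof. exact: asboolP. Qed.

(** Directedness of the union: it reduces questions about finitely many elements, such as the
    coefficients of a polynomial, to a single finite field. *)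
Lemma towerF_seq u i (s : seq C) : {subset s <= K u i} ->
  exists2 w, smooth u w & {subset s <= F (u ^ i * w)}.
Proof.
elim: s => [|x s IH] H; first by exists 1%N.
have [w sw Hw] : exists2 w, smooth u w & {subset s <= F (u ^ i * w)}.
  by apply: IH => y ys; apply: H; rewrite inE ys orbT.
have /towerFP[v sv xv] : x \in K u i by apply: H; exact: mem_head.
exists (w * v)%N => [|y]; first exact: smoothM.
rewrite inE => /predU1P[->|/Hw yw].
  by apply: fixF_dvd xv; rewrite dvdn_mul // dvdn_mull.
by apply: fixF_dvd yw; rewrite dvdn_mul // dvdn_mulr.
Qed.

Lemma towerF_divring u i : divring_closed (K u i).
Proof.
have H x y : x \in K u i -> y \in K u i ->
    exists2 w, smooth u w & (x \in F (u ^ i * w)) /\ (y \in F (u ^ i * w)).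
  move=> xK yK; have [|w sw Hw] := @towerF_seq u i [:: x; y].
    by move=> z; rewrite !in_cons in_nil orbF => /orP[/eqP ->|/eqP ->].
  by exists w => //; split; apply: Hw; rewrite !in_cons eqxx ?orbT.
split=> [|x y xK yK|x y xK yK].
- by apply/towerFP; exists 1%N; rewrite // rpred1.
- by have [w sw [xw yw]] := H x y xK yK; apply/towerFP; exists w; rewrite // rpredB.
- by have [w sw [xw yw]] := H x y xK yK; apply/towerFP; exists w; rewrite // rpred_div.
Qed.

HB.instance Definition _ u i := GRing.isDivringClosed.Build C (K u i) (towerF_divring u i).

Lemma towerF_poly u i (q : {poly C}) : q \is a polyOver (K u i) ->
  exists2 w, smooth u w & q \is a polyOver (F (u ^ i * w)).
Proof.
move=> /polyOverP qK; have [|w sw Hw] := @towerF_seq u i q.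
  by move=> x /(nthP 0)[j _ <-].
exists w => //; apply/polyOverP => j; have [jq|qj] := ltnP j (size q).
  by apply: Hw; exact: mem_nth.
by rewrite nth_default // rpred0.
Qed.

(** A root of a polynomial of degree below [u] has degree r < u over a finite subfield, and the
    factor r is absorbed by the smooth part. *)
Lemma towerF_root_small u i (q : {poly C}) x : q \is a polyOver (K u i) -> q != 0 ->
  (size q <= u)%N -> root q x -> x \in K u i.
Proof.
move=> /towerF_poly[w sw qF] q0 qu qx; have [r /andP[r0 rq] xr] := root_degree qF q0 qx.
apply/towerFP; exists (w * r)%N; last by rewrite mulnA.
by apply: smoothM => //; apply: smooth_small; rewrite r0 (leq_trans rq).
Qed.

(** The polynomial is that of an element [y] of degree [u] over [F (u ^ i)]. A conjugate of [y] in
    the tower field would lie in [F (u ^ i)], since [u] is coprime to smooth numbers. *)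
Lemma towerF_rootless u i : prime u -> exists q : {poly C},
  [/\ q \is a polyOver (K u i), q \is monic, size q = u.+1 & forall x, root q x -> x \notin K u i].
Proof.
move=> pu; have u0 := prime_gt0 pu; have ui0 : (0 < u ^ i)%N by rewrite expn_gt0 u0.
have uiu0 : (0 < u ^ i * u)%N by rewrite muln_gt0 ui0.
have [y yF yN] : exists2 y, y \in F (u ^ i * u) & y \notin F (u ^ i).
  apply: contrapT => no.
  have : {subset elems (u ^ i * u) <= elems (u ^ i)}.
    move=> y; rewrite !(mem_elemF charC) // => yF; apply: contrapT => yN.
    by apply: no; exists y => //; apply/negP.
  move=> /(uniq_leq_size (uniq_elemF charC uiu0)); rewrite !size_elemF //.
  by rewrite leq_exp2l // leqNgt -{1}[(u ^ i)%N]muln1 ltn_pmul2l // prime_gt1.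
exists (conjp charC (u ^ i) u y); split; rewrite ?monic_conjp ?size_conjp //.
  apply: polyOverS (conjp_over yF) => x xF; apply/towerFP; exists 1%N => //.
  by rewrite muln1.
move=> x; rewrite /conjp rootE horner_prod => /eqP/eqP/prodf_eq0[l _].
rewrite !hornerE subr_eq0 => /eqP ->; apply/negP => /towerFP[w sw].
rewrite fixF_frob => yw; move/negP: yN; apply.
have := fixF_gcd uiu0 yF yw; rewrite -muln_gcdr.
by rewrite (eqP (smooth_coprime pu sw)) muln1.
Qed.

Section TowerExtension.
Variables (u i : nat) (h : {poly C}) (th : C).
Hypothesis pu : prime u.
Hypotheses (hK : h \is a polyOver (K u i)) (sh : (size h <= u)%N).
Hypothesis rootlessK : forall x, root ('X^u - h) x -> x \notin K u i.
Hypothesis th_root : root ('X^u - h) th.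

Let u0 : (0 < u)%N. Proof. exact: prime_gt0. Qed.

Lemma towerF_ext_small w r : smooth u w -> (0 < r < u)%N -> th \notin F (u ^ i * w * r).
Proof.
move=> sw ru; apply/negP => thF; move: (rootlessK th_root); apply/negP; rewrite negbK.
by apply/towerFP; exists (w * r)%N; rewrite ?mulnA // smoothM // smooth_small.
Qed.

(** The degree of [th] over a finite subfield containing the coefficients is at most [u], and a
    smaller one would put [th] in the tower field already. *)
Lemma towerF_ext_root : exists2 w, smooth u w & th \in F (u ^ i * w * u).
Proof.
have [w sw hF] := towerF_poly hK; exists w => //.
have gF : 'X^u - h \is a polyOver (F (u ^ i * w)) by rewrite rpredB ?polyOverXn.
have sg : size ('X^u - h) = u.+1.
  by rewrite size_polyDl ?size_polyXn // size_polyN ltnS.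
have [|r] := root_degree gF _ th_root; first by rewrite -size_poly_gt0 sg.
rewrite sg ltnS => /andP[r0]; rewrite leq_eqVlt => /orP[/eqP <- //|ru] thr.
by have := towerF_ext_small sw (introT andP (conj r0 ru)); rewrite thr.
Qed.

Lemma towerF_ext_inj q : q \is a polyOver (K u i) -> (size q <= u)%N -> root q th -> q = 0.
Proof.
move=> qK sq qth; apply/eqP; apply: contraT => q0.
have := rootlessK th_root; rewrite (towerF_root_small qK q0 sq) //.
Qed.

Lemma towerF_ext_in q : q \is a polyOver (K u i) -> q.[th] \in K u i.+1.
Proof.
move=> qK; have [v sv qF] := towerF_poly qK; have [w sw thw] := towerF_ext_root.
apply/towerFP; exists (v * w)%N; first exact: smoothM.
apply: rpred_horner.
  apply: polyOverS qF => x; apply: fixF_dvd.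
  by rewrite expnSr -mulnA dvdn_mul // dvdn_mull // dvdn_mulr.
apply: fixF_dvd thw; rewrite expnSr -!mulnA dvdn_mul // mulnC dvdn_mul //.
by rewrite dvdn_mull.
Qed.

Lemma towerF_ext_surj x : x \in K u i.+1 ->
  exists q, [/\ q \is a polyOver (K u i), (size q <= u)%N & q.[th] = x].
Proof.
move=> /towerFP[v sv xv]; have [w sw thw] := towerF_ext_root.
have d0 : (0 < u ^ i * (v * w))%N.
  by rewrite !muln_gt0 expn_gt0 u0 (smooth_gt0 sv) (smooth_gt0 sw).
have [|||q [qF sq E]] := @eval_surj _ _ charC (u ^ i * (v * w)) u th x d0 u0.
- by move=> r ru; apply: towerF_ext_small => //; exact: smoothM.
- apply: fixF_dvd thw; rewrite -!mulnA dvdn_mul // mulnA dvdn_mul //.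
  by rewrite dvdn_mull.
- apply: fixF_dvd xv; rewrite expnSr -!mulnA dvdn_mul // mulnC dvdn_mul //.
  by rewrite dvdn_mull.
exists q; split=> //; apply: polyOverS qF => y yF; apply/towerFP.
by exists (v * w)%N => //; exact: smoothM.
Qed.

End TowerExtension.

Lemma towerF_sub u i x : x \in K u i -> x \in K u i.+1.
Proof.
move=> /towerFP[w sw xw]; apply/towerFP; exists w => //.
by apply: fixF_dvd xw; rewrite dvdn_mul // expnSr dvdn_mulr.
Qed.

Lemma towerF_next k x : (x \in K (prm k.+1) 0) <-> exists i, x \in K (prm k) i.
Proof.
split=> [/towerFP[w /smooth_next[i [w' [sw ->]]] xw]|[i /towerFP[w sw xw]]].
  by exists i; apply/towerFP; exists w' => //; move: xw; rewrite expn0 mul1n.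
apply/towerFP; exists (prm k ^ i * w)%N; last by rewrite expn0 mul1n.
by apply/smooth_next; exists i, w.
Qed.

Lemma towerF_prime_field x : (x \in K 2 0) = (x \in F 1).
Proof.
apply/towerFP/idP => [[w /smoothP[w0 H]]|xF]; last by exists 1%N.
suff -> : w = 1%N by [].
case: (ltngtP w 1) w0 => // w1 _; have := H (pdiv w) (pdiv_prime w1) (pdiv_dvd w).
by rewrite ltnNge prime_gt1 // pdiv_prime.
Qed.

Lemma fixF1P x : reflect (exists2 n, (n < p)%N & x = n%:R) (x \in F 1).
Proof.
have natF n : n%:R \in F 1 by rewrite rpred_nat.
pose s : seq C := [seq n%:R | n <- iota 0 p].
have us : uniq s.
  rewrite map_inj_in_uniq ?iota_uniq // => m n; rewrite !mem_iota !add0n /= => mp np.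
  wlog mn : m n mp np / (m <= n)%N => [W|] E.
    by case: (leqP m n) => [/W|/ltnW/W W']; [apply|symmetry; apply: W'].
  apply/eqP; rewrite eqn_leq mn -subn_eq0 /=; apply: contraT => nm.
  have : (p %| n - m)%N by rewrite (dvdn_pcharf charC) natrB // E subrr.
  rewrite gtnNdvd ?lt0n // (leq_ltn_trans (leq_subr _ _) np) //.
have [||_ sE] := uniq_min_size us (s2 := elems 1).
- by move=> _ /mapP[n _ ->]; rewrite (mem_elemF charC).
- by rewrite size_elemF // size_map size_iota expn1.
rewrite -(mem_elemF charC) // -sE; apply: (iffP mapP) => -[n np ->]; exists n => //.
  by move: np; rewrite mem_iota.
by rewrite mem_iota.
Qed.

Lemma towerF_all x d : (0 < d)%N -> x \in F d -> exists k, x \in K (prm k) 0.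
Proof.
move=> d0 xF; have [q dq pq] := prime_above d.
exists (count prime (iota 0 q)); rewrite prm_count //; apply/towerFP; exists d.
  by apply: smooth_small; rewrite d0.
by rewrite expn0 mul1n.
Qed.

End TowerFields.

(** * Stages as subfields *)

Section Subfield.
Local Open Scope ring_scope.
Variables (C : fieldType) (K : divringClosed C).

(** Packs a subfield of [C] as a field type: [stage_field] speaks of field types, not of
    predicates. *)
Record subfield := Subfield { subfield_val :> C; _ : subfield_val \in K }.

HB.instance Definition _ := [isSub for subfield_val].
HB.instance Definition _ := [Choice of subfield by <:].
HB.instance Definition _ := [SubChoice_isSubIntegralDomain of subfield by <:].
HB.instance Definition _ := [SubIntegralDomain_isSubField of subfield by <:].

End Subfield.

Section LexMin.
Variables (F : fieldType) (e : F -> Ord).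
Hypothesis e_inj : injective e.

Lemma lex_min n (P : {poly F} -> Prop) : (forall h, P h -> (size h <= n)%N) ->
  (exists h, P h) -> exists h, P h /\ forall k, P k -> k <> h -> lex_lt e h k.
Proof.
move=> Pn Pex.
(* Invariant: [h] is least for the coefficients of index at least n - l, ties being left open below.
   Each step minimises one more coefficient among the polynomials agreeing so far. *)
suff /(_ n) [h [Ph Hh]] : forall l, exists h, P h /\ forall k, P k ->
    (forall j, (n - l <= j)%N -> (h`_j = k`_j)%R) \/
    exists i, [/\ (n - l <= i)%N, e (h`_i)%R < e (k`_i)%R &
      forall j, (i < j)%N -> (h`_j = k`_j)%R].
  exists h; split=> // k Pk kh; case: (Hh k Pk) => [H|[i [_ ? ?]]]; last by exists i.
  by case: kh; apply/polyP => j; rewrite H // subnn.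
elim=> [|l [h [Ph Hh]]].
  have [h Ph] := Pex; exists h; split=> // k Pk; left=> j; rewrite subn0 => nj.
  by rewrite !nth_default // (leq_trans _ nj) // Pn.
set m := (n - l.+1)%N; have ml : (n - l <= m.+1)%N by rewrite /m subnS leqSpred.
have lm : (m <= n - l)%N by rewrite /m subnS leq_pred.
pose Q : set Ord := [set a | exists k, [/\ P k, forall j, (n - l <= j)%N -> (h`_j = k`_j)%R &
   a = e (k`_m)%R]]%classic.
have [|[g [Pg hg gm]] min] := @oleastP Q; first by exists (e (h`_m)%R), h.
exists g; split=> // k Pk; have [H|[i [ni hi Hi]]] := Hh k Pk; last first.
  right; exists i; split=> [||j ij]; first exact: leq_trans ni.
    by rewrite -hg.
  by rewrite -hg ?Hi // (leq_trans ni) // ltnW.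
have /min : Q (e (k`_m)%R) by exists k.
rewrite gm le_eqVlt => /orP[/eqP/e_inj E|lt]; [left=> j | right; exists m; split=> // j].
  rewrite leq_eqVlt => /orP[/eqP <- //|mj].
  by rewrite -hg ?H // (leq_trans ml).
by move=> mj; rewrite -hg ?H // (leq_trans ml).
Qed.

End LexMin.

Definition same_block (a b : Ord) : Prop := exists g m n,
  a = oadd (omul omega g) (onat m) /\ b = oadd (omul omega g) (onat n).

Lemma block_split x a : a < omul omega x ->
  exists g m, g < x /\ a = oadd (omul omega g) (onat m).
Proof. by move=> /omul_divl[g [r [gx /lt_omega[m ->] ->]]]; exists g, m. Qed.

Lemma block_uniq g h m n :
  oadd (omul omega g) (onat m) = oadd (omul omega h) (onat n) -> g = h /\ m = n.
Proof.
move=> /omul_div_uniq[||-> /onat_inj ->] //.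
  by apply/lt_omega; exists m.
by apply/lt_omega; exists n.
Qed.

(** * One step of the construction *)

Section StageStep.
Local Open Scope ring_scope.
Variables (C : closedFieldType) (p : nat).
Hypothesis charC : p \in [pchar C].
Local Notation K u i := (towerF charC u i).

(** [S] is the field of all ordinals below [B], and [v] identifies it with the
    subfield [L] of [C]. *)
Definition stage_iso (S : stage) (B : Ord) (v : Ord -> C) (L : {pred C}) : Prop :=
  [/\ bound S = B, (forall a b, a < B -> b < B -> v a = v b -> a = b)%O,
      forall x, x \in L <-> (exists2 a, (a < B)%O & v a = x), v ozero = 0
    & forall a b, (a < B)%O -> (b < B)%O ->
      [/\ (sadd S a b < B)%O, (smul S a b < B)%O, v (sadd S a b) = v a + v b
         & v (smul S a b) = v a * v b]].

Variables (S : stage) (B : Ord) (v : Ord -> C) (u i : nat).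
Hypothesis pu : prime u.
Hypothesis isoS : stage_iso S B v (K u i).

Let u0 : (0 < u)%N. Proof. exact: prime_gt0. Qed.

Let v_inj a b : (a < B)%O -> (b < B)%O -> v a = v b -> a = b.
Proof. by have [_ + _ _ _] := isoS; apply. Qed.

Let B_gt0 : (ozero < B)%O.
Proof.
have [_ _ H _ _] := isoS; have : 0 \in K u i by rewrite rpred0.
by move=> /H[a aB _]; exact: le_lt_trans (ozero_le a) aB.
Qed.

Section WithField.
Variables (F : fieldType) (e : F -> Ord).
Hypothesis fieldS : stage_field e S.

Let e_lt x : (e x < B)%O.
Proof.
have [<- _ _ _ _] := isoS; have [_ H _ _] := fieldS; apply/H; by exists x.
Qed.

(** The field in [next_stage] is existentially quantified. Through [emb] any such field becomes the
    same subfield of [C], so the results below hold whatever its choice. *)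
Definition emb (x : F) : C := v (e x).

Lemma emb_zmod : zmod_morphism emb.
Proof.
have D x y : emb (x + y) = emb x + emb y.
  rewrite /emb; have [_ _ -> _] := fieldS; have [_ _ _ _ H] := isoS.
  by have [_ _ -> _] := H _ _ (e_lt x) (e_lt y).
by move=> x y; apply: (addIr (emb y)); rewrite -D !subrK.
Qed.

Lemma embM x y : emb (x * y) = emb x * emb y.
Proof.
rewrite /emb; have [_ _ _ ->] := fieldS; have [_ _ _ _ H] := isoS.
by have [_ _ _ ->] := H _ _ (e_lt x) (e_lt y).
Qed.

Lemma emb_inj : injective emb.
Proof.
by move=> x y E; have [+ _ _ _] := fieldS; apply; apply: (v_inj _ _ E); exact: e_lt.
Qed.

Lemma emb_monoid : monoid_morphism emb.
Proof.
split=> [|x y]; last exact: embM.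
have n0 : emb 1 != 0.
  have -> : 0 = emb 0 by rewrite -[0 in RHS](subrr 0) emb_zmod subrr.
  by rewrite (inj_eq emb_inj) oner_eq0.
by apply: (mulfI n0); rewrite -embM !mulr1.
Qed.

HB.instance Definition _ := GRing.isZmodMorphism.Build F C emb emb_zmod.
HB.instance Definition _ := GRing.isMonoidMorphism.Build F C emb emb_monoid.

Lemma emb_in x : emb x \in K u i.
Proof. by have [_ _ H _ _] := isoS; apply/H; exists (e x). Qed.

Lemma emb_surj y : y \in K u i -> exists x, emb x = y.
Proof.
have [bS _ H _ _] := isoS; move=> /H[a aB <-].
by have [_ H2 _ _] := fieldS; move: aB; rewrite -bS => /H2[x <-]; exists x.
Qed.

Lemma map_emb_over (q : {poly F}) : map_poly emb q \is a polyOver (K u i).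
Proof. by apply/polyOverP => j; rewrite coef_map emb_in. Qed.

Lemma map_emb_surj (q : {poly C}) : q \is a polyOver (K u i) ->
  exists q', map_poly emb q' = q.
Proof.
move=> /polyOverP qK; have pre j := cid (emb_surj (qK j)).
exists (\poly_(j < size q) sval (pre j)); apply/polyP => j.
rewrite coef_map coef_poly; case: ltnP => [_|qj]; first exact: (svalP (pre j)).
by rewrite raddf0 nth_default.
Qed.

Lemma rootless_emb (q : {poly F}) :
  rootless q <-> forall y, root (map_poly emb q) y -> y \notin K u i.
Proof.
split=> [H y qy|H x]; last first.
  by apply/negP => qx; have := H (emb x); rewrite fmorph_root qx emb_in => /(_ isT).
by apply/negP => /emb_surj[x xy]; have := H x; rewrite -(fmorph_root emb) /= xy qy.
Qed.

Lemma emb_rootless_u : exists q : {poly F}, [/\ q \is monic, size q = u.+1 & rootless q].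
Proof.
have [q [/map_emb_surj[q' <-] qm sq qr]] := towerF_rootless charC i pu.
exists q'; split; first by rewrite -(map_monic emb).
  by rewrite -sq size_map_poly.
exact/rootless_emb.
Qed.

Lemma emb_root_small (q : {poly F}) n : size q = n.+1 -> (0 < n < u)%N -> ~ rootless q.
Proof.
move=> sq /andP[n0 nu] /rootless_emb H.
have [|y qy] := closed_rootP (map_poly emb q) _.
  by rewrite size_map_poly sq eqSS -lt0n.
have := H y qy; rewrite (towerF_root_small (map_emb_over q)) // ?size_map_poly ?sq //.
by rewrite map_poly_eq0 -size_poly_eq0 sq.
Qed.

Lemma first_degree_u : first_degree F u.
Proof.
split; first by split=> //; have [q [_ sq qr]] := emb_rootless_u; exists q.
move=> m [m0 [q [sq qr]]]; rewrite leqNgt; apply/negP => mu.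
by apply: (emb_root_small sq) qr; rewrite m0.
Qed.

Lemma first_degree_eq n : first_degree F n -> n = u.
Proof.
move=> [badn minn]; have [badu minu] := first_degree_u.
by apply/eqP; rewrite eqn_leq minn // minu.
Qed.

(** This excludes the transcendental clause of [next_stage] throughout the tower. *)
Lemma not_closed : ~ GRing.closed_field_axiom F.
Proof.
move=> cl; have [q [qm sq qr]] := emb_rootless_u.
have [x xE] := cl u (fun j => - q`_j) u0.
have := qr x; rewrite rootE horner_coef sq big_ord_recr /= xE.
have -> : q`_u = 1 by have := qm; rewrite monicE lead_coefE sq => /eqP.
rewrite mul1r -big_split big1 ?eqxx // => j _ /=.
by rewrite mulNr subrr.
Qed.

Lemma first_poly_exists : exists h, first_poly e u h.
Proof.
have [q [qm sq qr]] := emb_rootless_u; have [e_inj _ _ _] := fieldS.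
apply: (@lex_min _ e e_inj u (fun h => (size h <= u)%N /\ rootless ('X^u - h))).
  by move=> h [].
exists ('X^u - q); split; last by rewrite opprB addrC subrK.
apply/leq_sizeP => j uj; rewrite coefB coefXn.
case: (ltngtP u j) uj => // [uj _|<- _]; first by rewrite nth_default ?sq // subr0.
by have := qm; rewrite monicE lead_coefE sq => /eqP ->; rewrite subrr.
Qed.

Section WithPoly.
Variable h : {poly F}.
Hypothesis first_h : first_poly e u h.

Let H := map_poly emb h.
Let HK : H \is a polyOver (K u i). Proof. exact: map_emb_over. Qed.
Let sH : (size H <= u)%N.
Proof. by have [[sh _] _] := first_h; rewrite size_map_poly. Qed.
Let HE : map_poly emb ('X^u - h) = 'X^u - H.
Proof. by rewrite rmorphB /= map_polyXn. Qed.
Let rootlessH x : root ('X^u - H) x -> x \notin K u i.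
Proof. by have [[_ /rootless_emb +] _] := first_h; rewrite HE; apply. Qed.

Lemma root_exists : exists th, root ('X^u - H) th.
Proof.
apply/closed_rootP; rewrite size_polyDl ?size_polyXn ?eqSS -?lt0n //.
by rewrite size_polyN ltnS.
Qed.

Definition theta : C := sval (cid root_exists).

Let th_root : root ('X^u - H) theta. Proof. exact: svalP (cid root_exists). Qed.

(** The default makes all digits lie below [B] for every ordinal, in range or not. *)
Definition digit (a : Ord) : nat -> Ord :=
  if pselect (exists2 f, (forall j, f j < B)%O & a = digits B f u) is left ex
  then sval (cid2 ex) else fun=> ozero.

Let digit_lt a j : (digit a j < B)%O.
Proof. by rewrite /digit; case: pselect => // ex; case: (cid2 ex). Qed.

Let digitK a : (a < opow B (onat u))%O -> digits B (digit a) u = a.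
Proof.
move=> /(digits_surj B_gt0) ex; rewrite /digit; case: pselect => // ex'.
by case: (cid2 ex').
Qed.

Let digitE f j : (forall j, (j < u)%N -> f j < B)%O -> (j < u)%N -> digit (digits B f u) j = f j.
Proof.
move=> fB ju; apply: (digits_inj (n := u) B_gt0) => //.
by rewrite digitK // digits_lt.
Qed.

(** The value of [phi^(u-1) a_(u-1) + ... + a_0] in [C] is
    [theta^(u-1) v(a_(u-1)) + ... + v(a_0)]. *)
Definition ext_poly (a : Ord) : {poly C} := \poly_(j < u) v (digit a j).

Definition ext_val (a : Ord) : C := (ext_poly a).[theta].

Let ext_poly_over a : ext_poly a \is a polyOver (K u i).
Proof.
apply: polyOver_poly => j _; have [_ _ HK' _ _] := isoS.
by apply/HK'; exists (digit a j).
Qed.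

Lemma ext_val_inj a b : (a < opow B (onat u))%O -> (b < opow B (onat u))%O ->
  ext_val a = ext_val b -> a = b.
Proof.
move=> aB bB E; have : ext_poly a - ext_poly b = 0.
  apply: (towerF_ext_inj rootlessH th_root).
  - by rewrite rpredB.
  - by rewrite (leq_trans (size_polyD _ _)) // geq_max size_polyN !size_poly.
  - by rewrite rootE hornerD hornerN [X in X - _]E subrr.
move=> /eqP; rewrite subr_eq0 => /eqP Ep; rewrite -(digitK aB) -(digitK bB).
apply: eq_digits => j ju; apply: v_inj => //.
by have := congr1 (fun q : {poly C} => q`_j) Ep; rewrite !coef_poly ju.
Qed.

Lemma ext_val_in a : ext_val a \in K u i.+1.
Proof. exact: (towerF_ext_in HK sH rootlessH th_root). Qed.

Lemma ext_val_surj x : x \in K u i.+1 ->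
  exists2 a, (a < opow B (onat u))%O & ext_val a = x.
Proof.
move=> /(towerF_ext_surj pu HK sH rootlessH th_root)[q [qK sq <-]].
have [_ _ HKv _ _] := isoS.
have pre j : exists a, (a < B)%O /\ v a = q`_j.
  by have /HKv[a aB va] := polyOverP qK j; exists a.
pose f j := sval (cid (pre j)).
have fB j : (f j < B)%O by case: (svalP (cid (pre j))).
exists (digits B f u); first by apply: digits_lt.
rewrite /ext_val; congr horner; apply/polyP => j; rewrite coef_poly.
case: ltnP => [ju|uj]; last by rewrite nth_default // (leq_trans sq).
by rewrite digitE //; case: (svalP (cid (pre j))).
Qed.

Lemma ext_val_old a : (a < B)%O -> ext_val a = v a.
Proof.
move=> aB; pose f j := if j is 0 then a else ozero.
have fB j : (f j < B)%O by case: j.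
have -> : a = digits B f u by rewrite -(prednK u0) digits_const.
have [_ _ _ v0 _] := isoS.
rewrite /ext_val /ext_poly; transitivity ((v a)%:P).[theta]; last first.
  by rewrite hornerC -(prednK u0) digits_const.
congr horner; apply/polyP => j; rewrite coef_poly coefC.
case: ltnP => [ju|uj]; first by rewrite digitE //; case: j {ju}.
by case: eqP uj => // ->; rewrite leqn0 eqn0Ngt u0.
Qed.

Let digit_split a : exists c, forall a0 b, (a0 < B)%O -> (b < opow B (onat u))%O ->
  (b = oadd (omul B c) a0 <-> digit b 0 = a0 /\ forall j, (0 < j < u)%N -> digit b j = digit a j).
Proof.
have [c Hc] := digits_low (digit a) u.-1 B_gt0.
exists c => a0 b a0B bB; rewrite -Hc prednK //; set f := fun j => _.
have fB j : (f j < B)%O by case: j => //= j; exact: digit_lt.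
split=> [->|[b0 bj]].
  split; first by rewrite digitE.
  by move=> [|j] // ju; rewrite digitE.
rewrite -(digitK bB); apply: eq_digits => -[|j] ju //.
by rewrite bj.
Qed.

(** As [B] is a multiple of omega, two ordinals share a block iff their digits of positive index
    agree and their lowest digits share a block. On the side of [C], a difference lying in [L],
    inside the base field, forces the coefficients of positive powers of [theta] to agree. *)
Lemma ext_val_block (x : Ord) (L : {pred C}) : B = omul omega x ->
  {subset L <= K u i} ->
  (forall a b, (a < B)%O -> (b < B)%O -> (same_block a b <-> v b - v a \in L)) ->
  forall a b, (a < opow B (onat u))%O -> (b < opow B (onat u))%O ->
    (same_block a b <-> ext_val b - ext_val a \in L).
Proof.
move=> Bx LK BL a b aB bB.
have valE : (forall j, (0 < j < u)%N -> digit b j = digit a j) ->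
    ext_val b - ext_val a = v (digit b 0) - v (digit a 0).
  move=> E; rewrite /ext_val -hornerN -hornerD.
  rewrite -[RHS](hornerC _ theta); congr horner; apply/polyP => j.
  rewrite coefB !coef_poly coefC; case: ltnP => ju; last first.
    by case: eqP ju => [->|_ _]; rewrite ?subrr // leqNgt u0.
  by case: j ju => [|j] ju //=; rewrite E // subrr.
have [c Hc] := digit_split a.
have aE : a = oadd (omul B c) (digit a 0) by apply/Hc.
have blockE a0 : (a0 < B)%O -> exists g m, [/\ (g < x)%O, a0 = oadd (omul omega g) (onat m) &
    forall c, oadd (omul B c) a0 = oadd (omul omega (oadd (omul x c) g)) (onat m)].
  rewrite {1}Bx => /block_split[g [m [gx ->]]]; exists g, m; split=> // c'.
  by rewrite Bx oaddA omulDr omulA.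
split=> [[g [m [n [ag bg]]]]|].
  have [c' Hc'] := digit_split b.
  have bE : b = oadd (omul B c') (digit b 0) by apply/Hc'.
  have [g0 [m0 [g0x a0E a0c]]] := blockE _ (digit_lt a 0).
  have [g1 [m1 [g1x b0E b0c]]] := blockE _ (digit_lt b 0).
  have /block_uniq[E1 _] := etrans (esym ag) (etrans aE (a0c c)).
  have /block_uniq[E2 _] := etrans (esym bg) (etrans bE (b0c c')).
  have [cc gg] : c = c' /\ g0 = g1.
    by apply: (omul_div_uniq g0x g1x); rewrite -E1.
  have /Hc[] // : b = oadd (omul B c) (digit b 0) by rewrite cc.
  move=> _ /valE ->; apply/BL => //.
  by exists g0, m0, m1; split; [exact: a0E | rewrite gg].
move=> ab; have dj : forall j, (0 < j < u)%N -> digit b j = digit a j.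
  (* This polynomial over the base field has degree below [u] and vanishes at [theta]. *)
  have Ep : ext_poly b - ext_poly a - (ext_val b - ext_val a)%:P = 0.
    apply: (towerF_ext_inj rootlessH th_root).
    - by rewrite !rpredB ?polyOverC ?LK.
    - apply: leq_trans (size_polyD _ _) _; rewrite geq_max size_polyN.
      rewrite (leq_trans (size_polyC_leq1 _)) // andbT.
      by rewrite (leq_trans (size_polyD _ _)) // geq_max size_polyN !size_poly.
    - by rewrite rootE !hornerE subrr.
  move=> [|j] // /andP[_ ju]; apply: v_inj => //.
  have := congr1 (fun q : {poly C} => q`_j.+1) Ep.
  by rewrite !coefB coefC !coef_poly ju coef0 subr0 => /eqP; rewrite subr_eq0 => /eqP.
have /Hc bE : digit b 0 = digit b 0 /\ forall j, (0 < j < u)%N -> digit b j = digit a j by [].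
move: ab; rewrite valE // => /BL[] // g [m [n [a0E b0E]]].
exists (oadd (omul x c) g), m, n; split.
  by rewrite [LHS]aE a0E Bx oaddA omulDr omulA.
by rewrite bE // b0E Bx oaddA omulDr omulA.
Qed.

(** [{poly %/ g}] computes modulo [mk_monic g], which coincides with [g] for this monic non-constant
    [g]. *)
Let szg : size (mk_monic ('X^u - h)) = u.+1 /\ mk_monic ('X^u - h) = 'X^u - h.
Proof.
have [[sh _] _] := first_h.
have sg : size ('X^u - h) = u.+1 by rewrite size_polyDl ?size_polyXn // size_polyN ltnS.
have gm : 'X^u - h \is monic.
  by rewrite monicE lead_coefDl ?lead_coefXn // size_polyN size_polyXn ltnS.
by rewrite /mk_monic sg ltnS u0 gm.
Qed.

Lemma alg_code_ext a (x : {poly %/ ('X^u - h)}) :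
  alg_code e B u a x <->
  (a < opow B (onat u))%O /\ ext_val a = (map_poly emb (x : {poly F})).[theta].
Proof.
have sx : (size (x : {poly F}) <= u)%N.
  by rewrite -ltnS -szg.1 size_mk_monic.
have dE b : b = digits B (fun j => e (x : {poly F})`_j) u ->
    (b < opow B (onat u))%O /\ ext_val b = (map_poly emb (x : {poly F})).[theta].
  move=> ->; split; first by apply: digits_lt.
  rewrite /ext_val; congr horner; apply/polyP => j; rewrite coef_poly coef_map.
  case: ltnP => [ju|uj]; first by rewrite digitE.
  by rewrite nth_default ?raddf0 // (leq_trans sx).
split=> [/dE //|[aB aE]].
have [bB bE] := dE _ erefl; rewrite /alg_code -/(digits B (fun j => e (x : {poly F})`_j) u).
by apply: ext_val_inj => //; rewrite aE bE.
Qed.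

Lemma alg_code_exists a : (a < opow B (onat u))%O ->
  exists x : {poly %/ ('X^u - h)}, alg_code e B u a x.
Proof.
move=> aB; have [q qE] := map_emb_surj (ext_poly_over a).
exists (in_qpoly _ q); apply/alg_code_ext; split=> //.
rewrite in_qpoly_small ?qE // szg.1 ltnS.
by rewrite -(size_map_poly emb) qE size_poly.
Qed.

Lemma theta_qpolyM (x y : {poly %/ ('X^u - h)}) :
  (map_poly emb (x * y : {poly %/ ('X^u - h)})).[theta] =
  (map_poly emb (x : {poly F})).[theta] * (map_poly emb (y : {poly F})).[theta].
Proof.
rewrite -hornerM -rmorphM poly_of_qpolyM.
have E := Pdiv.RingMonic.rdivp_eq (monic_mk_monic ('X^u - h)) ((x : {poly F}) * y).
have gz : (map_poly emb (mk_monic ('X^u - h))).[theta] = 0.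
  by rewrite szg.2 HE; exact/rootP.
by rewrite [in RHS]E rmorphD rmorphM /= hornerD hornerM gz mulr0 add0r.
Qed.

(** Both directions matter: from right to left it shows that a next stage exists, from left to right
    it describes whichever one [xget] selects. *)
Lemma transported_ext S' : bound S' = opow B (onat u) ->
  transported (@alg_code F e B u ('X^u - h)) S' <->
  stage_iso S' (opow B (onat u)) ext_val (K u i.+1).
Proof.
move=> bS'; split=> [T|[_ _ _ _ T] a b x y].
  split=> //; first exact: ext_val_inj.
  - move=> x; split=> [/ext_val_surj //|[a _ <-]]; exact: ext_val_in.
  - by rewrite ext_val_old //; have [] := isoS.
  move=> a b aB bB; have [x ax] := alg_code_exists aB; have [y by_] := alg_code_exists bB.
  have [/alg_code_ext[cB cE] /alg_code_ext[dB dE]] := T _ _ _ _ ax by_.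
  move: ax by_ => /alg_code_ext[_ ax] /alg_code_ext[_ by_].
  split=> //; first by rewrite cE poly_of_qpolyD rmorphD hornerD ax by_.
  by rewrite dE theta_qpolyM ax by_.
move=> /alg_code_ext[aB aE] /alg_code_ext[bB bE]; have [cB dB cE dE] := T _ _ aB bB.
split; apply/alg_code_ext; split=> //.
  by rewrite cE aE bE poly_of_qpolyD rmorphD hornerD.
by rewrite dE theta_qpolyM aE bE.
Qed.

End WithPoly.
End WithField.
End StageStep.

Section Tower.
Local Open Scope ring_scope.
Variables (C : closedFieldType) (p : nat).
Hypothesis charC : p \in [pchar C].
Local Notation K u i := (towerF charC u i).
Local Notation isoStage := (@stage_iso C).

Definition block_coset (L : {pred C}) (B : Ord) (v : Ord -> C) : Prop :=
  forall a b, (a < B)%O -> (b < B)%O -> (same_block a b <-> v b - v a \in L).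

Lemma stage_iso_field S B v u i : stage_iso S B v (K u i) ->
  exists (F : fieldType) (e : F -> Ord), stage_field e S.
Proof.
move=> [bS v_inj HK v0 H]; pose F := subfield (K u i).
have pre (x : F) : exists a, (a < B)%O /\ v a = subfield_val x.
  by have /HK[a aB va] := valP x; exists a.
pose e x := sval (cid (pre x)).
have eB x : (e x < B)%O by case: (svalP (cid (pre x))).
have ev x : v (e x) = subfield_val x by case: (svalP (cid (pre x))).
exists F, e; split=> [x y exy|a|x y|x y].
- by apply: val_inj; rewrite /= -!ev exy.
- rewrite bS; split=> [aB|[x <-] //].
  have aK : v a \in K u i by apply/HK; exists a.
  by exists (Subfield aK); apply: v_inj => //; rewrite ev.
- have [dB _ dE _] := H _ _ (eB x) (eB y); apply: v_inj => //.
  by rewrite dE !ev.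
- have [_ dB _ dE] := H _ _ (eB x) (eB y); apply: v_inj => //.
  by rewrite dE !ev.
Qed.

Section Step.
Variables (S : stage) (B : Ord) (v : Ord -> C) (u i : nat).
Hypothesis pu : prime u.
Hypothesis isoS : stage_iso S B v (K u i).

(** Without a solution of [next_stage], the [xget] in [On_stage] would merely repeat the previous
    stage. *)
Lemma next_stage_exists : exists S', next_stage S S'.
Proof.
have [F [e fieldS]] := stage_iso_field isoS.
have [h first_h] := first_poly_exists pu isoS fieldS.
have bS : bound S = B by case: isoS.
pose V := ext_val pu isoS fieldS first_h; pose B' := opow B (onat u).
have Vin := ext_val_in pu isoS fieldS first_h.
have Vsurj x := ext_val_surj pu isoS fieldS first_h (x := x).
(* The operations of [C] are pulled back along the bijection [V] from ordinals below [B'] to the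
   larger field. *)
pose op (f : C -> C -> C) a b := xget ozero [set c | (c < B')%O /\ V c = f (V a) (V b)]%classic.
have opP f a b : (forall x y, x \in K u i.+1 -> y \in K u i.+1 -> f x y \in K u i.+1) ->
    (op f a b < B')%O /\ V (op f a b) = f (V a) (V b).
  move=> fK; apply: (@xgetPex _ ozero [set c | (c < B')%O /\ V c = f (V a) (V b)]%classic).
  by have [c cB cE] := Vsurj _ (fK _ _ (Vin a) (Vin b)); exists c.
exists (Stage B' (op +%R) (op *%R)), F, e; split=> //; left; split.
  exact: (not_closed pu isoS fieldS).
exists u, h; split=> //; rewrite ?bS //; first exact: (first_degree_u pu isoS fieldS).
apply/(transported_ext pu isoS fieldS first_h) => //; split=> //.
- exact: ext_val_inj.
- by move=> x; split=> [/Vsurj //|[a _ <-]].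
- rewrite ext_val_old; first by case: isoS.
  case: isoS => _ _ /(_ 0)[/(_ (rpred0 _))[a aB _] _] _ _.
  exact: le_lt_trans (ozero_le a) aB.
move=> a b _ _.
have [cB cE] := opP +%R a b (@rpredD _ _).
have [dB dE] := opP *%R a b (@rpredM _ _).
by [].
Qed.

Lemma next_stage_step S' : next_stage S S' -> exists v',
  [/\ stage_iso S' (opow B (onat u)) v' (K u i.+1),
      forall a, (a < B)%O -> v' a = v a &
      forall x L, B = omul omega x -> {subset L <= K u i} -> block_coset L B v ->
        block_coset L (opow B (onat u)) v'].
Proof.
have bS : bound S = B by case: isoS.
case=> F [e [fieldS [[_ [n [h [fd fp bS' tr]]]]|[cl _]]]]; last first.
  by case: (not_closed pu isoS fieldS cl).
have nu := first_degree_eq pu isoS fieldS fd; rewrite {}nu in fp bS' tr.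
rewrite bS in bS' tr.
exists (ext_val pu isoS fieldS fp); split.
- exact/(transported_ext pu isoS fieldS fp bS').
- by move=> a; exact: ext_val_old.
- move=> x L Bx LK BL a b aB bB.
  exact: (@ext_val_block _ _ charC _ _ _ _ _ pu isoS _ _ fieldS _ fp x L Bx LK BL).
Qed.

End Step.

End Tower.

Lemma osup_lub (P : set Ord) b : (forall a, P a -> a <= b) -> osup P <= b.
Proof. by move=> H; apply: (@oleast_le [set b | forall a, P a -> a <= b]%classic). Qed.

Lemma osup_ub (P : set Ord) b a : (forall a, P a -> a <= b) -> P a -> a <= osup P.
Proof.
move=> H Pa; have : exists b, forall a, P a -> a <= b by exists b.
by move=> /(@oleast_in [set b | forall a, P a -> a <= b]%classic); apply.
Qed.

Lemma On_stage0 p : On_stage p ozero = stage0 p.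
Proof. by rewrite /On_stage orecE eqxx. Qed.

Lemma On_stageS p D :
  On_stage p (osucc D) = xget (On_stage p D) [set S' | next_stage (On_stage p D) S']%classic.
Proof.
rewrite {1}/On_stage orecE -/(On_stage p) (negbTE (osucc_neq0 D)).
case: pselect => [ex|[]]; last by exists D.
have -> : oleast [set D' | osucc D = osucc D']%classic = D.
  have /oleast_in : exists D', [set D' | osucc D = osucc D']%classic D' by exists D.
  by move=> /osucc_inj.
by rewrite ltS.
Qed.

Lemma On_stage_lim p D : D != ozero -> (forall D', D <> osucc D') ->
  On_stage p D = Stage (osup [set bound (On_stage p D') | D' in [set D' | D' < D]]%classic)
    (union_op sadd (On_stage p) [set D' | D' < D]%classic)
    (union_op smul (On_stage p) [set D' | D' < D]%classic).
Proof.
move=> D0 nS; rewrite {1}/On_stage orecE -/(On_stage p) (negbTE D0).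
case: pselect => [ex|no] /=; first by case: ex => D' /nS.
set prev := (fun b => if b < D then On_stage p b else stage0 p).
have prevE D' : D' < D -> prev D' = On_stage p D' by rewrite /prev => ->.
have unionE op : union_op op prev [set D' | D' < D]%classic =
    union_op op (On_stage p) [set D' | D' < D]%classic.
  apply/funext => a; apply/funext => b; rewrite /union_op.
  have -> : [set D0 | [/\ [set D' | D' < D] D0, a < bound (prev D0)
        & b < bound (prev D0)]]%classic =
      [set D0 | [/\ [set D' | D' < D] D0, a < bound (On_stage p D0)
        & b < bound (On_stage p D0)]]%classic.
    by apply/seteqP; split=> x /= [xD]; rewrite prevE.
  set P := [set D0 | _]%classic.
  (* This holds even for empty [P], where [oleast] is the default [ozero], below the limit [D]. *)
  suff PD : oleast P < D by rewrite prevE.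
  have [ex|nP] := pselect (exists x, P x); first by have [] := oleast_in ex.
  rewrite /oleast xgetPN ?lt0_neq // => x [Px _]; apply: nP; by exists x.
rewrite !unionE; congr (Stage (osup _) _ _); apply/seteqP.
by split=> _ [D' /= D'D <-]; exists D' => //=; rewrite ?(prevE D' D'D) ?D'D.
Qed.

(** * Identification of all stages below omega^(omega^omega) *)

Section TowerStages.
Local Open Scope ring_scope.
Variables (C : closedFieldType) (p : nat).
Hypothesis charC : p \in [pchar C].
Local Notation K u i := (towerF charC u i).
Let pp : prime p. Proof. exact: (pcharf_prime charC). Qed.
Let p1 : (1 < p)%N. Proof. exact: prime_gt1. Qed.

Fixpoint stage_lim (k : nat) : Ord :=
  if k is k'.+1 then osup (range (fun i => iter i osucc (stage_lim k')))%classic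
  else ozero.

(** The index of the stage [p^(omega^k q_k^i)], for [q_k] the [k]-th prime. *)
Definition stage_idx (k i : nat) : Ord := iter i osucc (stage_lim k).

Lemma stage_idx_mono k i j : (i < j)%N -> (stage_idx k i < stage_idx k j)%O.
Proof.
elim: j => // j IH; rewrite ltnS leq_eqVlt => /orP[/eqP ->|/IH ij]; first exact: ltS.
exact: lt_trans ij (ltS _).
Qed.

Lemma stage_limP k D : (D < stage_lim k.+1)%O <-> exists i, (D < stage_idx k i)%O.
Proof. exact: lt_osup. Qed.

(** The stages of the tower have no gaps, so the least index used by [union_op] is again the index
    of a known stage. *)
Lemma stage_idx_lt k i D : (D < stage_idx k i)%O ->
  exists k' i', [/\ D = stage_idx k' i', (k' <= k)%N & (k' == k) ==> (i' < i)%N].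
Proof.
elim: k i => [|k IHk]; elim=> [|i IHi] DE.
- by move: DE; rewrite ltNge ozero_le.
- move: DE; rewrite ltSle le_eqVlt => /orP[/eqP ->|/IHi[k' [i' [-> k'k H]]]].
    by exists 0%N, i; rewrite eqxx ltnSn.
  exists k', i'; split=> //; move: H; case: eqP => //= _ /ltnW H.
  exact: leq_trans H _.
- move: DE => /stage_limP[j /IHk[k' [i' [-> k'k H]]]].
  exists k', i'; split=> //; first exact: leqW.
  by rewrite (ltn_eqF _) // ltnS.
- move: DE; rewrite ltSle le_eqVlt => /orP[/eqP ->|/IHi[k' [i' [-> k'k H]]]].
    by exists k.+1, i; rewrite eqxx ltnSn leqnn.
  exists k', i'; split=> //; move: H; case: eqP => //= _ /ltnW H.
  exact: leq_trans H _.
Qed.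

Lemma stage_lim_neq0 k : stage_lim k.+1 != ozero.
Proof.
rewrite -lt0_neq; apply/stage_limP; exists 1%N.
exact: le_lt_trans (ozero_le _) (ltS _).
Qed.

Lemma stage_lim_limit k D : stage_lim k.+1 <> osucc D.
Proof.
move=> E; have := ltS D; rewrite -E => /stage_limP[i Di].
have : (osucc D < stage_idx k i.+1)%O by rewrite osuccS.
move=> H; have /(_ (ex_intro _ i.+1 H)) := proj2 (stage_limP k (osucc D)).
by rewrite E ltxx.
Qed.

Local Notation sb := (sbound p prm).

Lemma sb_le k i j : (i <= j)%N -> (sb k i <= sb k j)%O.
Proof.
move=> /subnKC <-; elim: (j - i)%N => [|n IH]; first by rewrite addn0.
by rewrite addnS; apply: le_trans IH _; apply: sbound_leS => //; exact: prm_gt0.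
Qed.

Lemma sb_lt_lim k i a : (a < sb k i)%O -> (a < sb k.+1 0)%O.
Proof. by move=> ai; apply/(sbound_lim p1 (prm_gt1 k)); exists i. Qed.

Lemma sb_lt_lim' k k' i a : (k < k')%N -> (a < sb k i)%O -> (a < sb k' 0)%O.
Proof.
elim: k' => // k' IH; rewrite ltnS leq_eqVlt => /orP[/eqP <-|/IH H] /= ai.
  exact: sb_lt_lim ai.
exact/(@sb_lt_lim _ 0)/H.
Qed.

(** As [prm 1] is 3, [K (prm 1) 0] is the field of finite ordinals. The block property starts at k =
    1: for k = 0 the bounds are finite, hence not multiples of omega, and [ext_val_block] does not
    apply. *)
Definition stage_good (k i : nat) (v : Ord -> C) : Prop :=
  stage_iso (On_stage p (stage_idx k i)) (sb k i) v (K (prm k) i) /\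
  ((0 < k)%N -> block_coset (K (prm 1) 0) (sb k i) v).

Lemma tower1_sub k i x : (0 < k)%N -> x \in K (prm 1) 0 -> x \in K (prm k) i.
Proof.
move=> k0 x1; have : x \in K (prm k) 0.
  elim: k k0 => // -[|k] IH _ //; apply/towerF_next; exists 0%N; exact: IH.
by elim: i => // i IH /IH; exact: towerF_sub.
Qed.

Lemma stage_good_step k i v : stage_good k i v -> exists v',
  stage_good k i.+1 v' /\ forall a, (a < sb k i)%O -> v' a = v a.
Proof.
move=> [iso blk]; have [S' nS'] := next_stage_exists (prm_prime k) iso.
have nS : next_stage (On_stage p (stage_idx k i)) (On_stage p (stage_idx k i.+1)).
  by rewrite [stage_idx k i.+1]/= On_stageS; apply: xgetPex; exists S'.
have [v' [iso' agr blk']] := next_stage_step (prm_prime k) iso nS.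
exists v'; split=> //; split=> [|k0]; first by rewrite sboundS.
rewrite sboundS //; move: k0 blk blk'; case: k {iso iso' agr nS nS'} => // k _ blk blk'.
have [x Bx] := sbound_omega p1 i (prm_gt0 k.+1).
apply: (blk' x) => //; last exact: blk.
by move=> y; exact: tower1_sub.
Qed.

(** The identification with a subfield of [C] depends on the choice of a root, so an extension of
    the previous one is chosen; otherwise the values could not be glued at limits. *)
Definition stage_next (k i : nat) (v : Ord -> C) : Ord -> C :=
  if pselect (exists v', stage_good k i.+1 v' /\ forall a, (a < sb k i)%O -> v' a = v a)
  is left ex then sval (cid ex) else v.

Fixpoint stage_val_from (k : nat) (v : Ord -> C) (i : nat) : Ord -> C :=
  if i is i'.+1 then stage_next k i' (stage_val_from k v i') else v.

Definition stage_glue (vs : nat -> Ord -> C) (k : nat) (a : Ord) : C :=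
  if pselect (exists i, (a < sb k i)%O) is left ex then vs (ex_minn ex) a else 0.

Fixpoint stage_start (k : nat) : Ord -> C :=
  if k is k'.+1 then stage_glue (stage_val_from k' (stage_start k')) k'
  else fun a => (nat_of_Ord a)%:R.

Definition stage_val (k i : nat) : Ord -> C := stage_val_from k (stage_start k) i.

Lemma stage_val_good k : stage_good k 0 (stage_start k) ->
  forall i, stage_good k i (stage_val k i) /\
    forall a, (a < sb k i)%O -> stage_val k i.+1 a = stage_val k i a.
Proof.
move=> g0.
have step i : stage_good k i (stage_val k i) -> stage_good k i.+1 (stage_val k i.+1) /\
    forall a, (a < sb k i)%O -> stage_val k i.+1 a = stage_val k i a.
  move=> /stage_good_step ex; rewrite /stage_val /= -/(stage_val k i) /stage_next.
  by case: pselect => // ex'; exact: (svalP (cid ex')).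
suff H i : stage_good k i (stage_val k i) by move=> i; split=> //; have [] := step i (H i).
by elim: i => // i /step[].
Qed.

Lemma stage_val_agree k i j a : stage_good k 0 (stage_start k) -> (i <= j)%N ->
  (a < sb k i)%O -> stage_val k j a = stage_val k i a.
Proof.
move=> g0 /subnKC <- ai; elim: (j - i)%N => [|n IH]; first by rewrite addn0.
rewrite addnS; have [_ ->] := stage_val_good g0 (i + n) => //.
by apply: lt_le_trans ai _; apply: sb_le; exact: leq_addr.
Qed.

Lemma stage_start_agree k i a : stage_good k 0 (stage_start k) ->
  (a < sb k i)%O -> stage_start k.+1 a = stage_val k i a.
Proof.
move=> g0 ai; rewrite /= /stage_glue; case: pselect => [ex|[]]; last by exists i.
case: ex_minnP => j aj min; symmetry; apply: stage_val_agree => //; exact: min.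
Qed.

Lemma stage_start_agree' k k' i a : (forall l, (l <= k')%N -> stage_good l 0 (stage_start l)) ->
  (k <= k')%N -> (a < sb k i)%O -> stage_start k'.+1 a = stage_val k i a.
Proof.
elim: k' => [|k' IH] g kk ai; move: kk; rewrite leq_eqVlt => /orP[/eqP kk|kk].
- by rewrite -kk; apply: stage_start_agree => //; apply: g; rewrite kk.
- by [].
- by rewrite -kk; apply: stage_start_agree => //; apply: g; rewrite kk.
rewrite (@stage_start_agree _ 0); [|exact: g|exact: sb_lt_lim' ai].
rewrite -[stage_val k'.+1 0]/(stage_start k'.+1) IH // => l lk.
by apply: g; exact: leqW.
Qed.

Lemma stage_good0 : stage_good 0 0 (stage_start 0).
Proof.
split=> //; rewrite [stage_idx 0 0]/= On_stage0 sbound00 //= prm0.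
have natE a : (a < onat p)%O -> exists2 n, (n < p)%N & a = onat n := @lt_onat a p.
have modE n : (n %% p)%:R = n%:R :> C.
  by rewrite [in RHS](divn_eq n p) natrD natrM (pcharf0 charC) mulr0 add0r.
have ltp n : (onat (n %% p) < onat p)%O by rewrite onat_mono ltn_pmod ?prime_gt0.
split=> //.
- move=> a b /natE[m mp ->] /natE[n np ->]; rewrite !nat_of_OrdK => E.
  congr onat; wlog mn : m n mp np E / (m <= n)%N => [W|].
    by case: (leqP m n) => [/W|/ltnW/W W']; [apply|symmetry; apply: W'].
  apply/eqP; rewrite eqn_leq mn -subn_eq0 /=; apply: contraT => nm.
  have : (p %| n - m)%N by rewrite (dvdn_pcharf charC) natrB // E subrr.
  by rewrite gtnNdvd ?lt0n // (leq_ltn_trans (leq_subr _ _) np).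
- move=> x; rewrite towerF_prime_field; split=> [/fixF1P[n np ->]|[_ /natE[n np ->] <-]].
    by exists (onat n); rewrite ?onat_mono ?nat_of_OrdK.
  by apply/fixF1P; exists n; rewrite ?nat_of_OrdK.
- by rewrite -[ozero]/(onat 0) nat_of_OrdK.
move=> _ _ /natE[m mp ->] /natE[n np ->]; rewrite !nat_of_OrdK !ltp.
by rewrite !modE natrD natrM.
Qed.

Lemma union_op_stage (op : stage -> Ord -> Ord -> Ord) (I : set Ord) k i a b :
  (forall l, (l <= k)%N -> stage_good l 0 (stage_start l)) ->
  (forall l j, (l <= k)%N -> I (stage_idx l j)) ->
  (a < sb k i)%O -> (b < sb k i)%O ->
  exists l j, [/\ (l <= k)%N, (a < sb l j)%O, (b < sb l j)%O &
    union_op op (On_stage p) I a b = op (On_stage p (stage_idx l j)) a b].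
Proof.
move=> g Ik ai bi; rewrite /union_op; set P := [set D | _]%classic.
have bE l j : (l <= k)%N -> bound (On_stage p (stage_idx l j)) = sb l j.
  by move=> lk; have [[[-> _ _ _ _] _] _] := stage_val_good (g l lk) j.
have Pki : P (stage_idx k i) by split; rewrite ?bE //; exact: Ik.
have [l [j [E lk]]] : exists l j, oleast P = stage_idx l j /\ (l <= k)%N.
  have := oleast_le Pki; rewrite le_eqVlt => /orP[/eqP ->|].
    by exists k, i; rewrite leqnn.
  by move=> /stage_idx_lt[l [j [-> lk _]]]; exists l, j.
have := oleast_in (ex_intro P _ Pki); rewrite E => -[_]; rewrite !bE // => aj bj.
by exists l, j.
Qed.

Lemma stage_good_lim k : (forall l, (l <= k)%N -> stage_good l 0 (stage_start l)) ->
  stage_good k.+1 0 (stage_start k.+1).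
Proof.
move=> g; set B := sb k.+1 0; set v := stage_start k.+1.
have vE l i a : (l <= k)%N -> (a < sb l i)%O -> v a = stage_val l i a.
  exact: stage_start_agree'.
have subB l i a : (l <= k)%N -> (a < sb l i)%O -> (a < B)%O.
  by move=> lk; apply: sb_lt_lim'.
have inB a : (a < B)%O -> exists i, (a < sb k i)%O.
  by move/(sbound_lim p1 (prm_gt1 k)).
have inB2 a b : (a < B)%O -> (b < B)%O -> exists i, (a < sb k i)%O /\ (b < sb k i)%O.
  move=> /inB[i ai] /inB[j bj]; exists (maxn i j).
  by rewrite (lt_le_trans ai) ?(lt_le_trans bj) // sb_le ?leq_maxl ?leq_maxr.
have gk i : stage_good k i (stage_val k i) by have [] := stage_val_good (g k (leqnn k)) i.
have E := On_stage_lim p (stage_lim_neq0 k) (@stage_lim_limit k).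
have bE : bound (On_stage p (stage_lim k.+1)) = B.
  rewrite E /=; have ub a :
      [set bound (On_stage p D') | D' in [set D' | (D' < stage_lim k.+1)%O]]%classic a ->
      (a <= B)%O.
    move=> [D' /= /stage_limP[i /stage_idx_lt[l [j [-> lk _]]]] <-].
    have [[[-> _ _ _ _] _] _] := stage_val_good (g l lk) j.
    by apply: le_from_lt => c; exact: subB.
  apply/eqP; rewrite eq_le osup_lub //=; apply: le_from_lt => c /inB[i ci].
  apply: lt_le_trans ci _; apply: (osup_ub ub); exists (stage_idx k i) => /=.
    by apply/stage_limP; exists i.+1; exact: stage_idx_mono.
  by have [[-> _ _ _ _] _] := gk i.
have idx_lim l j : (l <= k)%N -> (stage_idx l j < stage_lim k.+1)%O.
  elim: k {g B v vE subB inB inB2 gk E bE} => [|k IH]; rewrite leq_eqVlt => /orP[/eqP ->|lk] //.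
  - by apply/stage_limP; exists j.+1; exact: stage_idx_mono.
  - by apply/stage_limP; exists j.+1; exact: stage_idx_mono.
  apply: lt_trans (IH lk) _; apply/stage_limP; exists 1%N; exact: ltS.
have opE op a b : (a < B)%O -> (b < B)%O -> exists l j,
    [/\ (l <= k)%N, (a < sb l j)%O, (b < sb l j)%O &
     union_op op (On_stage p) [set D' | (D' < stage_lim k.+1)%O]%classic a b =
     op (On_stage p (stage_idx l j)) a b].
  move=> aB bB; have [i [ai bi]] := inB2 a b aB bB.
  exact: union_op_stage g idx_lim ai bi.
split; last first.
  move=> _ a b aB bB; have [i [ai bi]] := inB2 a b aB bB; rewrite !(vE k i) //.
  case: (posnP k) => [k0|kp]; last by have [_ /(_ kp)] := gk i; apply.
  (* For k = 0 the new bound is omega: the finite ordinals form one block, and all their values lie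
     in [K (prm 1) 0]. *)
  have aw : (a < omega)%O by rewrite -(sbound10 p1 prm) -/B; move: aB; rewrite /B k0.
  have bw : (b < omega)%O by rewrite -(sbound10 p1 prm) -/B; move: bB; rewrite /B k0.
  split=> _.
    rewrite rpredB //; apply/towerF_next; exists i; have [[_ _ H _ _] _] := gk i;
      rewrite -[in X in prm X]k0; apply/H; by [exists b | exists a].
  move: aw bw => /lt_omega[m ->] /lt_omega[n ->]; exists ozero, m, n.
  by rewrite omulx0 !oadd0x.
split=> //.
- move=> a b aB bB; have [i [ai bi]] := inB2 a b aB bB; rewrite !(vE k i) //.
  by have [[_ H _ _ _] _] := gk i; exact: H.
- move=> x; split=> [/towerF_next[i xi]|[a aB <-]].
    have [[_ _ /(_ x)[/(_ xi)[a ai <-] _] _ _] _] := gk i.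
    by exists a; [exact: subB ai | exact: vE].
  have [i ai] := inB a aB; apply/towerF_next; exists i; rewrite (vE k i) //.
  by have [[_ _ H _ _] _] := gk i; apply/H; exists a.
- have z : (ozero < sb k 0)%O by exact: sbound_gt0.
  by rewrite (vE k 0%N) //; have [[_ _ _ H _] _] := gk 0%N.
move=> a b aB bB; rewrite [stage_idx k.+1 0]/= E /=.
have [l [j [lk aj bj ->]]] := opE sadd a b aB bB.
have [l' [j' [lk' aj' bj' ->]]] := opE smul a b aB bB.
have [[[_ _ _ _ H] _] _] := stage_val_good (g l lk) j.
have [[[_ _ _ _ H'] _] _] := stage_val_good (g l' lk') j'.
have [cB _ cE _] := H a b aj bj; have [_ dB _ dE] := H' a b aj' bj'.
split; [exact: subB cB | exact: subB dB | |].
  by rewrite !(vE l j).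
by rewrite !(vE l' j').
Qed.

Lemma stage_good_start k : stage_good k 0 (stage_start k).
Proof.
elim/ltn_ind: k => -[_|k IH]; first exact: stage_good0.
by apply: stage_good_lim => l lk; exact: IH.
Qed.

Definition ord_val (a : Ord) : C :=
  if pselect (exists k, (a < sb k 0)%O) is left ex then stage_start (ex_minn ex) a else 0.

Lemma ord_valE k i a : (a < sb k i)%O -> ord_val a = stage_val k i a.
Proof.
move=> ai; have a0 := sb_lt_lim ai; rewrite /ord_val.
case: pselect => [ex|[]]; last by exists k.+1.
case: ex_minnP => m am min; have := min _ a0; rewrite leq_eqVlt => /orP[/eqP ->|].
  by apply: stage_start_agree ai; exact: stage_good_start.
rewrite ltnS => mk; rewrite -(stage_start_agree (stage_good_start k) ai).
symmetry; apply: (@stage_start_agree' m k 0) => // l _; exact: stage_good_start.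
Qed.

Lemma lt_omega3 a : (a < omega_omega_omega)%O <-> exists k, (a < sb k 0)%O.
Proof. exact: sbound_sup. Qed.

Lemma sb_lt_omega3 k i a : (a < sb k i)%O -> (a < omega_omega_omega)%O.
Proof. by move=> /sb_lt_lim ak; apply/lt_omega3; exists k.+1. Qed.

Lemma lt_omega3_common a b : (a < omega_omega_omega)%O -> (b < omega_omega_omega)%O ->
  exists k, [/\ (0 < k)%N, (a < sb k 0)%O & (b < sb k 0)%O].
Proof.
move=> /lt_omega3[j aj] /lt_omega3[k bk]; exists (maxn j k).+1; split=> //.
  by apply: sb_lt_lim' aj; rewrite ltnS leq_maxl.
by apply: sb_lt_lim' bk; rewrite ltnS leq_maxr.
Qed.

Let good k i : stage_good k i (stage_val k i).
Proof. by have [] := stage_val_good (stage_good_start k) i. Qed.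

Lemma ord_val_inj a b : (a < omega_omega_omega)%O -> (b < omega_omega_omega)%O ->
  ord_val a = ord_val b -> a = b.
Proof.
move=> aO bO; have [k [_ ak bk]] := lt_omega3_common aO bO.
by rewrite !(@ord_valE k 0) //; have [[_ H _ _ _] _] := good k 0; exact: H.
Qed.

Lemma ord_val_surj k i x : x \in K (prm k) i -> exists2 a, (a < sb k i)%O & ord_val a = x.
Proof.
have [[_ _ H _ _] _] := good k i; move=> /H[a ai <-]; exists a => //; exact: ord_valE.
Qed.

Lemma ord_val_tower k i a : (a < omega_omega_omega)%O ->
  (a < sb k i)%O = (ord_val a \in K (prm k) i).
Proof.
move=> aO; apply/idP/idP => [ai|/ord_val_surj[b bi E]].
  by rewrite (ord_valE ai); have [[_ _ H _ _] _] := good k i; apply/H; exists a.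
by rewrite (ord_val_inj aO _ (esym E)) //; exact: sb_lt_omega3 bi.
Qed.

Lemma ord_val_op a b : (a < omega_omega_omega)%O -> (b < omega_omega_omega)%O ->
  [/\ (On_add p a b < omega_omega_omega)%O, (On_mul p a b < omega_omega_omega)%O,
      ord_val (On_add p a b) = ord_val a + ord_val b &
      ord_val (On_mul p a b) = ord_val a * ord_val b].
Proof.
move=> aO bO; have [k [_ ak bk]] := lt_omega3_common aO bO.
have opE op := @union_op_stage op setT%classic k 0 a b
  (fun l _ => stage_good_start l) (fun _ _ _ => I) ak bk.
have [l [j [_ aj bj E]]] := opE sadd; have [l' [j' [_ aj' bj' E']]] := opE smul.
have [[_ _ _ _ /(_ a b aj bj)[cB _ cE _]] _] := good l j.
have [[_ _ _ _ /(_ a b aj' bj')[_ dB _ dE]] _] := good l' j'.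
rewrite /On_add /On_mul E E'; split.
- exact: sb_lt_omega3 cB.
- exact: sb_lt_omega3 dB.
- by rewrite (ord_valE cB) (ord_valE aj) (ord_valE bj).
- by rewrite (ord_valE dB) (ord_valE aj') (ord_valE bj').
Qed.

Lemma ord_val_block a b : (a < omega_omega_omega)%O -> (b < omega_omega_omega)%O ->
  (same_block a b <-> ord_val b - ord_val a \in K (prm 1) 0).
Proof.
move=> aO bO; have [k [k0 ak bk]] := lt_omega3_common aO bO.
by rewrite !(@ord_valE k 0) //; have [_ /(_ k0)] := good k 0; apply.
Qed.

(** The bound on n is essential: a finite ordinal n >= p is not in the prime field, so its value
    differs from n%:R. *)
Lemma ord_val_nat n : (n < p)%N -> ord_val (onat n) = n%:R.
Proof.
move=> np; rewrite (@ord_valE 0 0) /stage_val /= ?nat_of_OrdK //.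
by rewrite sbound00 // onat_mono.
Qed.

Lemma onat_omega3 n : (onat n < omega_omega_omega)%O.
Proof.
apply: (@sb_lt_omega3 1 0); rewrite sbound10 //; apply/lt_omega; by exists n.
Qed.

End TowerStages.

(** * Roots of order [u] *)

Section RootsInTower.
Local Open Scope ring_scope.
Variables (C : closedFieldType) (p : nat).
Hypothesis charC : p \in [pchar C].
Local Notation F d := (fixF charC d).
Local Notation K u i := (towerF charC u i).
Hypothesis algebraicC : forall x : C, exists2 d, (0 < d)%N & x \in F d.
Local Notation dgr := (dgr algebraicC).
Let pp : prime p. Proof. exact: (pcharf_prime charC). Qed.
Let p1 : (1 < p)%N. Proof. exact: prime_gt1. Qed.
Let q_gt0 d : (0 < p ^ d)%N. Proof. by rewrite expn_gt0 prime_gt0. Qed.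

Variables (u : nat) (z : C).
Hypotheses (pu : prime u) (up : u != p) (zu : z ^+ u = 1) (z1 : z != 1).
Let u0 : (0 < u)%N. Proof. exact: prime_gt0. Qed.

Lemma unity_root_fixF d : (z \in F d) = (u %| (p ^ d).-1)%N.
Proof.
have zprim : u.-primitive_root z.
  have [m mz /(primeP pu).2] := prim_order_exists u0 zu.
  case/orP=> /eqP mE; rewrite mE in mz => //.
  by move: z1; rewrite -[z]expr1 (prim_expr_order mz) eqxx.
have z0 : z != 0 by rewrite (prim_root_eq0 zprim) -lt0n.
rewrite (prim_order_dvd zprim); apply/fixFP/eqP => [H|H].
  by apply: (mulIf z0); rewrite -exprSr prednK // H mul1r.
by rewrite -(prednK (q_gt0 d)) exprS H mulr1.
Qed.

Lemma dvd_unity_degree d : (u %| (p ^ d).-1)%N = (dgr z %| d)%N.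
Proof. by rewrite -unity_root_fixF fixFE. Qed.

(** By Fermat [u] divides p^(u-1) - 1, so the degree of [z] divides u - 1. Hence [z] lies in
    chi_u. *)
Lemma unity_degree_small : (0 < dgr z < u)%N.
Proof.
rewrite dgr_gt0 /=; have : (dgr z %| u.-1)%N.
  rewrite -dvd_unity_degree -(totient_prime pu) -subn1 -eqn_mod_dvd //.
  have cop : coprime p u by rewrite prime_coprime // dvdn_prime2 // eq_sym.
  by rewrite Euler_exp_totient.
have u1 : (0 < u.-1)%N by rewrite -subn1 subn_gt0 prime_gt1.
by move=> /(dvdn_leq u1); rewrite -{2}(prednK u0) ltnS.
Qed.

Lemma unity_root_tower : z \in K u 0.
Proof.
apply/towerFP; exists (dgr z); first by apply: smooth_small; exact: unity_degree_small.
by rewrite expn0 mul1n fixF_dgr.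
Qed.

(** Here [u] is prime to the order of the multiplicative group of [F_p(x)]. *)
Lemma root_of_degree x : x \in K u 0 -> ~~ (dgr z %| dgr x)%N ->
  exists2 y, y \in K u 0 & y ^+ u = x.
Proof.
move=> xK; rewrite -dvd_unity_degree => ndv.
have [->|x0] := eqVneq x 0.
  by exists 0; rewrite ?rpred0 // expr0n eqn0Ngt u0.
set Q := (p ^ dgr x).-1 in ndv.
have xQ : x ^+ Q = 1 by apply: (fixF_expr_pred _ x0); exact: fixF_dgr.
have [k l E _] := egcdnP Q u0.
have g1 : gcdn u Q = 1%N by apply/eqP; rewrite -/(coprime u Q) prime_coprime.
exists (x ^+ k); first exact: rpredX.
by rewrite -exprM E g1 addn1 exprSr mulnC exprM xQ expr1n mul1r.
Qed.

(** Let t = y^(p^d - 1), a u-th root of unity fixed by the Frobenius of exponent d, which multiplies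
    [y] by t. Some iterate of order w prime to [u] fixes [y], so t^w = 1 and therefore t = 1. *)
Lemma kummer d x y : (u %| (p ^ d).-1)%N -> x \in F d -> x != 0 ->
  y \in K u 0 -> y ^+ u = x -> x ^+ ((p ^ d).-1 %/ u) = 1.
Proof.
move=> ud xd x0 /towerFP[w sw]; rewrite expn0 mul1n => yw yu.
set Q := (p ^ d).-1 in ud *.
have QE : (p ^ d = Q.+1)%N by rewrite prednK.
pose t := y ^+ Q.
have tu : t ^+ u = 1 by rewrite /t -exprM mulnC exprM yu (fixF_expr_pred xd x0).
have yr r : y ^+ (p ^ (d * r)) = t ^+ r * y.
  elim: r => [|r IH]; first by rewrite muln0 expr1 expr0 mul1r.
  rewrite mulnSr expnD exprM IH exprMn QE exprS -/Q.
  have -> : t ^+ r ^+ Q = 1 by rewrite exprAC -(divnK ud) mulnC exprM tu !expr1n.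
  by rewrite mulr1 exprSr -/t mulrA -exprSr.
have y0 : y != 0 by apply: contraNneq x0 => y0; rewrite -yu y0 expr0n eqn0Ngt u0.
have tw : t ^+ w = 1.
  apply: (mulIf y0); rewrite mul1r -yr; apply/fixFP; rewrite mulnC; exact: fixF_mul.
have t1 : t = 1.
  have [k l E _] := egcdnP w u0.
  rewrite (eqP (smooth_coprime pu sw)) addn1 in E.
  have : t ^+ (k * u) = 1 by rewrite mulnC exprM tu expr1n.
  by rewrite E exprS mulnC exprM tw expr1n mulr1.
by rewrite -yu -exprM mulnC divnK.
Qed.

Lemma pow2_smooth j : smooth (prm 1) (2 ^ j).
Proof.
apply/smoothP; split=> [|l pl]; first by rewrite expn_gt0.
by rewrite Euclid_dvdX // dvdn_prime2 // => /andP[/eqP -> _]; rewrite prm_next // prm0.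
Qed.

Lemma pow2_tower j x : x \in F (2 ^ j) -> x \in K (prm 1) 0.
Proof.
by move=> xF; apply/towerFP; exists (2 ^ j)%N; rewrite ?pow2_smooth // expn0 mul1n.
Qed.

(** Here F_p(zeta_u) consists of finite ordinals and contains an element that is not a u-th
    power. *)
Lemma rootless_pow2 j : dgr z = (2 ^ j)%N ->
  exists x, [/\ x \in K u 0, x \in K (prm 1) 0 & forall y, y \in K u 0 -> y ^+ u <> x].
Proof.
move=> zj; have d0 : (0 < dgr z)%N := dgr_gt0 _ _.
have ud : (u %| (p ^ dgr z).-1)%N by rewrite dvd_unity_degree.
have Q0 : (0 < (p ^ dgr z).-1)%N.
  by rewrite -subn1 subn_gt0 -(exp1n (dgr z)) ltn_exp2r.
set e := ((p ^ dgr z).-1 %/ u)%N.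
have e0 : (0 < e)%N by rewrite divn_gt0 // dvdn_leq.
have [|x [xF x0 xe]] := exists_nonpower charC d0 e0.
  by rewrite -(divnK ud) -/e -{1}[e]muln1 ltn_pmul2l // prime_gt1.
exists x; split=> [||y yK yu].
- apply/towerFP; exists (dgr z); first by apply: smooth_small; exact: unity_degree_small.
  by rewrite expn0 mul1n.
- by apply: (@pow2_tower j); rewrite -zj.
by move/eqP: xe; apply; exact: (kummer ud xF x0 yK yu).
Qed.

Lemma rootless_translate x : x \in K u 0 -> (dgr z %| dgr x)%N ->
  (forall j, dgr z <> 2 ^ j)%N ->
  exists2 m, m \in K (prm 1) 0 & forall y, y \in K u 0 -> y ^+ u <> x + m.
Proof.
move=> xK zx zn2; apply: contrapT => no.
have all_m m : m \in K (prm 1) 0 -> exists2 y, y \in K u 0 & y ^+ u = x + m.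
  move=> mK; apply: contrapT => ny; apply: no; exists m => // y yK yu.
  by apply: ny; exists y.
have [n cop DE] := pfactor_coprime (isT : prime 2) (dgr_gt0 algebraicC x).
set a := logn 2 (dgr x) in DE; set s := (2 ^ a)%N in DE.
have s0 : (0 < s)%N by rewrite expn_gt0.
have odd_n : odd n by rewrite -coprime2n.
have DE' : (s * n)%N = dgr x by rewrite mulnC.
(* If n were 1, the degree of [z] would divide a power of 2. *)
have n1 : (1 < n)%N.
  case: (n) odd_n DE => [|[|//]] // _; rewrite mul1n => DE1.
  by move: zx; rewrite DE1 => /(@dvdn_pfactor 2 _ _ isT)[j _ /zn2].
(* Thus [x] is in no field with p^(s 2^i) elements, whence [x + m] is nonzero below. *)
have sn_pow2 i : ~~ (dgr x %| s * 2 ^ i)%N.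
  rewrite -DE' dvdn_pmul2l //; apply/negP => /(@dvdn_pfactor 2 _ _ isT)[j _ nE].
  by move: odd_n n1; rewrite nE oddX; case: j {nE}.
apply: (@not_all_powers C p charC s n u x) => //.
- move=> r /andP[r0 rn]; rewrite fixFE -DE' dvdn_pmul2l //.
  by apply/negP => /(dvdn_leq r0); rewrite leqNgt rn.
- by rewrite DE' fixF_dgr.
- by rewrite DE' dvd_unity_degree.
move=> i m mF; have [|y yK yu] := all_m m.
  by apply: (@pow2_tower (a + i)); rewrite expnD.
apply: (kummer _ _ _ yK yu).
- by rewrite dvd_unity_degree DE' dvdn_mulr.
- rewrite rpredD //; first by rewrite DE' fixF_mul // fixF_dgr.
  by apply: fixF_dvd mF; rewrite mulnAC dvdn_mulr.
- apply/eqP => xm; have := sn_pow2 i; rewrite -fixFE; case/negP.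
  have -> : x = - m by apply/eqP; rewrite -addr_eq0 xm.
  by rewrite rpredN.
Qed.

End RootsInTower.

(** * Return to ordinals and conclusion *)

Section Transfer.
Local Open Scope ring_scope.
Variables (C : closedFieldType) (p : nat).
Hypothesis charC : p \in [pchar C].
Variable incl : {rmorphism 'F_p -> C}.
Local Notation F d := (fixF charC d).
Local Notation K u i := (towerF charC u i).
Hypothesis algebraicC : forall x : C, exists2 d, (0 < d)%N & x \in F d.
Local Notation dgr := (dgr algebraicC).
Local Notation val := (ord_val charC).
Local Notation Om := omega_omega_omega.
Let pp : prime p. Proof. exact: (pcharf_prime charC). Qed.
Let p1 : (1 < p)%N. Proof. exact: prime_gt1. Qed.

Lemma Fp_lt (c : 'F_p) : (c < p)%N.
Proof. by rewrite -[X in (_ < X)%N](Fp_cast pp) ltn_ord. Qed.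

Lemma inclE (c : 'F_p) : incl c = (c : nat)%:R.
Proof. by rewrite -{1}[c]natr_Zp rmorph_nat. Qed.

Lemma incl_fix1 x : x \in F 1 -> exists c, incl c = x.
Proof. by move=> /fixF1P[n np ->]; exists n%:R; rewrite rmorph_nat. Qed.

Lemma map_incl_over (q : {poly 'F_p}) : map_poly incl q \is a polyOver (F 1).
Proof. by apply/polyOverP => j; rewrite coef_map /= inclE rpred_nat. Qed.

Lemma val_exp a n : (a < Om)%O -> (On_exp p a n < Om)%O /\ val (On_exp p a n) = val a ^+ n.
Proof.
move=> aO; elim: n => [|n [IHO IH]].
  by rewrite expr0; split; [exact: (onat_omega3 charC 1) | exact: (ord_val_nat charC p1)].
have [_ dB _ dE] := ord_val_op charC aO IHO.
by rewrite /On_exp iterS -/(On_exp p a n); split=> //; rewrite dE IH exprS.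
Qed.

Lemma val_eval (q : {poly 'F_p}) a : (a < Om)%O ->
  (On_eval q a < Om)%O /\ val (On_eval q a) = (map_poly incl q).[val a].
Proof.
move=> aO; have O0 : (ozero < Om)%O by exact: (onat_omega3 charC 0).
rewrite map_polyE horner_Poly /On_eval; elim: (polyseq q) => [|c s [IHO IH]] /=.
  by rewrite -[ozero]/(onat 0) (ord_val_nat charC) ?prime_gt0.
have [_ mO _ mE] := ord_val_op charC IHO aO.
have [sO _ sE _] := ord_val_op charC mO (onat_omega3 charC c).
by split=> //; rewrite sE mE IH (ord_val_nat charC) ?Fp_lt // inclE.
Qed.

Lemma eval_eq0 (q : {poly 'F_p}) a : (a < Om)%O ->
  On_eval q a = ozero <-> root (map_poly incl q) (val a).
Proof.
move=> aO; have [qO qE] := val_eval q aO.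
have v0 : val ozero = 0 by rewrite -[ozero]/(onat 0) (ord_val_nat charC) ?prime_gt0.
split=> [E|/rootP E]; first by apply/rootP; rewrite -qE E.
by apply: (@ord_val_inj _ _ charC) => //; [exact: (onat_omega3 charC 0) | rewrite qE E v0].
Qed.

Lemma minpoly_size (r : {poly 'F_p}) x : r != 0 -> root (map_poly incl r) x ->
  (dgr x < size r)%N.
Proof.
move=> r0 rx; have [|k /andP[k0 kr]] := root_degree (map_incl_over r) _ rx.
  by rewrite map_poly_eq0.
rewrite mul1n fixFE => /(dvdn_leq k0) dk; apply: leq_ltn_trans dk _.
by rewrite size_map_poly in kr.
Qed.

(** The product of ['X - y] over the conjugates [y] of [x] has coefficients in [F 1], which lift to
    ['F_p]. *)
Lemma minpoly_exists x : exists q : {poly 'F_p},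
  [/\ q \is monic, size q = (dgr x).+1 & root (map_poly incl q) x].
Proof.
have xF : x \in F (1 * dgr x) by rewrite mul1n fixF_dgr.
have PF := conjp_over xF; set P := conjp _ _ _ _ in PF.
have pre j := cid (incl_fix1 (polyOverP PF j)).
have E : map_poly incl (\poly_(j < size P) sval (pre j)) = P.
  apply/polyP => j; rewrite coef_map coef_poly; case: ltnP => [_|qj].
    exact: (svalP (pre j)).
  by rewrite raddf0 nth_default.
exists (\poly_(j < size P) sval (pre j)); split.
- by rewrite -(map_monic incl) E monic_conjp.
- by rewrite -(size_map_poly incl) E size_conjp.
rewrite E /P -(prednK (dgr_gt0 algebraicC x)) /conjp rootE horner_prod big_ord_recl.
by rewrite muln0 frob0 !hornerE subrr mul0r.
Qed.

Lemma deg_val a : (a < Om)%O -> deg p a = dgr (val a).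
Proof.
move=> aO; have [q [qm sq qx]] := minpoly_exists (val a).
have minq : is_minpoly a q.
  split=> //; first exact/(eval_eq0 q aO).
  move=> r rm /(eval_eq0 r aO) rx; rewrite sq; apply: minpoly_size rx.
  exact: monic_neq0.
rewrite /deg; set q' := xget _ _; have [q'm q'a minq'] : is_minpoly a q'.
  by apply: (@xgetPex _ 0 [set r | is_minpoly a r]%classic); exists q.
suff -> : size q' = (dgr (val a)).+1 by [].
apply/eqP; rewrite eqn_leq -{1}sq minq' //=; last exact/(eval_eq0 q aO).
by apply: minpoly_size; [exact: monic_neq0 | exact/(eval_eq0 q' aO)].
Qed.

Variables (u : nat).
Hypotheses (pu : prime u) (up : u != p).
Let u0 : (0 < u)%N. Proof. exact: prime_gt0. Qed.
Let u1 : (1 < u)%N. Proof. exact: prime_gt1. Qed.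

Lemma primitive_root_exists : exists2 z : C, z ^+ u = 1 & forall k, (0 < k < u)%N -> z ^+ k != 1.
Proof.
have d0 : (0 < u.-1)%N by rewrite -subn1 subn_gt0.
have ud : (u %| (p ^ u.-1).-1)%N.
  rewrite -(totient_prime pu) -subn1 -eqn_mod_dvd ?expn_gt0 ?prime_gt0 //.
  have cop : coprime p u by rewrite prime_coprime // dvdn_prime2 // eq_sym.
  by rewrite Euler_exp_totient.
have Q0 : (0 < (p ^ u.-1).-1)%N by rewrite -subn1 subn_gt0 -(exp1n u.-1) ltn_exp2r.
set e := ((p ^ u.-1).-1 %/ u)%N.
have e0 : (0 < e)%N by rewrite divn_gt0 // dvdn_leq.
have [|x [xF x0 xe]] := exists_nonpower charC d0 e0.
  by rewrite -(divnK ud) -/e -{1}[e]muln1 ltn_pmul2l // prime_gt1.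
have xu : (x ^+ e) ^+ u = 1 by rewrite -exprM divnK // (fixF_expr_pred xF).
exists (x ^+ e) => // k /andP[k0 ku]; apply: contra xe => /eqP xk.
have [a b E _] := egcdnP u k0.
have g1 : gcdn k u = 1%N.
  by apply/eqP; rewrite gcdnC -/(coprime u k) prime_coprime // gtnNdvd.
have : (x ^+ e) ^+ (a * k) = 1 by rewrite mulnC exprM xk expr1n.
by rewrite E g1 addn1 exprS mulnC exprM xu expr1n mulr1 => ->.
Qed.

Lemma val_inj_exp a b n : (a < Om)%O -> (b < Om)%O -> On_exp p a n = b <-> val a ^+ n = val b.
Proof.
move=> aO bO; have [eO eE] := val_exp n aO; split=> [<-|E]; first by rewrite eE.
by apply: (@ord_val_inj _ _ charC) => //; rewrite eE.
Qed.

Lemma Om_surj x : exists2 a, (a < Om)%O & val a = x.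
Proof.
have [k xk] := towerF_all (dgr_gt0 algebraicC x) (fixF_dgr algebraicC x).
have [a ak <-] := ord_val_surj xk; exists a => //; exact: (sb_lt_omega3 charC ak).
Qed.

Lemma zeta_spec : (zeta p u < Om)%O /\ val (zeta p u) ^+ u = 1 /\ val (zeta p u) != 1.
Proof.
have O1 : (onat 1 < Om)%O := onat_omega3 charC 1.
have v1 : val (onat 1) = 1 by rewrite (ord_val_nat charC).
set P := [set z : Ord | [/\ (z < Om)%O, On_exp p z u = onat 1
    & forall k, (0 < k < u)%N -> On_exp p z k <> onat 1]]%classic.
have [zO zu zk] : P (zeta p u).
  apply: xgetPex; have [x xu xk] := primitive_root_exists.
  have [a aO ax] := Om_surj x; exists a; split=> //.
    by apply/(val_inj_exp _ aO O1); rewrite ax v1.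
  by move=> k /xk /eqP xk1 /(val_inj_exp _ aO O1); rewrite ax v1.
split=> //; split; first by rewrite -v1; apply/(val_inj_exp _ zO O1).
apply/eqP => z1; apply: (zk 1%N) => //; apply/(val_inj_exp _ zO O1).
by rewrite expr1 z1.
Qed.

Local Notation z := (val (zeta p u)).
Local Notation f := (zeta_deg p u).
Local Notation k := (count prime (iota 0 u)).
Local Notation B := (chi_field p u).

Let zO : (zeta p u < Om)%O. Proof. by have [] := zeta_spec. Qed.
Let zu : z ^+ u = 1. Proof. by have [_ []] := zeta_spec. Qed.
Let z1 : z != 1. Proof. by have [_ []] := zeta_spec. Qed.

Lemma zeta_degE : f = dgr z. Proof. exact: deg_val. Qed.

Lemma chi_field_val a : (a < Om)%O -> (a < B)%O = (val a \in K u 0).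
Proof.
move=> aO; rewrite /chi_field -(sbound0 p prm k) (ord_val_tower charC) //.
by rewrite prm_count.
Qed.

Lemma chi_field_Om a : (a < B)%O -> (a < Om)%O.
Proof. by rewrite /chi_field -(sbound0 p prm k); exact: (sb_lt_omega3 charC). Qed.

Lemma chi_spec h : (exists2 a, (a < Om)%O & (h %| dgr (val a))%N) ->
  [/\ (chi p h < Om)%O, (h %| dgr (val (chi p h)))%N &
    forall a, (a < Om)%O -> (h %| dgr (val a))%N -> (chi p h <= a)%O].
Proof.
move=> [a aO ha].
have [] := @oleast_in [set a | (a < Om)%O /\ (h %| deg p a)%N]%classic.
  by exists a; split=> //; rewrite deg_val.
rewrite -/(chi p h) => cO; rewrite deg_val // => hc; split=> // b bO hb.
apply: (@oleast_le [set a | (a < Om)%O /\ (h %| deg p a)%N]%classic).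
by split=> //; rewrite deg_val.
Qed.

Lemma chi_zeta : [/\ (chi p f < Om)%O, (f %| dgr (val (chi p f)))%N &
    forall a, (a < Om)%O -> (f %| dgr (val a))%N -> (chi p f <= a)%O].
Proof. by apply: chi_spec; exists (zeta p u) => //; rewrite zeta_degE. Qed.

Lemma On_expE a b : (a < B)%O -> (b < B)%O -> On_exp p b u = a <-> val b ^+ u = val a.
Proof. by move=> /chi_field_Om aO /chi_field_Om bO; exact: val_inj_exp. Qed.

Lemma rootless_block : exists b, [/\ (b < B)%O, same_block (chi p f) b &
  forall y, y \in K u 0 -> y ^+ u <> val b].
Proof.
have [cO fc cmin] := chi_zeta.
have zK : z \in K u 0 := unity_root_tower algebraicC pu up zu z1.
have zB : (zeta p u < B)%O by rewrite chi_field_val.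
have cB : (chi p f < B)%O.
  by apply: le_lt_trans (cmin _ zO _) zB; rewrite zeta_degE.
rewrite zeta_degE in fc cmin cB cO *; set c := chi p _ in fc cmin cB cO *.
have [[j zj]|zn] := pselect (exists j, dgr z = 2 ^ j)%N.
  have [x [xu x1 xr]] := rootless_pow2 pu up zu z1 zj.
  have [b bO bx] := Om_surj x; exists b; split; rewrite ?bx //.
    by rewrite chi_field_val // bx.
  (* When f(u) is a power of 2, zeta_u is a finite ordinal; it bounds chi_(f(u)), which is therefore
     finite too. *)
  apply/(ord_val_block charC) => //; rewrite bx rpredB //.
  rewrite -(ord_val_tower charC) //; apply: le_lt_trans (cmin _ zO (dvdnn _)) _.
  rewrite (ord_val_tower charC) //; apply: (@pow2_tower _ _ charC j).
  by rewrite -zj fixF_dgr.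
have cK : val c \in K u 0 by rewrite -chi_field_val.
have [|m m1 mr] := rootless_translate pu zu z1 cK fc.
  by move=> j zj; apply: zn; exists j.
have [b bO bx] := Om_surj (val c + m); exists b; split; rewrite ?bx //.
  rewrite chi_field_val // bx rpredD //.
  (* For u = 2 the degree of zeta_u is 1 = 2^0, the case already treated; so u > 2, and chi_u
     contains the finite ordinals. *)
  have k0 : (0 < k)%N.
    rewrite lt0n; apply/eqP => k0; apply: zn; exists 0%N; apply/eqP.
    have u2 : u = 2%N by rewrite -(prm_count pu) k0 prm0.
    have /andP[d0 du] := unity_degree_small algebraicC pu up zu z1.
    by rewrite expn0 eqn_leq d0 andbT -ltnS (leq_trans du) // {1}u2.
  by rewrite -(prm_count pu); exact: tower1_sub.
by apply/(ord_val_block charC) => //; rewrite bx addrC addKr.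
Qed.

(** By [root_of_degree], f(u) divides the degree of alpha_u, so chi_(f(u)) <= alpha_u; by minimality
    alpha_u <= b for the non-power [b] of the same block. The finite gap gives m, and the coset
    description of the block gives m'. *)
Lemma alpha_spec : exists m m' : nat,
  alpha p u = oadd (chi p f) (onat m) /\ alpha p u = On_add p (chi p f) (onat m').
Proof.
have [cO fc cmin] := chi_zeta.
have [b [bB cb bn]] := rootless_block; set c := chi p f in cO fc cmin cb *.
pose P : set Ord := [set a | (a < B)%O /\ ~ exists b, (b < B)%O /\ On_exp p b u = a]%classic.
have Pb : P b.
  split=> // -[y [yB /(On_expE bB yB) yE]]; apply: (bn (val y)) => //.
  by rewrite -chi_field_val // chi_field_Om.
have [aB aN] : P (alpha p u) by apply: oleast_in; exists b.
have ab : (alpha p u <= b)%O by exact: (@oleast_le P).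
have aO := chi_field_Om aB.
have aK : val (alpha p u) \in K u 0 by rewrite -chi_field_val.
have ca : (c <= alpha p u)%O.
  apply: cmin => //; rewrite zeta_degE; apply: contrapT => /negP nd.
  have [y yK yE] := root_of_degree pu zu z1 aK nd.
  have [d dO dy] := Om_surj y; apply: aN; exists d.
  have dB : (d < B)%O by rewrite chi_field_val // dy.
  by split=> //; apply/(On_expE aB dB); rewrite dy.
have [g [m [n [cE bE]]]] := cb.
have [d dE] := oadd_sub ca.
have gd : (oadd (onat m) d <= onat n)%O.
  by rewrite -(oadd_le (omul omega g)) oaddA -cE -dE -bE.
have [l dl] : exists l, d = onat l.
  have /lt_onat[l _ ->] : (d < onat n.+1)%O; last by exists l.
  by rewrite ltSle; apply: le_trans gd; exact: le_oaddl.
have cal : same_block c (alpha p u).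
  by exists g, m, (m + l)%N; split; rewrite // dE dl -oadd_nat oaddA -cE.
have /(ord_val_block charC cO aO) := cal.
rewrite -(expn0 1) => diff.
have [e ew eE] := ord_val_surj diff.
have /lt_omega[m' em'] : (e < omega)%O by rewrite -(sbound10 p1 prm).
exists l, m'; split; first by rewrite dE dl.
have [sO _ sE _] := ord_val_op charC cO (onat_omega3 charC m').
by apply: (@ord_val_inj _ _ charC) => //; rewrite sE -em' eE addrC subrK.
Qed.

End Transfer.

Theorem theorem4p6 (p : nat) (hp : prime p) (u : nat) (hu : prime u)
    (hup : u <> p) :
  exists m m' : nat,
    alpha p u = oadd (chi p (zeta_deg p u)) (onat m) /\
    alpha p u = On_add p (chi p (zeta_deg p u)) (onat m').
Proof.
have [C [incl intC]] := countable_algebraic_closure 'F_p.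
have charC : p \in [pchar C]%R.
  by rewrite (fmorph_pchar incl) pchar_Fp.
have up : u != p by apply/eqP.
apply: (@alpha_spec C p charC incl _ u hu up) => x.
have [q qm qx] := intC x.
have qF : map_poly incl q \is a polyOver (fixF charC 1).
  apply/polyOverP => j; rewrite coef_map /= -[(q`_j)%R]natr_Zp rmorph_nat.
  exact: rpred_nat.
(* An element algebraic over ['F_p] has a finite Frobenius orbit, which is the hypothesis
   [algebraicC]. *)
have [|r /andP[r0 _] xr] := root_degree qF _ qx.
  by rewrite map_poly_eq0 monic_neq0.
by exists r => //; rewrite -(mul1n r).
Qed.
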